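(* Let $n\ge 1$, $A\in GL_n(\mathbb{Z})$, and let $M$ be the associated $n$-torus bundle over $S^1$. The space of $L^2$ functions on $M$ decomposes as $$L^2(M)=\left(\widehat{\bigoplus_{\substack{\mathrm{Orb}_{\mathbf y}\in\mathcal{O}\\ |\mathrm{Orb}_{\mathbf y}|=\infty}}}\mathcal{H}_{\mathbf y}\right)\oplus\left(\widehat{\bigoplus_{\substack{\mathrm{Orb}_{\mathbf y}\in\mathcal{O}\\ |\mathrm{Orb}_{\mathbf y}|=N<\infty}}}\ \widehat{\bigoplus_{t_0\in\mathbb{Z}}}\ \mathcal{H}_{t_0,\mathbf y}\right),$$ where $$\mathcal{H}_{\mathbf y}=\left\{\sum_{\xi\in\mathbb{Z}}f(t+\xi)e^{2\pi i\,\mathbf y\cdot A^\xi\mathbf x}\;\middle|\;f\in L^2(\mathbb{R})\right\}$$ and, with $N=|\mathrm{Orb}_{\mathbf y}|$, $$\mathcal{H}_{t_0,\mathbf y}=\left\{C e^{2\pi i\frac{t_0t}{N}}\sum_{\xi=0}^{N-1}e^{2\pi i\left(\frac{t_0\xi}{N}+\mathbf y\cdot A^\xi\mathbf x\right)}\;\middle|\;C\in\mathbb{C}\right\}.$$ Here $\widehat{\bigoplus}$ denotes the direct sum followed by the closure with respect to the $L^2$ norm.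
   Context: $M$ is the quotient of $\mathbb{R}^{n+1}$, with coordinates $(t,\mathbf x)$, $t\in\mathbb{R}$, $\mathbf x\in\mathbb{R}^n$, by the identifications $(t,\mathbf x)\sim(t,\mathbf x+\eta)$ and $(t,\mathbf x)\sim(t+\xi,A^\xi\mathbf x)$ for all $\eta\in\mathbb{Z}^n$, $\xi\in\mathbb{Z}$. Complex-valued functions on $M$ are identified with functions $f$ on $\mathbb{R}^{n+1}$ satisfying $f(t,\mathbf x)=f(t,\mathbf x+\eta)$ and $f(t,\mathbf x)=f(t+\xi,A^\xi\mathbf x)$ for all such $\eta,\xi$. $L^2(M)$ is taken with respect to the measure induced by Lebesgue measure $dt\,d\mathbf x$ on the fundamental domain $[0,1]\times[0,1]^n$. For $\mathbf y\in\mathbb{Z}^n$, $\mathrm{Orb}_{\mathbf y}=\{(A^T)^\xi\mathbf y\mid\xi\in\mathbb{Z}\}$, and $\mathcal{O}$ is the set of all such orbits (a partition of $\mathbb{Z}^n$); in sums over $\mathcal{O}$ one representative $\mathbf y$ is chosen from each orbit. *)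

(* Defs.v *)
From HB Require Import structures.
From mathcomp Require Import all_boot all_order all_algebra finmap.
From mathcomp Require Import all_classical all_reals all_analysis.
From mathcomp Require Import complex.
From mathcomp.analysis.showcase Require Import summability.

Set Implicit Arguments.
Unset Strict Implicit.
Unset Printing Implicit Defensive.

Import Order.TTheory GRing.Theory Num.Theory.
Import numFieldNormedType.Exports.
Import ComplexField.

Local Open Scope classical_set_scope.
Local Open Scope ring_scope.

(* The product sigma-algebra on R^n, generated by the coordinates; this is the
   Borel sigma-algebra, R being separable. *)
Definition measure_cV_display : measure_display.
Proof. exact: default_measure_display. Qed.

Section measurable_cV.
Variables (R : realType) (n : nat).

Let coord (i : 'I_n) (x : 'cV[R]_n) : measurableTypeR R := x i 0.

Let cV_set0 : g_sigma_preimage coord set0.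
Proof. exact: sigma_algebra0. Qed.

Let cV_setC B : g_sigma_preimage coord B -> g_sigma_preimage coord (~` B).
Proof. exact: sigma_algebraC. Qed.

Let cV_bigcup (F : (set 'cV[R]_n)^nat) :
  (forall i, g_sigma_preimage coord (F i)) ->
  g_sigma_preimage coord (\bigcup_i (F i)).
Proof. exact: sigma_algebra_bigcup. Qed.

HB.instance Definition _ := @isMeasurable.Build measure_cV_display
  'cV[R]_n (g_sigma_preimage coord) cV_set0 cV_setC cV_bigcup.

Lemma measurable_coord (i : 'I_n) :
  measurable_fun [set: 'cV[R]_n] (fun x => x i 0 : measurableTypeR R).
Proof.
move=> _ Y mY; rewrite setTI; apply: sub_sigma_algebra => /=.
rewrite -bigcup_seq/=; exists i => /=; first by rewrite mem_index_enum.
by exists Y => //; rewrite setTI.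
Qed.

Lemma measurable_fun_coordP d (T : measurableType d) (f : T -> 'cV[R]_n) :
  (forall i, measurable_fun [set: T] (fun x => f x i 0 : measurableTypeR R)) ->
  measurable_fun [set: T] f.
Proof.
move=> mf; apply: (@measurability _ _ _ _ _ _
  (\big[setU/set0]_(i < n) preimage_set_system setT (coord i) measurable)) => //.
move=> _ [S + <-]; rewrite -bigcup_seq/= => -[i _ [B mB <-]].
by rewrite !setTI; have := mf i measurableT B mB; rewrite setTI.
Qed.

End measurable_cV.

Section lebesgue_cV.
Variable R : realType.
Local Open Scope ereal_scope.

Definition cons_cV n (p : R * 'cV[R]_n) : 'cV[R]_n.+1 :=
  \col_i (if unlift ord0 i is Some j then p.2 j 0%R else p.1).

Definition uncons_cV n (x : 'cV[R]_n.+1) : R * 'cV[R]_n :=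
  (x ord0 0%R, \col_i x (lift ord0 i) 0%R).

Lemma cons_cVK n : cancel (@cons_cV n) (@uncons_cV n).
Proof.
move=> [t x]; rewrite /cons_cV /uncons_cV /= mxE unlift_none; congr pair.
by apply/colP => i; rewrite !mxE liftK.
Qed.

Lemma measurable_cons_cV n : measurable_fun setT (@cons_cV n).
Proof.
apply: measurable_fun_coordP => i; rewrite /cons_cV.
under eq_fun do rewrite mxE.
case: (unlift ord0 i) => [j|]; last exact: measurable_fst.
by apply: (measurableT_comp (measurable_coord j)); exact: measurable_snd.
Qed.

Lemma measurable_uncons_cV n : measurable_fun setT (@uncons_cV n).
Proof.
apply: measurable_fun_pair; first exact: measurable_coord.
apply: measurable_fun_coordP => i.
under eq_fun do rewrite mxE.
exact: measurable_coord.
Qed.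

Section step.
Variables (n : nat) (mu : {sigma_finite_measure set 'cV[R]_n -> \bar R}).

Definition lebesgue_cons : set 'cV[R]_n.+1 -> \bar R :=
  pushforward (@lebesgue_measure R \x mu) (@cons_cV n).

Let nu0 : lebesgue_cons set0 = 0.
Proof. by rewrite /lebesgue_cons /pushforward preimage_set0 measure0. Qed.

Let nu_ge0 B : 0 <= lebesgue_cons B.
Proof. by rewrite /lebesgue_cons /pushforward; apply: measure_ge0. Qed.

Let nu_sigma_additive : semi_sigma_additive lebesgue_cons.
Proof.
move=> F mF tF mUF; rewrite /lebesgue_cons /pushforward preimage_bigcup.
apply: measure_semi_sigma_additive.
- by move=> k; rewrite -[X in measurable X]setTI; exact: measurable_cons_cV.
- apply/trivIsetP => /= i j _ _ ij; rewrite -preimage_setI.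
  by move/trivIsetP : tF => /(_ _ _ _ _ ij) ->//; rewrite preimage_set0.
- by rewrite -preimage_bigcup -[X in measurable X]setTI;
    exact: measurable_cons_cV.
Qed.

HB.instance Definition _ := isMeasure.Build _ _ _ lebesgue_cons
  nu0 nu_ge0 nu_sigma_additive.

Let nu_sigma_finite : sigma_finite setT lebesgue_cons.
Proof.
have /sigma_finiteP[F [TF ndF Foo]] := sigma_finiteT (@lebesgue_measure R).
have /sigma_finiteP[G [TG ndG Goo]] := sigma_finiteT mu.
exists (fun k => @uncons_cV n @^-1` (F k `*` G k)).
  rewrite -preimage_bigcup -[LHS](preimage_setT (@uncons_cV n)).
  congr preimage; rewrite -setXTT TF TG predeqE => -[x y]; split.
    move=> [/= [a _ Fax] [b _ Gby]]; exists (maxn a b) => //; split.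
    - by move: x Fax; exact/subsetPset/ndF/leq_maxl.
    - by move: y Gby; exact/subsetPset/ndG/leq_maxr.
  by move=> [a _ []/= ? ?]; split; exists a.
move=> k; have [mF Fk] := Foo k; have [mG Gk] := Goo k; split.
  rewrite -[X in measurable X]setTI; apply: measurable_uncons_cV => //.
  exact: measurableX.
rewrite /lebesgue_cons /pushforward -comp_preimage.
rewrite (_ : _ \o _ = id); last by apply/funext => p; exact: cons_cVK.
by rewrite preimage_id product_measure1E// lte_mul_pinfty// ge0_fin_numE.
Qed.

HB.instance Definition _ := Measure_isSigmaFinite.Build _ _ _ lebesgue_cons
  nu_sigma_finite.

End step.

(* n-dimensional Lebesgue measure; 'cV[R]_0 is a point. *)
Fixpoint lebesgue_cV n : {sigma_finite_measure set 'cV[R]_n -> \bar R} :=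
  if n is m.+1 then lebesgue_cons (lebesgue_cV m) else \d_(0%R : 'cV[R]_0).

End lebesgue_cV.

Section complex_L2.
Context d (T : measurableType d) (R : realType).
Variable mu : {measure set T -> \bar R}.

Definition L2norm (F : T -> R[i]) : \bar R :=
  'N[mu]_(2%:E) [EFin \o (fun z => Normc.normc (F z))].

(* Elements of L^2 are represented by functions; almost everywhere equal
   functions are not identified, see [ae_zero]. *)
Definition L2 : set (T -> R[i]) :=
  [set F | [/\ measurable_fun setT (fun z => complex.Re (F z)),
               measurable_fun setT (fun z => complex.Im (F z))
             & (L2norm F < +oo)%E]].

Definition ae_zero (F : T -> R[i]) : Prop := {ae mu, forall z, F z = 0}.

End complex_L2.

Section torus_bundle.
Variables (R : realType) (n : nat).
Local Notation space := (measurableTypeR R * 'cV[R]_n)%type.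

Definition fundamental_domain : set space :=
  [set z : space | 0 <= z.1 <= 1 /\ forall i, 0 <= z.2 i 0 <= 1].

Lemma measurable_fundamental_domain : measurable fundamental_domain.
Proof.
have -> : fundamental_domain =
    `[0, 1]%classic `*`
    \bigcap_(i in [set: 'I_n]) (fun x : 'cV[R]_n => x i 0) @^-1` `[0, 1]%classic.
  rewrite predeqE => -[t x]; rewrite /fundamental_domain /=; split.
    move=> [t01 x01]; split; first by rewrite /= in_itv.
    by move=> i _ /=; rewrite in_itv; exact: x01.
  move=> [t01 x01]; split; first by move: t01; rewrite /= in_itv.
  by move=> i; have := x01 i I; rewrite /= in_itv.
apply: measurableX => //; apply: fin_bigcap_measurable => // i _.
by rewrite -[X in measurable X]setTI; exact: measurable_coord.
Qed.

Definition bundle_measure : {measure set space -> \bar R} :=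
  mrestr (@lebesgue_measure R \x @lebesgue_cV R n)%E
    measurable_fundamental_domain.


Definition to_R p q (B : 'M[int]_(p, q)) : 'M[R]_(p, q) :=
  map_mx (fun m : int => m%:~R) B.

Definition expi2pi (theta : R) : R[i] :=
  (cos (2 * pi * theta) +i* sin (2 * pi * theta))%C.

Definition dot (u v : 'cV[R]_n) : R := \sum_i u i 0 * v i 0.

End torus_bundle.

Section decomposition.
Variables (R : realType) (n : nat) (A : 'M[int]_n.+1).
Local Notation space := (measurableTypeR R * 'cV[R]_n.+1)%type.
Local Notation mu := (@bundle_measure R n.+1).
Implicit Types (F : space -> R[i]) (y : 'cV[int]_n.+1) (xi : int).

Definition bundle_function F : Prop := forall (t : R) (x : 'cV[R]_n.+1),
  (forall eta : 'cV[int]_n.+1, F (t, x) = F (t, x + to_R R eta)) /\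
  (forall xi, F (t, x) = F (t + xi%:~R, to_R R (A ^ xi) *m x)).

Definition L2_bundle : set (space -> R[i]) :=
  [set F | bundle_function F /\ L2 mu F].

Definition bundle_subspace (W : set (space -> R[i])) : Prop :=
  [/\ W `<=` L2_bundle, W (fun=> 0) &
      forall (a : R[i]) F G, W F -> W G -> W (fun z => a * F z + G z)].

(* The V i, i in D, are linear subspaces of L^2(M) whose algebraic sum is
   direct, modulo almost everywhere equality. *)
Definition direct_family (I : choiceType) (D : set I)
    (V : I -> set (space -> R[i])) : Prop :=
  (forall i, D i -> bundle_subspace (V i)) /\
  forall (J : {fset I}) (G : I -> space -> R[i]),
    (forall i, i \in J -> D i /\ V i (G i)) ->
    ae_zero mu (fun z => \sum_(i <- J) G i z) ->
    forall i, i \in J -> ae_zero mu (G i).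

(* The L^2-closure in L^2(M) of the algebraic sum of the V i, i in D. *)
Definition closed_sum (I : choiceType) (D : set I)
    (V : I -> set (space -> R[i])) : set (space -> R[i]) :=
  [set F | L2_bundle F /\
    forall e : R, 0 < e -> exists (J : {fset I}) (G : I -> space -> R[i]),
      (forall i, i \in J -> D i /\ V i (G i)) /\
      (L2norm mu (fun z => (F z - \sum_(i <- J) G i z)%R) < e%:E)%E].

Definition lattice_orbit y : set 'cV[int]_n.+1 :=
  range (fun xi => A^T ^ xi *m y).

Definition orbits : set (set 'cV[int]_n.+1) := range lattice_orbit.

Definition infinite_orbits : set (set 'cV[int]_n.+1) :=
  [set o | orbits o /\ infinite_set o].

Definition finite_orbits : set (set 'cV[int]_n.+1) :=
  [set o | orbits o /\ finite_set o].

Definition orbit_size y : nat := #|` fset_set (lattice_orbit y)|.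

Definition phase y xi (x : 'cV[R]_n.+1) : R :=
  dot (to_R R y) (to_R R (A ^ xi) *m x).

(* F is the sum of the series with general term f(t + xi) e^(2 pi i y.A^xi x),
   xi in Z, in the sense of unconditional convergence in L^2(M): for f in
   L^2(R) the series need not converge absolutely at a given point. Its finite
   partial sums are not functions on M, but L^2(M) is L^2 of the fundamental
   domain. *)
Definition is_series_sum y (f : measurableTypeR R -> R[i]) F : Prop :=
  L2_bundle F /\
  L2norm mu (fun z => F z - partial_sum
    (fun xi => f ((z.1 : R) + xi%:~R) * expi2pi (phase y xi z.2)) J)
    @[J --> totally] --> 0%E.

(* H_infinite is saturated under almost everywhere equality within L^2(M);
   H_finite consists of the literal (continuous) functions on R^(n+1). *)
Definition H_infinite y : set (space -> R[i]) :=
  [set F | exists2 f, L2 (@lebesgue_measure R) f & is_series_sum y f F].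

Definition H_finite y (t0 : int) : set (space -> R[i]) :=
  let N := orbit_size y in
  range (fun (C : R[i]) (z : space) =>
    C * expi2pi (t0%:~R * (z.1 : R) / N%:R) *
    \sum_(xi < N) expi2pi (t0%:~R * xi%:R / N%:R + phase y xi z.2)).

End decomposition.

(* Main.v *)
From HB Require Import structures.
Require Import Defs.
From mathcomp Require Import all_boot all_order all_algebra finmap.
From mathcomp Require Import all_classical all_reals all_analysis.
From mathcomp Require Import complex.
From mathcomp Require Import measurable_realfun ring lra.
From mathcomp.analysis.showcase Require Import summability.

(** The modes f(t) e^(2 pi i m.x), for a frequency m in Z^n and f in L^2([0, 1]), span
   L^2 of the fundamental domain, and modes of distinct frequencies are orthogonal,
   since a nontrivial character integrates to zero over the cube ([mode_orthogonal]).
   The general term f(t + xi) e^(2 pi i y.A^xi x) is a mode of frequency (A^T)^xi y: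
   the gluing of M moves frequencies along the orbits of A^T, so every summand of the
   theorem lies in the closed span of the modes of one orbit. Distinct orbits are
   disjoint, hence give orthogonal spaces ([mode_space_orthogonal]), and orthogonality
   gives all the directness claims except the one inside a single finite orbit.

   For an infinite orbit the frequencies (A^T)^xi y are pairwise distinct, so that the
   terms of the series are orthogonal. Their squared norms are the integrals of |f|^2
   over the intervals [xi, xi + 1], which add up to the squared norm of f, and the
   series converges because L^2 is complete ([series_sum_exists]). The limit is a
   function on the fundamental domain; it is transported to a function on M through
   the reduction of a point modulo the identifications ([periodize]).

   For a finite orbit of size N the sum over xi wraps around and only sees N-periodic
   functions of t, with basis e^(2 pi i t0 s / N). The spaces H_{t0, y} are orthogonal
   because the integrals over the N unit intervals add up to the integral of a
   nontrivial exponential over a period, a telescoping sum ([H_finite_orthogonal]).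

   It remains to see that nothing is missed. The characters e^(2 pi i (k t + m.x)) span
   a dense subspace ([characters_dense]) and the sum of two orthogonal closed subspaces
   is closed ([orthogonal_sum_closed]), so it is enough to find each character, up to a
   null set, in one of the two summands. In an infinite orbit, f is the wave
   e^(2 pi i k s) cut off to one unit interval ([character_infinite]). In a finite one
   the wave is cut off to the N-periodic translates of a unit interval, and this
   function is a bounded pointwise limit of trigonometric polynomials of period N
   ([character_finite]).

   Both this last limit and the density of the characters come from one device: in an
   algebra of bounded functions containing the constants, the indicator of {f > 0} is
   a pointwise limit of elements with values in [0, 1] ([cspan_superlevel]). If such
   superlevel sets generate the sigma-algebra, a monotone class argument shows that the
   algebra is dense in L^2 ([cspan_dense]).

   Only the real part of the Hermitian product is used: for complex subspaces it
   defines the same orthogonality and the same norm. *)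

Set Implicit Arguments.
Unset Strict Implicit.
Unset Printing Implicit Defensive.

Import Order.TTheory GRing.Theory Num.Theory.
Import numFieldNormedType.Exports.

Local Open Scope classical_set_scope.
Local Open Scope ring_scope.

(** * The real inner product of complex-valued L^2 functions *)

Section L2_theory.
Context d (T : measurableType d) (R : realType) (mu : {measure set T -> \bar R}).
Implicit Types (F G H : T -> R[i]) (a : R[i]).
Notation Re := complex.Re.
Notation Im := complex.Im.

(** The real part of z times the conjugate of w. *)
Definition cdot (z w : R[i]) : R := Re z * Re w + Im z * Im w.

Lemma cdotC z w : cdot z w = cdot w z.
Proof. by rewrite /cdot; ring. Qed.

Lemma cdot0l z : cdot 0 z = 0.
Proof. by rewrite /cdot /= !mul0r addr0. Qed.

Lemma cdotDl z z' w : cdot (z + z') w = cdot z w + cdot z' w.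
Proof. by case: z z' w => [? ?] [? ?] [? ?]; rewrite /cdot /=; ring. Qed.

Lemma cdotNl z w : cdot (- z) w = - cdot z w.
Proof. by case: z w => [? ?] [? ?]; rewrite /cdot /=; ring. Qed.

Lemma cdotZl (r : R) z w : cdot (r%:C%C * z) w = r * cdot z w.
Proof. by case: z w => [? ?] [? ?]; rewrite /cdot /=; ring. Qed.

Lemma cdotMM a z : cdot (a * z) (a * z) = cdot a a * cdot z z.
Proof. by case: z a => [? ?] [? ?]; rewrite /cdot /=; ring. Qed.

Lemma cdot_ge0 z : 0 <= cdot z z.
Proof. by rewrite /cdot -!expr2 addr_ge0 ?sqr_ge0. Qed.

Lemma cdot_eq0 z : cdot z z = 0 -> z = 0.
Proof.
case: z => x y /eqP; rewrite /cdot/= -!expr2 paddr_eq0 ?sqr_ge0 // !sqrf_eq0.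
by move=> /andP[/eqP-> /eqP->].
Qed.

Lemma cdot_normc z : Normc.normc z ^+ 2 = cdot z z.
Proof. by case: z => x y; rewrite sqr_sqrtr // addr_ge0 ?sqr_ge0. Qed.

Lemma cdot_le z w : `|cdot z w| <= cdot z z + cdot w w.
Proof.
case: z w => x y [u v]; rewrite /cdot /=.
have := sqr_ge0 (x - u); have := sqr_ge0 (y - v).
have := sqr_ge0 (x + u); have := sqr_ge0 (y + v).
have := sqr_ge0 x; have := sqr_ge0 y; have := sqr_ge0 u; have := sqr_ge0 v.
by rewrite ler_norml; nra.
Qed.

Lemma cdotDD_le z w : cdot (z + w) (z + w) <= 2 * (cdot z z + cdot w w).
Proof.
case: z w => x y [u v]; rewrite /cdot /=.
by have := sqr_ge0 (x - u); have := sqr_ge0 (y - v); nra.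
Qed.

(** Measurability for the Borel structure of the plane, one coordinate at a time. *)
Definition measC F : Prop := measurable_fun setT (fun z => Re (F z)) /\
  measurable_fun setT (fun z => Im (F z)).

Lemma measC_cst a : measC (fun=> a).
Proof. by split; exact: measurable_cst. Qed.

Lemma measCD F G : measC F -> measC G -> measC (fun z => F z + G z).
Proof.
move=> [mF nF] [mG nG]; split.
  by under eq_fun do rewrite raddfD; exact: measurable_funD.
by under eq_fun do rewrite raddfD; exact: measurable_funD.
Qed.

Lemma measCM F G : measC F -> measC G -> measC (fun z => F z * G z).
Proof.
move=> [mF nF] [mG nG]; split.
  rewrite (_ : (fun z => _) = (fun z => Re (F z) * Re (G z) - Im (F z) * Im (G z))).
    by apply: measurable_funB; exact: measurable_funM.
  by apply/funext => z; case: (F z) (G z) => [? ?] [? ?].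
rewrite (_ : (fun z => _) = (fun z => Re (F z) * Im (G z) + Im (F z) * Re (G z))).
  by apply: measurable_funD; exact: measurable_funM.
by apply/funext => z; case: (F z) (G z) => [? ?] [? ?].
Qed.

Lemma measurable_cdot F G : measC F -> measC G ->
  measurable_fun setT (fun z => cdot (F z) (G z)).
Proof.
by move=> [mF nF] [mG nG]; apply: measurable_funD; exact: measurable_funM.
Qed.

Lemma normc_ge0 z : 0 <= Normc.normc z :> R.
Proof. by case: z => x y; exact: sqrtr_ge0. Qed.

Lemma L2normE F : L2norm mu F = sqrte (\int[mu]_z (cdot (F z) (F z))%:E)%E.
Proof.
rewrite /L2norm unlock /= poweR12_sqrt; last first.
  by apply: integral_ge0 => z _; rewrite lee_fin powR_ge0.
congr sqrte; apply: eq_integral => z _ /=.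
by rewrite ger0_norm ?normc_ge0 // -cdot_normc powR_mulrn // normc_ge0.
Qed.

(** Membership in L^2 as integrability of the squared modulus, which is the form that
   products, domination and convergence theorems consume. *)
Lemma L2P F : L2 mu F <->
  measC F /\ mu.-integrable setT (EFin \o (fun z => cdot (F z) (F z))).
Proof.
have I0 : (0 <= \int[mu]_z (cdot (F z) (F z))%:E)%E.
  by apply: integral_ge0 => z _; rewrite lee_fin cdot_ge0.
have key : (L2norm mu F < +oo)%E = (\int[mu]_z (cdot (F z) (F z))%:E < +oo)%E.
  rewrite L2normE -!ge0_fin_numE ?sqrte_ge0 //.
  exact: sqrte_fin_num.
have absE : (\int[mu]_z `|(EFin \o (fun z => cdot (F z) (F z))) z| =
             \int[mu]_z (cdot (F z) (F z))%:E)%E.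
  by apply: eq_integral => z _ /=; rewrite ger0_norm ?cdot_ge0.
split.
  move=> [mF nF]; rewrite key => Foo; have mcF : measC F by [].
  split=> //; apply/integrableP; split; last by rewrite absE.
  by apply/measurable_EFinP; exact: measurable_cdot.
by move=> [[mF nF] /integrableP[_ Foo]]; split; rewrite // key -absE.
Qed.

Lemma L2_meas F : L2 mu F -> measC F. Proof. by move/L2P => []. Qed.

Lemma L2_integrable F G : L2 mu F -> L2 mu G ->
  mu.-integrable setT (EFin \o (fun z => cdot (F z) (G z))).
Proof.
move=> /L2P[mF iF] /L2P[mG iG].
apply: (le_integrable _ _ _ (integrableD measurableT iF iG)) => //.
  by apply/measurable_EFinP; exact: measurable_cdot.
move=> z _ /=; rewrite lee_fin (le_trans (cdot_le _ _)) //.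
by rewrite ger0_norm // addr_ge0 // cdot_ge0.
Qed.

Lemma L2_dominated F G : measC F -> L2 mu G ->
  (forall z, cdot (F z) (F z) <= cdot (G z) (G z)) -> L2 mu F.
Proof.
move=> mF /L2P[mG iG] FG; apply/L2P; split => //.
apply: (le_integrable _ _ _ iG) => //.
  by apply/measurable_EFinP; exact: measurable_cdot.
by move=> z _ /=; rewrite lee_fin !ger0_norm ?cdot_ge0.
Qed.

Lemma L2D F G : L2 mu F -> L2 mu G -> L2 mu (fun z => F z + G z).
Proof.
move=> /L2P[mF iF] /L2P[mG iG]; apply/L2P; split; first exact: measCD.
have iFG := integrableZl measurableT 2 (integrableD measurableT iF iG).
apply: (le_integrable _ _ _ iFG) => //.
  by apply/measurable_EFinP; apply: measurable_cdot; exact: measCD.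
move=> z _ /=; rewrite lee_fin ger0_norm ?cdot_ge0 //.
by rewrite (le_trans (cdotDD_le _ _)) // ler_norm.
Qed.

Lemma L2Z a F : L2 mu F -> L2 mu (fun z => a * F z).
Proof.
move=> /L2P[mF iF]; apply/L2P; split; first exact: (measCM (measC_cst a)).
have := integrableZl measurableT (cdot a a) iF.
by apply: eq_integrable => // z _ /=; rewrite cdotMM EFinM.
Qed.

Lemma L2_0 : L2 mu (fun=> 0).
Proof.
apply/L2P; split; first exact: measC_cst.
have := integrable0 mu [set: T].
by apply: eq_integrable => // z _ /=; rewrite cdot0l.
Qed.

Lemma L2B F G : L2 mu F -> L2 mu G -> L2 mu (fun z => F z - G z).
Proof.
move=> hF hG; have := L2D hF (L2Z (-1) hG).
by congr (L2 mu _); apply/funext => z; rewrite mulN1r.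
Qed.

Lemma L2_sum I (s : seq I) (G : I -> T -> R[i]) : (forall i, L2 mu (G i)) ->
  L2 mu (fun z => \sum_(i <- s) G i z).
Proof.
move=> hG; elim: s => [|i s IH].
  by under eq_fun do rewrite big_nil; exact: L2_0.
by under eq_fun do rewrite big_cons; exact: L2D.
Qed.

Lemma L2_sum_in (I : eqType) (s : seq I) (G : I -> T -> R[i]) :
  (forall i, i \in s -> L2 mu (G i)) -> L2 mu (fun z => \sum_(i <- s) G i z).
Proof.
elim: s => [|i s IH] hG.
  by under eq_fun do rewrite big_nil; exact: L2_0.
under eq_fun do rewrite big_cons; apply: L2D; first by apply: hG; rewrite mem_head.
by apply: IH => j js; apply: hG; rewrite inE js orbT.
Qed.

Definition ip F G : R := (\int[mu]_z cdot (F z) (G z))%R.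

Lemma ipC F G : ip F G = ip G F.
Proof. by apply: eq_Rintegral => z _; exact: cdotC. Qed.

Lemma ip0l G : ip (fun=> 0) G = 0.
Proof.
rewrite /ip -[RHS](Rintegral_set0 mu (fun=> 0)) /Rintegral integral_set0.
by rewrite integral0_eq // => z _; rewrite cdot0l.
Qed.

Lemma ipDl F G H : L2 mu F -> L2 mu G -> L2 mu H ->
  ip (fun z => F z + G z) H = ip F H + ip G H.
Proof.
move=> hF hG hH; rewrite /ip -RintegralD //; [|exact: L2_integrable..].
by apply: eq_Rintegral => z _; rewrite cdotDl.
Qed.

Lemma ipZl (r : R) F H : L2 mu F -> L2 mu H ->
  ip (fun z => r%:C%C * F z) H = r * ip F H.
Proof.
move=> hF hH; rewrite /ip -RintegralZl //; [|exact: L2_integrable].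
by apply: eq_Rintegral => z _; rewrite cdotZl.
Qed.

Lemma ipDr F G H : L2 mu F -> L2 mu G -> L2 mu H ->
  ip H (fun z => F z + G z) = ip H F + ip H G.
Proof. by move=> hF hG hH; rewrite ipC ipDl // ipC [ip G _]ipC. Qed.

Lemma ipZr (r : R) F H : L2 mu F -> L2 mu H ->
  ip H (fun z => r%:C%C * F z) = r * ip H F.
Proof. by move=> hF hH; rewrite ipC ipZl // ipC. Qed.

Lemma ipBl F G H : L2 mu F -> L2 mu G -> L2 mu H ->
  ip (fun z => F z - G z) H = ip F H - ip G H.
Proof.
move=> hF hG hH; rewrite /ip -RintegralB //; [|exact: L2_integrable..].
by apply: eq_Rintegral => z _; rewrite cdotDl cdotNl.
Qed.

Lemma ip_suml (I : eqType) (s : seq I) (G : I -> T -> R[i]) H :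
  (forall i, i \in s -> L2 mu (G i)) -> L2 mu H ->
  ip (fun z => \sum_(i <- s) G i z) H = \sum_(i <- s) ip (G i) H.
Proof.
move=> + hH; elim: s => [|i s IH] hG.
  by rewrite big_nil; under eq_fun do rewrite big_nil; exact: ip0l.
under eq_fun do rewrite big_cons.
have hGs j : j \in s -> L2 mu (G j) by move=> js; apply: hG; rewrite inE js orbT.
rewrite ipDl ?IH ?big_cons //; first by apply: hG; rewrite mem_head.
exact: L2_sum_in.
Qed.

Lemma ip_ge0 F : 0 <= ip F F.
Proof. by apply: Rintegral_ge0 => z _; exact: cdot_ge0. Qed.

Lemma ipZZ a F : L2 mu F ->
  ip (fun z => a * F z) (fun z => a * F z) = cdot a a * ip F F.
Proof.
move=> hF; rewrite /ip -RintegralZl //; [|exact: L2_integrable].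
by apply: eq_Rintegral => z _; rewrite cdotMM.
Qed.

(** The quadratic polynomial r |-> ip (F + r G) (F + r G) has no negative value; it is
   evaluated at its minimum, or far away when G has norm zero. *)
Lemma ip_cauchy_schwarz F G : L2 mu F -> L2 mu G -> ip F G ^+ 2 <= ip F F * ip G G.
Proof.
move=> hF hG.
have quad (r : R) : 0 <= ip F F + r * (ip F G *+ 2) + r ^+ 2 * ip G G.
  have hZ := L2Z r%:C%C hG.
  have hS := L2D hF hZ.
  rewrite (le_trans (ip_ge0 (fun z => F z + r%:C%C * G z))) //.
  rewrite ipDl // !ipDr // ipZl // !ipZr // ipZl // [ip G F]ipC.
  rewrite le_eqVlt; apply/orP; left; apply/eqP; ring.
have [G0|G0] := eqVneq (ip G G) 0.
  rewrite G0 mulr0.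
  have [->|FG0] := eqVneq (ip F G) 0; first by rewrite expr0n.
  have := quad (- (ip F F + 1) / (ip F G *+ 2)).
  rewrite G0 mulr0 addr0 divfK ?mulrn_eq0 //.
  by have := ip_ge0 F; lra.
have Gp : 0 < ip G G by rewrite lt_def G0 ip_ge0.
have := quad (- ip F G / ip G G).
have -> : ip F F + - ip F G / ip G G * (ip F G *+ 2) +
  (- ip F G / ip G G) ^+ 2 * ip G G = (ip F F * ip G G - ip F G ^+ 2) / ip G G.
  by field.
by rewrite pmulr_lge0 ?invr_gt0 // subr_ge0.
Qed.

(** The L^2 norm as a real number, see [L2norm_nrm]. *)
Definition nrm F : R := Num.sqrt (ip F F).

Lemma nrm_ge0 F : 0 <= nrm F. Proof. exact: sqrtr_ge0. Qed.

Lemma sqr_nrm F : nrm F ^+ 2 = ip F F. Proof. by rewrite sqr_sqrtr ?ip_ge0. Qed.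

Lemma L2norm_nrm F : L2 mu F -> L2norm mu F = (nrm F)%:E.
Proof.
move=> hF; rewrite L2normE /nrm /ip /Rintegral.
have := integrable_fin_num measurableT (L2_integrable hF hF).
by rewrite /=; case: (\int[mu]_z _)%E.
Qed.

Lemma ip_le_nrm F G : L2 mu F -> L2 mu G -> `|ip F G| <= nrm F * nrm G.
Proof.
move=> hF hG; rewrite -ler_sqr ?nnegrE ?mulr_ge0 ?nrm_ge0 //.
by rewrite exprMn !sqr_nrm real_normK ?num_real // ip_cauchy_schwarz.
Qed.

Lemma nrmD F G : L2 mu F -> L2 mu G -> nrm (fun z => F z + G z) <= nrm F + nrm G.
Proof.
move=> hF hG; have hS := L2D hF hG.
rewrite -ler_sqr ?nnegrE ?addr_ge0 ?nrm_ge0 // sqrrD !sqr_nrm.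
rewrite ipDl // !ipDr // [ip G F]ipC.
by have := ip_le_nrm hF hG; rewrite ler_norml => /andP[_]; lra.
Qed.

Lemma nrmZ a F : L2 mu F -> nrm (fun z => a * F z) = Num.sqrt (cdot a a) * nrm F.
Proof. by move=> hF; rewrite /nrm ipZZ // sqrtrM ?cdot_ge0. Qed.

Lemma nrm0 : nrm (fun=> 0) = 0.
Proof. by rewrite /nrm ip0l sqrtr0. Qed.

Definition L2dist F G : R := nrm (fun z => F z - G z).

Lemma L2dist_ge0 F G : 0 <= L2dist F G. Proof. exact: nrm_ge0. Qed.

Lemma L2distC F G : L2dist F G = L2dist G F.
Proof.
congr Num.sqrt; apply: eq_Rintegral => z _; rewrite -opprB cdotNl cdotC cdotNl.
by rewrite opprK.
Qed.

Lemma L2distxx F : L2dist F F = 0.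
Proof. by rewrite /L2dist; under eq_fun do rewrite subrr; exact: nrm0. Qed.

Lemma L2dist_triangle F G H : L2 mu F -> L2 mu G -> L2 mu H ->
  L2dist F H <= L2dist F G + L2dist G H.
Proof.
move=> hF hG hH; have := nrmD (L2B hF hG) (L2B hG hH); congr (nrm _ <= _).
by apply/funext => z; rewrite addrA subrK.
Qed.

Lemma L2dist_lin a F G F' G' : L2 mu F -> L2 mu G -> L2 mu F' -> L2 mu G' ->
  L2dist (fun z => a * F z + G z) (fun z => a * F' z + G' z) <=
  Num.sqrt (cdot a a) * L2dist F F' + L2dist G G'.
Proof.
move=> hF hG hF' hG'; have hFF := L2B hF hF'.
have := nrmD (L2Z a hFF) (L2B hG hG'); rewrite nrmZ //; congr (nrm _ <= _).
by apply/funext => z; rewrite mulrBr addrACA opprD.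
Qed.

(** This turns statements modulo null sets into statements on norms. *)
Lemma L2_ae_zero F : L2 mu F -> ae_zero mu F <-> nrm F = 0.
Proof.
move=> hF; have [mF _] := (iffLR (L2P F) hF).
have mc : measurable_fun setT (EFin \o (fun z => cdot (F z) (F z))).
  by apply/measurable_EFinP; exact: measurable_cdot.
have key := ae_eq_integral_abs mu measurableT mc.
have absE : (\int[mu]_z `|(EFin \o (fun z => cdot (F z) (F z))) z| =
             \int[mu]_z (cdot (F z) (F z))%:E)%E.
  by apply: eq_integral => z _ /=; rewrite ger0_norm ?cdot_ge0.
have fin : (\int[mu]_z (cdot (F z) (F z))%:E)%E = (ip F F)%:E.
  by rewrite fineK //; exact: integrable_fin_num (L2_integrable hF hF).
rewrite absE fin in key; split.
  move=> F0; rewrite /nrm; suff -> : ip F F = 0 by rewrite sqrtr0.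
  have [_ h] := key; apply: EFin_inj; apply: h.
  by apply: filterS F0 => z /= -> _; rewrite cdot0l.
move=> /eqP; rewrite sqrtr_eq0 => F0.
have ip0 : ip F F = 0 by apply/eqP; rewrite eq_le F0 ip_ge0.
have [h _] := key; rewrite ip0 in h.
by apply: filterS (h erefl) => z /= /(_ I) [] /cdot_eq0.
Qed.

End L2_theory.

(** * Completeness of L^2 *)

Lemma integrable_bounded d (T : measurableType d) (R : realType) (mu : {measure set T -> \bar R})
    (f : T -> R) (M : R) :
  (mu setT < +oo)%E -> measurable_fun setT f -> (forall z, `|f z| <= M) ->
  mu.-integrable setT (EFin \o f).
Proof.
move=> muoo mf fM.
apply: (@le_integrable _ _ _ _ _ measurableT _ (EFin \o (fun=> M))).
- exact/measurable_EFinP.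
- by move=> z _ /=; rewrite lee_fin (le_trans (fM z)) // ler_norm.
- apply/integrableP; split; first exact: measurable_cst.
  by under eq_integral do rewrite /=; rewrite integral_cst // lte_mul_pinfty.
Qed.

Section completeness.
Context d (T : measurableType d) (R : realType) (mu : {measure set T -> \bar R}).
Hypothesis mu_fin : (mu [set: T] < +oo)%E.
Implicit Types (F G : T -> R[i]).
Notation Re := complex.Re.
Notation Im := complex.Im.

Lemma L2_bounded F (M : R) : measC F -> (forall z, cdot (F z) (F z) <= M) -> L2 mu F.
Proof.
move=> mF FM; apply/L2P; split=> //.
apply: (@integrable_bounded _ _ _ _ (fun z => cdot (F z) (F z)) M) => //.
  exact: measurable_cdot.
by move=> z; rewrite ger0_norm ?cdot_ge0.
Qed.

Lemma limn_einf_le (u : (\bar R)^nat) (c : \bar R) :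
  (forall n, u n <= c)%E -> (limn_einf u <= c)%E.
Proof.
move=> uc; rewrite limn_einf_lim; apply: lime_le; first exact: is_cvg_einfs.
by apply: nearW => n; apply: le_trans (uc n); apply: ereal_inf_lbound; exists n => /=.
Qed.

(** Fatou's lemma for |F_ k - G|^2: a bound on distances survives a pointwise limit,
   and in passing it shows that the limit is square integrable. *)
Lemma L2dist_fatou (F_ : nat -> T -> R[i]) F G (c : R) :
  (forall k, L2 mu (F_ k)) -> measC F -> L2 mu G ->
  (forall z, Re (F_ k z) @[k --> \oo] --> Re (F z)) ->
  (forall z, Im (F_ k z) @[k --> \oo] --> Im (F z)) ->
  (forall k, L2dist mu (F_ k) G <= c) -> L2 mu F /\ L2dist mu F G <= c.
Proof.
move=> hF mF hG cRe cIm Fc.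
pose q k z := cdot (F_ k z - G z) (F_ k z - G z).
have mFG : measC (fun z => F z - G z).
  have := measCD mF (measCM (measC_cst T (-1 : R[i])) (L2_meas hG)).
  by congr measC; apply/funext => z; rewrite mulN1r.
have hFG k : L2 mu (fun z => F_ k z - G z) by exact: L2B.
have c0 : 0 <= c by rewrite (le_trans _ (Fc 0%N)) // L2dist_ge0.
have qcvg z : (q k z)%:E @[k --> \oo] --> (cdot (F z - G z) (F z - G z))%:E.
  apply: cvg_EFin; first by near=> k.
  rewrite (_ : fine \o _ = (fun k => q k z)) //.
  have cR : Re (F_ k z - G z) @[k --> \oo] --> Re (F z - G z).
    rewrite raddfB; under eq_fun do rewrite raddfB.
    by apply: cvgB; [exact: cRe|exact: cvg_cst].
  have cI : Im (F_ k z - G z) @[k --> \oo] --> Im (F z - G z).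
    rewrite raddfB; under eq_fun do rewrite raddfB.
    by apply: cvgB; [exact: cIm|exact: cvg_cst].
  by apply: cvgD; apply: cvgM.
have qi k : (\int[mu]_z (q k z)%:E)%E = (L2dist mu (F_ k) G ^+ 2)%:E.
  rewrite /L2dist sqr_nrm fineK //.
  exact: integrable_fin_num (L2_integrable (hFG k) (hFG k)).
have fat : (\int[mu]_z (cdot (F z - G z) (F z - G z))%:E <= (c ^+ 2)%:E)%E.
  have := @fatou _ _ _ mu setT measurableT (fun k z => (q k z)%:E).
  rewrite (_ : (\int[mu]_x _)%E = (\int[mu]_z (cdot (F z - G z) (F z - G z))%:E)%E).
    move=> /(_ _ _)/le_trans; apply.
    - move=> k; apply/measurable_EFinP; apply: measurable_cdot; exact: L2_meas (hFG k).
    - by move=> k z _; rewrite lee_fin cdot_ge0.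
    - apply: limn_einf_le => k; rewrite qi lee_fin ler_sqr ?nnegrE ?L2dist_ge0 //.
  by apply: eq_integral => z _; have [-> _] := cvg_limn_einf_sup (qcvg z).
have LFG : L2 mu (fun z => F z - G z).
  apply/L2P; split=> //; apply/integrableP; split.
    by apply/measurable_EFinP; exact: measurable_cdot.
  under eq_integral => z _ do rewrite /= ger0_norm ?cdot_ge0 //.
  by rewrite (le_lt_trans fat) // ltry.
split.
  by have := L2D LFG hG; congr (L2 mu _); apply/funext => z; rewrite subrK.
rewrite -ler_sqr ?nnegrE ?L2dist_ge0 // /L2dist sqr_nrm -lee_fin fineK //.
exact: integrable_fin_num (L2_integrable LFG LFG).
Unshelve. all: by end_near. Qed.

Lemma ae_eq_L2dist F G : L2 mu F -> L2 mu G -> {ae mu, forall z, F z = G z} ->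
  L2dist mu F G = 0.
Proof.
move=> hF hG FG; apply/(L2_ae_zero (L2B hF hG)).
by apply: filterS FG => z ->; rewrite subrr.
Qed.

Definition norm_increment (F_ : nat -> T -> R[i]) k z : R :=
  Normc.normc (F_ k.+1 z - F_ k z).

Lemma Re_le_normc (z : R[i]) : `|Re z| <= Normc.normc z.
Proof.
rewrite -ler_sqr ?nnegrE ?normc_ge0 // cdot_normc real_normK ?num_real //.
by rewrite /cdot -!expr2 lerDl sqr_ge0.
Qed.

Lemma Im_le_normc (z : R[i]) : `|Im z| <= Normc.normc z.
Proof.
rewrite -ler_sqr ?nnegrE ?normc_ge0 // cdot_normc real_normK ?num_real //.
by rewrite /cdot -!expr2 lerDr sqr_ge0.
Qed.

Lemma measurable_normc F : measC F -> measurable_fun setT (fun z => Normc.normc (F z)).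
Proof.
move=> mF.
rewrite (_ : (fun z => _) = Num.sqrt \o (fun z => cdot (F z) (F z))).
  apply: measurableT_comp; last exact: measurable_cdot.
  by apply: continuous_measurable_fun; exact: sqrt_continuous.
by apply/funext => z /=; rewrite -cdot_normc sqrtr_sqr ger0_norm ?normc_ge0.
Qed.

(** Comparison with an absolutely convergent series; the bound is summable in the
   extended reals because it comes from an integral. *)
Lemma cvg_of_normed_increments (u : R^nat) (v : R^nat) :
  (forall k, `|u k.+1 - u k| <= v k) -> (\sum_(k <oo) (v k)%:E < +oo)%E -> cvgn u.
Proof.
move=> uv voo.
have v0 k : 0 <= v k by rewrite (le_trans _ (uv k)).
have cv : cvgn (series v).
  apply: nondecreasing_is_cvgn.
    by apply/nondecreasing_seqP => k; rewrite !seriesEnat /= big_nat_recr //= lerDl.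
  have Soo : (\sum_(k <oo) (v k)%:E)%E \is a fin_num.
    by rewrite ge0_fin_numE // nneseries_ge0 // => k _ _; rewrite lee_fin.
  exists (fine (\sum_(k <oo) (v k)%:E)%E) => _ [k _ <-].
  rewrite -lee_fin fineK // seriesEnat /= -sumEFin.
  by apply: nneseries_lim_ge => i _ _; rewrite lee_fin.
have cs : cvgn (series (telescope u)).
  apply: normed_cvg; apply: series_le_cvg cv => [k|//|k] /=; first exact: normr_ge0.
  exact: uv.
rewrite telescopeK in cs.
rewrite (_ : u = fun n => (u n - u 0%N) + u 0%N); last by apply/funext => n; rewrite subrK.
by apply: is_cvgD => //; exact: is_cvg_cst.
Qed.

(** Riesz and Fischer. On a finite measure space the L^1 norm is controlled by the L^2
   norm, so the moduli of the increments have an integrable sum and the sequence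
   converges almost everywhere; Fatou's lemma gives the rate of convergence in norm. *)
Lemma L2_complete (F_ : nat -> T -> R[i]) :
  (forall k, L2 mu (F_ k)) -> (forall k, L2dist mu (F_ k) (F_ k.+1) <= 2 ^- k) ->
  exists2 F, L2 mu F & forall k, L2dist mu (F_ k) F <= 2 * 2 ^- k.
Proof.
move=> hF Fk.
pose D := norm_increment F_.
have hD k : L2 mu (fun z => F_ k.+1 z - F_ k z) by exact: L2B.
have mD k : measurable_fun setT (EFin \o D k).
  by apply/measurable_EFinP/measurable_normc/L2_meas.
pose c := nrm mu (fun=> 1).
have h1 : L2 mu (fun=> 1).
  by apply: (@L2_bounded _ 1) => [|z]; [exact: measC_cst|rewrite /cdot /= mulr0 mulr1 addr0].
have iD k : (\int[mu]_z (D k z)%:E <= (c * 2 ^- k)%:E)%E.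
  have hDk : L2 mu (fun z => (D k z)%:C%C).
    apply: L2_dominated (hD k) _ => [|z].
      split; last exact: measurable_cst.
      exact: measurable_normc (L2_meas (hD k)).
    by rewrite -[leRHS]cdot_normc /cdot /= mulr0 addr0 -expr2.
  have := ip_le_nrm hDk h1.
  rewrite (_ : nrm mu (fun z => (D k z)%:C%C) = L2dist mu (F_ k) (F_ k.+1)); last first.
    rewrite L2distC; congr Num.sqrt; apply: eq_Rintegral => z _.
    by rewrite -[RHS]cdot_normc /cdot /= mulr0 addr0 -expr2.
  rewrite (_ : ip mu _ _ = (\int[mu]_z D k z)%R); last first.
    by apply: eq_Rintegral => z _; rewrite /cdot /= mulr1 mulr0 addr0.
  move=> /(le_trans (ler_norm _)) CS.
  have : (\int[mu]_z (D k z)%:E)%E \is a fin_num.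
    have := integrable_fin_num measurableT (L2_integrable hDk h1).
    by congr (_ \is a fin_num); apply: eq_integral => z _; rewrite /cdot /= mulr1 mulr0 addr0.
  move=> /fineK <-; rewrite lee_fin (le_trans CS) // mulrC ler_wpM2l ?nrm_ge0 //.
pose S z := (\sum_(k <oo) (D k z)%:E)%E.
have D0 k z : (0 <= (D k z)%:E)%E by rewrite lee_fin normc_ge0.
have S0 z : (0 <= S z)%E by apply: nneseries_ge0 => k _ _; exact: D0.
have mS : measurable_fun setT S by apply: ge0_emeasurable_sum => [k z _ _|k _];
  [exact: D0|exact: mD].
have geo : (\sum_(k <oo) (c * 2 ^- k)%:E < +oo)%E.
  rewrite (_ : (\sum_(k <oo) _)%E = (c * 2)%:E) ?ltry //.
  apply/cvg_lim => //.
  rewrite (_ : (fun n => _) = EFin \o series (geometric c 2^-1)); last first.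
    by apply/funext => n; rewrite sumEFin /= seriesEnat /=; congr EFin; apply: eq_bigr => i _;
      rewrite exprVn.
  apply: cvg_EFin; first by near=> n.
  have := @cvg_geometric_series R c 2^-1.
  rewrite ger0_norm ?invr_ge0 //; have -> : (1 - 2^-1)^-1 = 2 :> R by field.
  by apply; lra.
have iS : (\int[mu]_z S z < +oo)%E.
  rewrite (integral_nneseries mu measurableT mD (fun k z _ => D0 k z)).
  apply: le_lt_trans geo; apply: lee_nneseries => [k _ _|k _]; last exact: iD.
  by apply: integral_ge0 => z _; exact: D0.
have Sae : {ae mu, forall z, S z \is a fin_num}.
  have : mu.-integrable setT S.
    apply/integrableP; split=> //.
    by under eq_integral => z _ do rewrite gee0_abs //.
  by move/(integrable_ae measurableT); apply: filterS => z; apply.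
(* The sequence is replaced by zero off this conull set, so that it converges everywhere. *)
pose B := [set z | S z \is a fin_num].
have mB : measurable B by have := emeasurable_fin_num measurableT mS; rewrite setTI.
pose F' k z := if z \in B then F_ k z else 0.
have F'E k z : F' k z = (\1_B z)%:C%C * F_ k z.
  by rewrite /F' indicE; case: ifP; rewrite ?mul1r ?mul0r.
have mI : measC (fun z => ((\1_B z : R))%:C%C).
  split => /=; last exact: measurable_cst.
  by apply: measurable_indic.
have mF' k : measC (F' k).
  have := measCM mI (L2_meas (hF k)).
  by congr measC; apply/funext => z; rewrite F'E.
have hF' k : L2 mu (F' k).
  apply: L2_dominated (mF' k) (hF k) _ => z; rewrite /F'; case: ifP => // _.
  by rewrite cdot0l cdot_ge0.
have FF' k : L2dist mu (F_ k) (F' k) = 0.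
  apply: ae_eq_L2dist => //; apply: filterS Sae => z Sz.
  by rewrite /F' mem_set.
have cRe z : cvgn (fun k => Re (F' k z)).
  have [zB|zB] := boolP (z \in B); last by rewrite /F' (negbTE zB); exact: is_cvg_cst.
  rewrite /F' zB; apply: (@cvg_of_normed_increments _ (D ^~ z)).
    by move=> k; rewrite -raddfB; exact: Re_le_normc.
  by move: zB; rewrite inE /B /= ge0_fin_numE.
have cIm z : cvgn (fun k => Im (F' k z)).
  have [zB|zB] := boolP (z \in B); last by rewrite /F' (negbTE zB); exact: is_cvg_cst.
  rewrite /F' zB; apply: (@cvg_of_normed_increments _ (D ^~ z)).
    by move=> k; rewrite -raddfB; exact: Im_le_normc.
  by move: zB; rewrite inE /B /= ge0_fin_numE.
pose F z := (lim (Re (F' k z) @[k --> \oo]) +i* lim (Im (F' k z) @[k --> \oo]))%C.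
have mF : measC F.
  split.
    by apply: (@measurable_fun_cvg _ _ _ _ (fun k z => Re (F' k z))) => [k|z _];
      [case: (mF' k)|exact: cRe].
  by apply: (@measurable_fun_cvg _ _ _ _ (fun k z => Im (F' k z))) => [k|z _];
      [case: (mF' k)|exact: cIm].
have geo_dist k j : L2dist mu (F_ (j + k)%N) (F_ k) <= 2 * 2 ^- k - 2 * 2 ^- (j + k).
  elim: j => [|j IH]; first by rewrite L2distxx subrr.
  rewrite addSn (le_trans (L2dist_triangle (hF _) (hF (j + k)%N) (hF _))) //.
  rewrite L2distC; have := Fk (j + k)%N.
  have -> : 2 ^- (j + k).+1 = 2 ^- (j + k) / 2 :> R by rewrite exprS invfM mulrC.
  by move: IH; lra.
have key k : L2 mu F /\ L2dist mu F (F_ k) <= 2 * 2 ^- k.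
  apply: (@L2dist_fatou (fun j => F' (j + k)%N)) => //.
  - move=> z; have := cRe z; rewrite -(cvg_shiftn k) => h; exact: h.
  - move=> z; have := cIm z; rewrite -(cvg_shiftn k) => h; exact: h.
  - move=> j; rewrite (le_trans (L2dist_triangle (hF' _) (hF (j + k)%N) (hF _))) //.
    rewrite L2distC FF' add0r (le_trans (geo_dist k j)) // lerBlDr lerDl.
    by rewrite mulr_ge0 // invr_ge0 exprn_ge0.
by exists F => [|k]; [have [] := key 0%N|rewrite L2distC; have [] := key k].
Unshelve. all: by end_near. Qed.

End completeness.

(** * Superlevel sets of functions in an algebra *)

Section threshold.
Variable R : realType.
Implicit Types (x y : R) (m k : nat).

Lemma bernoulli_sub y m : 0 <= y <= 1 -> 1 - m%:R * y <= (1 - y) ^+ m.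
Proof.
move=> /andP[y0 y1]; elim: m => [|m IH]; first by rewrite mul0r subr0 expr0.
rewrite exprS -natr1.
have [h|h] := leP (1 - m%:R * y) 0.
  apply: (@le_trans _ _ 0); first by rewrite mulrDl mul1r; lra.
  by rewrite mulr_ge0 ?subr_ge0 // exprn_ge0 // subr_ge0.
apply: (@le_trans _ _ ((1 - y) * (1 - m%:R * y))).
  have h2 : 0 <= m%:R * y * y by rewrite !mulr_ge0.
  by nra.
by rewrite ler_wpM2l // subr_ge0.
Qed.

Lemma bernoulli_add y m : 0 <= y -> 1 + m%:R * y <= (1 + y) ^+ m.
Proof.
move=> y0; elim: m => [|m IH]; first by rewrite mul0r addr0 expr0.
rewrite exprS -natr1; apply: (@le_trans _ _ ((1 + y) * (1 + m%:R * y))).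
  have h2 : 0 <= m%:R * y * y by rewrite !mulr_ge0.
  by nra.
by rewrite ler_wpM2l // addr_ge0.
Qed.

(** With s the square root of x, Bernoulli's inequality bounds k s^k, and k x^k is
   this bounded quantity times s^k. *)
Lemma cvg_natmul_exprn x : 0 <= x < 1 -> k%:R * x ^+ k @[k --> \oo] --> (0 : R).
Proof.
move=> /andP[x0 x1].
have [->|xn0] := eqVneq x 0.
  apply: cvg_near_cst; near=> k; rewrite expr0n.
  have -> : (k == 0%N) = false by apply/negbTE; rewrite -lt0n; near: k; exact: nbhs_infty_gt.
  by rewrite mulr0.
pose s := Num.sqrt x.
have s0 : 0 < s by rewrite sqrtr_gt0 lt_def xn0.
have ss : s * s = x by rewrite -expr2 sqr_sqrtr.
have s1 : s < 1 by rewrite -sqrtr1 ltr_sqrt.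
have bnd k : k%:R * x ^+ k <= (s^-1 - 1)^-1 * s ^+ k.
  have h0 : 0 < s^-1 - 1 by rewrite subr_gt0 invf_gt1.
  rewrite -ss exprMn mulrA ler_wpM2r ?(exprn_ge0 _ (ltW s0)) //.
  have := @bernoulli_add (s^-1 - 1) k (ltW h0); rewrite addrCA subrr addr0 exprVn => h.
  have sk : 0 < s ^+ k by rewrite exprn_gt0.
  have h2 : (1 + k%:R * (s^-1 - 1)) * s ^+ k <= 1 by rewrite -ler_pdivlMr // mul1r.
  rewrite -[leRHS]mul1r ler_pdivlMr //.
  by move: h2; rewrite mulrDl mul1r; nra.
apply: (@squeeze_cvgr _ _ _ _ (fun=> 0) (fun k => (s^-1 - 1)^-1 * s ^+ k)).
- by near=> k; rewrite bnd mulr_ge0 // exprn_ge0.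
- exact: cvg_cst.
- apply: (@cvg_geometric R (s^-1 - 1)^-1 s); by rewrite ger0_norm ?(ltW s0).
Unshelve. all: by end_near. Qed.

(** Polynomials in the manner of Brosowski and Deutsch, which converge pointwise on
   [0, 1] to the indicator of [0, 1/2). The factor k in the exponent forces the limit 0
   at the point 1/2 itself, so that no exceptional set appears. *)
Definition step_poly k x : R := (1 - x ^+ k) ^+ (k * 2 ^ k)%N.

Lemma step_poly_itv k x : 0 <= x <= 1 -> 0 <= step_poly k x <= 1.
Proof.
move=> /andP[x0 x1]; have h0 : 0 <= 1 - x ^+ k by rewrite subr_ge0 exprn_ile1.
by rewrite exprn_ge0 // exprn_ile1 // lerBlDr lerDl exprn_ge0.
Qed.

(** Bernoulli's inequality bounds the polynomial below by 1 - k (2 x)^k and above by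
   1 / (1 + k (2 x)^k). *)
Lemma cvg_step_poly x : 0 <= x <= 1 ->
  step_poly k x @[k --> \oo] --> ((x < 2^-1)%R%:R : R).
Proof.
move=> x01; have /andP[x0 x1] := x01.
have E k : (k * 2 ^ k)%N%:R * x ^+ k = k%:R * (2 * x) ^+ k :> R.
  by rewrite natrM natrX -mulrA -exprMn.
have xk k : 0 <= x ^+ k <= 1 by rewrite exprn_ge0 // exprn_ile1.
have [xh|xh] := ltP x 2^-1 => /=.
  apply: (@squeeze_cvgr _ _ _ _ (fun k => 1 - k%:R * (2 * x) ^+ k) (fun=> 1)).
  - near=> k; rewrite -E bernoulli_sub //=.
    by have /andP[] := step_poly_itv k x01.
  - rewrite -[X in _ --> X]subr0; apply: cvgB; first exact: cvg_cst.
    by apply: cvg_natmul_exprn; lra.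
  - exact: cvg_cst.
apply: (@squeeze_cvgr _ _ _ _ (fun=> 0) (fun k => harmonic k)).
- near=> k; have /andP[-> _] /= := step_poly_itv k x01.
  have /andP[xk0 xk1] := xk k.
  have h1 : step_poly k x * (1 + x ^+ k) ^+ (k * 2 ^ k) <= 1.
    rewrite /step_poly -exprMn exprn_ile1 //.
      by rewrite mulr_ge0 // ?subr_ge0 // addr_ge0.
    by have := sqr_ge0 (x ^+ k); nra.
  have h2 : k.+1%:R <= (1 + x ^+ k) ^+ (k * 2 ^ k).
    apply: le_trans (bernoulli_add (k * 2 ^ k)%N xk0).
    rewrite E -natr1 addrC lerD2l ler_peMr // exprn_ege1 //; lra.
  rewrite /harmonic /= -[leRHS]mul1r ler_pdivlMr ?ltr0n //.
  apply: le_trans h1; apply: ler_wpM2l => //.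
  by have /andP[] := step_poly_itv k x01.
- exact: cvg_cst.
- exact: cvg_harmonic.
Unshelve. all: by end_near. Qed.

End threshold.

Section span.
Context (T : Type) (R : realType).
Implicit Types (S : set (T -> R[i])) (f g : T -> R[i]).

Inductive cspan S : set (T -> R[i]) :=
| cspan0 : cspan S (fun=> 0)
| cspan_cons a s g : S s -> cspan S g -> cspan S (fun z => a * s z + g z).

Lemma cspan_lin S a f g : cspan S f -> cspan S g -> cspan S (fun z => a * f z + g z).
Proof.
move=> + Sg; elim=> [|b s h Ss _ IH].
  by rewrite (_ : (fun z => _) = g) //; apply/funext => z; rewrite mulr0 add0r.
have := cspan_cons (a * b) Ss IH; congr cspan; apply/funext => z.
by rewrite mulrDr mulrA addrA.
Qed.

Lemma cspanD S f g : cspan S f -> cspan S g -> cspan S (fun z => f z + g z).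
Proof.
move=> Sf Sg; have := cspan_lin 1 Sf Sg; congr cspan.
by apply/funext => z; rewrite mul1r.
Qed.

Lemma cspanZ S a f : cspan S f -> cspan S (fun z => a * f z).
Proof.
move=> Sf; have := cspan_lin a Sf (cspan0 S); congr cspan.
by apply/funext => z; rewrite addr0.
Qed.

Lemma cspan_sub S f : S f -> cspan S f.
Proof.
move=> Sf; have := cspan_cons 1 Sf (cspan0 S); congr cspan.
by apply/funext => z; rewrite mul1r addr0.
Qed.

Section algebra.
Variable S : set (T -> R[i]).
Hypotheses (S1 : S (fun=> 1)) (SM : forall f g, S f -> S g -> S (fun z => f z * g z)).

Lemma cspan_cst a : cspan S (fun=> a).
Proof.
have := cspanZ a (cspan_sub S1); congr cspan; by apply/funext => z; rewrite mulr1.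
Qed.

Lemma cspanM f g : cspan S f -> cspan S g -> cspan S (fun z => f z * g z).
Proof.
move=> Sf Sg; elim: Sf => [|a s h Ss _ IH].
  by rewrite (_ : (fun z => _) = fun=> 0); [exact: cspan0|apply/funext => z; rewrite mul0r].
have Ssg : cspan S (fun z => s z * g z).
  elim: Sg => [|b s' h' Ss' _ IH'].
    by rewrite (_ : (fun z => _) = fun=> 0); [exact: cspan0|apply/funext => z; rewrite mulr0].
  have := cspan_lin b (cspan_sub (SM Ss Ss')) IH'; congr cspan.
  by apply/funext => z; rewrite mulrDr mulrCA.
have := cspan_lin a Ssg IH; congr cspan.
by apply/funext => z; rewrite mulrDl mulrA.
Qed.

Lemma cspanX f n : cspan S f -> cspan S (fun z => f z ^+ n).
Proof.
move=> Sf; elim: n => [|n IH].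
  by under eq_fun do rewrite expr0; exact: cspan_cst.
by under eq_fun do rewrite exprS; exact: cspanM.
Qed.

(** With N a bound for |f|, rescale f to q = 1/2 - f / (2 N) with values in [0, 1], so
   that f > 0 means q < 1/2, and apply the step polynomials to q. *)
Lemma cspan_superlevel (f : T -> R) (M : R) :
  cspan S (fun z => (f z)%:C%C) -> (forall z, `|f z| <= M) ->
  exists p : nat -> T -> R, [/\ forall k, cspan S (fun z => (p k z)%:C%C),
    forall k z, 0 <= p k z <= 1 & forall z, p k z @[k --> \oo] --> ((0 < f z)%R%:R : R)].
Proof.
move=> Sf fM.
pose N := `|M| + 1.
have N0 : 0 < N by rewrite /N ltr_wpDl.
have fN z : - N <= f z <= N.
  by rewrite -ler_norml (le_trans (fM z)) // (le_trans (ler_norm _)) // lerDl.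
pose q z := 2^-1 - f z / (2 * N).
have q01 z : 0 <= q z <= 1.
  have /andP[l r] := fN z.
  have : -1 <= f z / N <= 1 by rewrite ler_pdivlMr // ler_pdivrMr // mulN1r mul1r l.
  rewrite /q invfM mulrCA mulrC; set u := f z / N; lra.
exists (fun k z => step_poly k (q z)); split=> [k|k z|z].
- have Sq : cspan S (fun z => (q z)%:C%C).
    have := cspan_lin (- (2 * N)^-1)%:C%C Sf (cspan_cst (2^-1)%:C%C); congr cspan.
    apply/funext => z; rewrite /q -rmorphM -rmorphD /=; congr (_%:C%C).
    by rewrite mulNr addrC mulrC.
  have h := cspanX (k * 2 ^ k) (cspan_lin (-1) (cspanX k Sq) (cspan_cst 1)).
  move: h; congr cspan; apply/funext => z.
  move: (q z) => u; rewrite /step_poly (rmorphXn (real_complex R)) (rmorphB (real_complex R)) /=.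
  by rewrite (rmorphXn (real_complex R)) (rmorph1 (real_complex R)) mulN1r addrC.
- exact: step_poly_itv.
- rewrite (_ : (0 < f z) = (q z < 2^-1)); first exact: cvg_step_poly.
  by rewrite /q gtrBl pmulr_lgt0 ?invr_gt0 ?mulr_gt0.
Qed.

End algebra.
End span.

(** * Density of algebras of functions in L^2 *)

Section closure.
Context d (T : measurableType d) (R : realType) (mu : {measure set T -> \bar R}).
Implicit Types (W : set (T -> R[i])) (F G : T -> R[i]).

Definition L2cl W : set (T -> R[i]) :=
  [set F | L2 mu F /\ forall e : R, 0 < e -> exists2 G, W G & L2dist mu F G < e].

Lemma L2cl_sub W F : L2 mu F -> W F -> L2cl W F.
Proof. by move=> hF WF; split=> // e e0; exists F; rewrite ?L2distxx. Qed.

Lemma L2cl_cl W F : W `<=` L2 mu -> L2 mu F ->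
  (forall e : R, 0 < e -> exists2 G, L2cl W G & L2dist mu F G < e) -> L2cl W F.
Proof.
move=> WL hF h; split=> // e e0.
have e2 : 0 < e / 2 by rewrite divr_gt0.
have [G [hG /(_ _ e2)[H WH GH]] FG] := h _ e2; exists H => //.
rewrite (le_lt_trans (L2dist_triangle hF hG (WL _ WH))) //.
by rewrite (splitr e) ltrD.
Qed.

Lemma L2cl_lin W : W `<=` L2 mu ->
  (forall a F G, W F -> W G -> W (fun z => a * F z + G z)) ->
  forall a F G, L2cl W F -> L2cl W G -> L2cl W (fun z => a * F z + G z).
Proof.
move=> WL Wlin a F G [hF cF] [hG cG]; split.
  by apply: L2D => //; exact: L2Z.
move=> e e0; pose c := Num.sqrt (cdot a a) + 1.
have c1 : 1 <= c by rewrite lerDr sqrtr_ge0.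
have c0 : 0 < c by rewrite (lt_le_trans ltr01).
have e2 : 0 < e / (2 * c) by rewrite divr_gt0 // mulr_gt0.
have [F' WF' FF'] := cF _ e2; have [G' WG' GG'] := cG _ e2.
exists (fun z => a * F' z + G' z); first exact: Wlin.
rewrite (le_lt_trans (L2dist_lin a hF hG (WL _ WF') (WL _ WG'))) //.
have -> : e = c * (e / (2 * c)) + c * (e / (2 * c)) by field; rewrite gt_eqF.
apply: ler_ltD; last by rewrite (lt_le_trans GG') // ler_peMl // ltW.
rewrite ler_pM ?sqrtr_ge0 ?L2dist_ge0 //; first by rewrite lerDl.
exact: ltW.
Qed.

(** Only the existence of one close term is stated: it is all that membership in a
   closure asks for. *)
Lemma L2_dominated_cvg (F_ : nat -> T -> R[i]) F H :
  (forall k, measC (F_ k)) -> L2 mu F -> L2 mu H ->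
  (forall k z, cdot (F_ k z) (F_ k z) <= cdot (H z) (H z)) ->
  {ae mu, forall z, cdot (F_ k z - F z) (F_ k z - F z) @[k --> \oo] --> (0 : R)} ->
  forall e : R, 0 < e -> exists k, L2dist mu (F_ k) F < e.
Proof.
move=> mF hF hH FH cvF e e0.
have hFk k : L2 mu (F_ k) by apply: L2_dominated hH _.
have hB k := L2B (hFk k) hF.
pose g z := (2 * (cdot (H z) (H z) + cdot (F z) (F z)))%:E.
pose f_ k z := (cdot (F_ k z - F z) (F_ k z - F z))%:E.
have mf_ k : measurable_fun setT (f_ k).
  by apply: measurable_int; exact: L2_integrable (hB k) (hB k).
have mf0 : measurable_fun [set: T] (fun=> 0%E : \bar R) by exact: measurable_cst.
have c_ : {ae mu, forall z, setT z -> f_ k z @[k --> \oo] --> 0%E}.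
  by apply: filterS cvF => z h _; apply: cvg_EFin => //; exact: nearW.
have ig : mu.-integrable setT g.
  have := integrableZl measurableT 2 (integrableD measurableT (L2_integrable hH hH) (L2_integrable hF hF)).
  by apply: eq_integrable => // z _; rewrite /g EFinM EFinD.
have dom : {ae mu, forall z k, setT z -> (`|f_ k z| <= g z)%E}.
  apply: nearW => z k _ /=; rewrite lee_fin ger0_norm ?cdot_ge0 //.
  have := cdotDD_le (F_ k z) (- F z); rewrite cdotNl cdotC cdotNl opprK => /le_trans; apply.
  by rewrite ler_wpM2l // lerD2r.
have [_ _] := dominated_convergence measurableT mf_ mf0 c_ ig dom.
rewrite integral0 => C.
have {C} : L2dist mu (F_ k) F ^+ 2 @[k --> \oo] --> (0 : R).
  move: C => /fine_cvg; apply: cvg_trans; apply: near_eq_cvg; near=> k => /=.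
  by rewrite /L2dist sqr_nrm.
move=> /cvgrPdist_lt /(_ _ (exprn_gt0 2 e0)) [k _ /(_ k (leqnn k))] /=.
rewrite sub0r normrN ger0_norm ?sqr_ge0 // ltr_sqr ?nnegrE ?L2dist_ge0 ?(ltW e0) // => h.
by exists k.
Unshelve. all: by end_near. Qed.

End closure.

Import HBSimple HBNNSimple.

Section density.
Context d (T : measurableType d) (R : realType) (mu : {measure set T -> \bar R}).
Hypothesis mu_fin : (mu [set: T] < +oo)%E.
Variable S : set (T -> R[i]).
Hypotheses (S1 : S (fun=> 1)) (SM : forall f g, S f -> S g -> S (fun z => f z * g z)).
Hypothesis S_meas : forall f, S f -> measC f.
Hypothesis S_bound : forall f, S f -> forall z, cdot (f z) (f z) <= 1.
Variable Omega : set T.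
Hypothesis ae_Omega : {ae mu, forall z, Omega z}.

Lemma cspan_L2 : cspan S `<=` L2 mu.
Proof.
move=> f; elim=> [|a s g Ss _ IH]; first exact: L2_0.
by apply: L2D => //; apply: L2Z; apply: (L2_bounded mu_fin (S_meas Ss) (S_bound Ss)).
Qed.

Local Notation cl := (L2cl mu (cspan S)).

Let cl_lin a f g : cl f -> cl g -> cl (fun z => a * f z + g z).
Proof. by apply: L2cl_lin; [exact: cspan_L2|move=> *; exact: cspan_lin]. Qed.

Definition indC (E : set T) (z : T) : R[i] := ((\1_E z : R))%:C%C.

Lemma measC_indC (E : set T) : measurable E -> measC (indC E).
Proof. by move=> mE; split; [exact: measurable_indic|exact: measurable_cst]. Qed.

Lemma cdot_real (x : R) : cdot x%:C%C x%:C%C = x ^+ 2.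
Proof. by rewrite /cdot /= mulr0 addr0 expr2. Qed.

Lemma L2_indC (E : set T) : measurable E -> L2 mu (indC E).
Proof.
move=> mE; apply: (@L2_bounded _ _ _ _ mu_fin _ 1); first exact: measC_indC.
by move=> z; rewrite cdot_real indicE; case: (z \in E); rewrite /= ?expr1n // expr0n.
Qed.

(** The pi-system of the monotone class argument: products of approximating functions
   approximate intersections. *)
Definition approx_set : set (set T) := [set E | measurable E /\
  exists p : nat -> T -> R, [/\ forall k, cspan S (fun z => (p k z)%:C%C),
    forall k z, 0 <= p k z <= 1 &
    forall z, Omega z -> p k z @[k --> \oo] --> (\1_E z : R)]].

Lemma approx_setI : setI_closed approx_set.
Proof.
move=> E E' [mE [p [Sp p01 pE]]] [mE' [p' [Sp' p01' pE']]]; split.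
  exact: measurableI.
exists (fun k z => p k z * p' k z); split=> [k|k z|z Oz].
- by have := cspanM SM (Sp k) (Sp' k); congr cspan; apply/funext => z; rewrite rmorphM.
- have /andP[? ?] := p01 k z; have /andP[? ?] := p01' k z.
  by rewrite mulr_ge0 // mulr_ile1.
- by rewrite indicI; apply: cvgM; [exact: pE|exact: pE'].
Qed.

Lemma approx_set_cl E : approx_set E -> cl (indC E).
Proof.
move=> [mE [p [Sp p01 pE]]].
apply: L2cl_cl; [exact: cspan_L2|exact: L2_indC|].
have h1 : L2 mu (indC setT) by exact: L2_indC.
move=> e e0; have [||k] := @L2_dominated_cvg _ _ _ mu (fun k z => (p k z)%:C%C) (indC E) _
  (fun k => L2_meas (cspan_L2 (Sp k))) (L2_indC mE) h1 _ _ e e0.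
- move=> k z; rewrite !cdot_real indicT expr1n.
  by have /andP[? ?] := p01 k z; rewrite expr_le1.
- apply: filterS ae_Omega => z /pE h.
  rewrite (_ : (fun k => _) = (fun k => (p k z - \1_E z) ^+ 2)); last first.
    by apply/funext => k; rewrite /indC -rmorphB cdot_real.
  have {h} h : p k z - \1_E z @[k --> \oo] --> (0 : R).
    by rewrite -(subrr (\1_E z : R)); apply: cvgB => //; exact: cvg_cst.
  by have := cvgM h h; rewrite mulr0; exact.
- rewrite L2distC => h; exists (fun z => (p k z)%:C%C) => //.
  by apply: L2cl_sub => //; exact: cspan_L2.
Qed.

Variable gen : set (set T).
Hypothesis measurable_gen : @measurable _ T = <<s gen >>.
Hypothesis gen_approx : gen `<=` approx_set.

(** The sets whose indicator lies in the closed span form a lambda-system containing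
   the pi-system [approx_set]. *)
Lemma indC_cl E : measurable E -> cl (indC E).
Proof.
have mG : @measurable _ T = <<s approx_set >>.
  apply/seteqP; split.
    by rewrite measurable_gen; exact: sub_smallest2r.
  apply: smallest_sub; first exact: sigma_algebra_measurable.
  by move=> A [].
rewrite {1}mG.
have clC A : measurable A -> cl (indC A) -> cl (indC (~` A)).
  move=> mA cA.
  have c1 : cl (fun=> 1) by apply: L2cl_sub; [apply: cspan_L2; apply: cspan_cst|exact: cspan_cst].
  have := cl_lin (-1) cA c1; congr (cl _); apply/funext => z.
  rewrite /indC !indicE in_setC; case: (z \in A) => /=; last by rewrite mulr0 add0r.
  by rewrite mulr1 addNr.
move: E; apply: (dynkin_induction mG approx_setI).
- have := clC set0 measurable0; rewrite setC0; apply.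
  rewrite (_ : indC set0 = fun=> 0); last by apply/funext => z; rewrite /indC indic0.
  by apply: L2cl_sub; [exact: L2_0|exact: cspan0].
- exact: approx_set_cl.
- exact: clC.
move=> F mF tF cF.
have mU := bigcup_measurable (fun k _ => mF k : measurable (F k)) : measurable (\bigcup_k F k).
apply: L2cl_cl; [exact: cspan_L2|exact: L2_indC|].
have h1 : L2 mu (indC setT) by exact: L2_indC.
pose U k := \big[setU/set0]_(i < k) F i.
have mUk k : measurable (U k) by apply: bigsetU_measurable.
move=> e e0; have [||k] := @L2_dominated_cvg _ _ _ mu (fun k => indC (U k)) (indC (\bigcup_k F k)) _
  (fun k => measC_indC (mUk k)) (L2_indC mU) h1 _ _ e e0.
- move=> k z; rewrite !cdot_real indicT expr1n indicE.
  by case: (z \in U k); rewrite /= ?expr1n // expr0n.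
- apply: nearW => z; apply: cvg_near_cst.
  have [[i _ Fiz]|nU] := pselect ((\bigcup_k F k) z).
    near=> k; rewrite /indC !indicE !mem_set ?subrr ?cdot0l //; first by exists i.
    rewrite /U -bigcup_mkord; exists i => //=; near: k; exact: nbhs_infty_gt.
  apply: nearW => k; rewrite /indC !indicE !memNset ?subrr ?cdot0l //.
  by rewrite /U -bigcup_mkord => -[i /= _ Fiz]; apply: nU; exists i.
- rewrite L2distC => h; exists (indC (U k)) => //.
  elim: k {h} => [|k IH].
    rewrite /U big_ord0 (_ : indC set0 = fun=> 0); last by apply/funext => z; rewrite /indC indic0.
    by apply: L2cl_sub; [exact: L2_0|exact: cspan0].
  have := cl_lin 1 IH (cF k); congr (cl _); apply/funext => z.
  rewrite mul1r /U big_ord_recr /= /indC -rmorphD /= !indicE in_setU; congr (_%:C%C).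
  have : ~ (z \in U k /\ z \in F k).
    rewrite !inE /U -bigcup_mkord => -[[i /= ik Fiz] Fkz].
    have /trivIsetP /(_ i k I I) := tF; move: ik; rewrite ltn_neqAle => /andP[ik _] /(_ ik) FF.
    by have : (F i `&` F k) z by []; rewrite FF.
  by rewrite -/(U k); case: (z \in U k); case: (z \in F k) => nn; rewrite /= ?addr0 ?add0r //;
    case: nn.
Unshelve. all: by end_near. Qed.

(** A nonnegative function is the increasing limit of simple functions, which it
   dominates. *)
Lemma real_cl (f : T -> R) : measurable_fun setT f -> L2 mu (fun z => (f z)%:C%C) ->
  (forall z, 0 <= f z) -> cl (fun z => (f z)%:C%C).
Proof.
move=> mf hf f0.
have mf' : measurable_fun setT (EFin \o f) by exact/measurable_EFinP.
pose g := nnsfun_approx measurableT mf'.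
have f0' z : [set: T] z -> (0 <= (EFin \o f) z)%E by rewrite lee_fin.
have cg z : g k z @[k --> \oo] --> f z.
  have /fine_cvg := cvg_nnsfun_approx measurableT mf' f0' (I : setT z).
  exact.
have gf k z : g k z <= f z.
  rewrite -(cvg_lim (@Rhausdorff R) (cg z)).
  apply: (@nondecreasing_cvgn_le _ (fun k => g k z)); last by apply/cvg_ex; exists (f z).
  by move=> i j ij; have /lefP := nd_nnsfun_approx measurableT mf' ij; exact.
have g0 k z : 0 <= g k z by exact: fun_ge0.
have mg k : measC (fun z => (g k z)%:C%C).
  by split; [exact: measurable_funP|exact: measurable_cst].
have clg k : cl (fun z => (g k z)%:C%C).
  pose s := fset_set (g k @` setT).
  have -> : (fun z => (g k z)%:C%C) = (fun z =>
      \sum_(i < #|`s|) (s`_i)%:C%C * indC (g k @^-1` [set s`_i]) z).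
    apply/funext => z; rewrite [in LHS]fimfunEord rmorph_sum; apply: eq_bigr => i _.
    by rewrite rmorphM.
  elim: (index_enum _) => [|i r IH].
    by under eq_fun do rewrite big_nil; apply: L2cl_sub; [exact: L2_0|exact: cspan0].
  under eq_fun do rewrite big_cons /=.
  by apply: cl_lin => //; apply: indC_cl; exact: measurable_funPTI.
apply: L2cl_cl => //; first exact: cspan_L2.
move=> e e0; have [||k] := @L2_dominated_cvg _ _ _ mu (fun k z => (g k z)%:C%C) _ _
  mg hf hf _ _ e e0.
- move=> k z; rewrite !cdot_real ler_sqr ?nnegrE //.
- apply: nearW => z.
  rewrite (_ : (fun k => _) = (fun k => (g k z - f z) ^+ 2)); last first.
    by apply/funext => k; rewrite -rmorphB cdot_real.
  have h : g k z - f z @[k --> \oo] --> (0 : R).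
    by rewrite -(subrr (f z : R)); apply: cvgB => //; exact: cvg_cst.
  by have := cvgM h h; rewrite mulr0; exact.
- by rewrite L2distC => h; exists (fun z => (g k z)%:C%C).
Qed.

(** Functional monotone class theorem: after indicators and nonnegative functions, pass
   to positive and negative parts, then to real and imaginary parts. *)
Theorem cspan_dense F : L2 mu F -> cl F.
Proof.
have clD f g : cl f -> cl g -> cl (fun z => f z + g z).
  by move=> cf cg; have := cl_lin 1 cf cg; under eq_fun do rewrite mul1r.
have cl0 : cl (fun=> 0) by apply: L2cl_sub; [exact: L2_0|exact: cspan0].
have clZ a f : cl f -> cl (fun z => a * f z).
  by move=> cf; have := cl_lin a cf cl0; under eq_fun do rewrite addr0.
have clR (f : T -> R) : measurable_fun setT f -> L2 mu (fun z => (f z)%:C%C) ->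
    cl (fun z => (f z)%:C%C).
  move=> mf hf.
  have mp : measC (fun z => (f^\+ z)%:C%C).
    by split; [exact: measurable_funrpos|exact: measurable_cst].
  have mn : measC (fun z => (f^\- z)%:C%C).
    by split; [exact: measurable_funrneg|exact: measurable_cst].
  have hp : L2 mu (fun z => (f^\+ z)%:C%C).
    apply: L2_dominated mp hf _ => z; rewrite !cdot_real -[leRHS]real_normK ?num_real //.
    rewrite ler_sqr ?nnegrE ?normr_ge0 ?funrpos_ge0 // /funrpos ge_max normr_ge0.
    by rewrite ler_norm.
  have hn : L2 mu (fun z => (f^\- z)%:C%C).
    apply: L2_dominated mn hf _ => z; rewrite !cdot_real -[leRHS]real_normK ?num_real //.
    rewrite ler_sqr ?nnegrE ?normr_ge0 ?funrneg_ge0 // /funrneg ge_max normr_ge0.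
    by rewrite -normrN ler_norm.
  have cp := real_cl (measurable_funrpos mf) hp (@funrpos_ge0 _ _ f).
  have cn := real_cl (measurable_funrneg mf) hn (@funrneg_ge0 _ _ f).
  have := cl_lin (-1) cn cp; congr (cl _); apply/funext => z.
  by rewrite mulN1r addrC -rmorphB /= -[in RHS](funrposBneg f).
move=> hF; have [mR mI] := L2_meas hF.
have hR : L2 mu (fun z => (complex.Re (F z))%:C%C).
  apply: L2_dominated hF _ => [|z]; first by split => //; exact: measurable_cst.
  by rewrite cdot_real /cdot -!expr2 lerDl sqr_ge0.
have hI : L2 mu (fun z => (complex.Im (F z))%:C%C).
  apply: L2_dominated hF _ => [|z]; first by split => //; exact: measurable_cst.
  by rewrite cdot_real /cdot -!expr2 lerDr sqr_ge0.
have := cl_lin 'i%C (clR _ mI hI) (clR _ mR hR); congr (cl _); apply/funext => z.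
by rewrite addrC; case: (F z) => x y; apply/eqP; rewrite eq_complex /=; apply/andP; split;
  apply/eqP; ring.
Qed.

End density.

(** * The measure of the fundamental domain *)

Section restricted_measures.
Variable R : realType.
Local Notation lambda := (@lebesgue_measure R).

Lemma measurable_unit_itv : measurable (`[0, 1]%classic : set (measurableTypeR R)).
Proof. exact: measurable_itv. Qed.

Definition unit_mu : set (measurableTypeR R) -> \bar R := mrestr lambda measurable_unit_itv.

HB.instance Definition _ := Measure.on unit_mu.

Let unit_mu_fin : fin_num_fun unit_mu.
Proof.
apply: lty_fin_num_fun; rewrite /= /unit_mu /mrestr setTI.
by rewrite lebesgue_measure_itv /= lte_fin ltr01 sube0 ltry.
Qed.

HB.instance Definition _ := @Measure_isFinite.Build _ _ R unit_mu unit_mu_fin.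

Definition cube n : set 'cV[R]_n := [set x | forall i, 0 <= x i 0 <= 1].

Lemma measurable_cube n : measurable (@cube n).
Proof.
have -> : @cube n = \bigcap_(i in [set: 'I_n]) (fun x : 'cV[R]_n => x i 0) @^-1` `[0, 1]%classic.
  rewrite predeqE => x; split => [h i _ /=|h i]; first by rewrite in_itv; exact: h.
  by have := h i I; rewrite /= in_itv.
apply: fin_bigcap_measurable => // i _.
by rewrite -[X in measurable X]setTI; exact: measurable_coord.
Qed.

Definition cube_mu n : set 'cV[R]_n -> \bar R := mrestr (lebesgue_cV R n) (@measurable_cube n).

HB.instance Definition _ n := Measure.on (@cube_mu n).

Lemma cons_cV_cube n : @cons_cV R n @^-1` (@cube n.+1) = `[0, 1]%classic `*` @cube n.
Proof.
rewrite predeqE => -[t x]; rewrite /cube /cons_cV /=; split => [h|[t01 h] i].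
  split; first by have := h ord0; rewrite mxE unlift_none in_itv.
  by move=> i; have := h (lift ord0 i); rewrite mxE liftK.
by rewrite mxE; case: unliftP => [j _|_] //=; move: t01; rewrite in_itv.
Qed.

Let cube_mu_fin n : fin_num_fun (@cube_mu n).
Proof.
apply: lty_fin_num_fun; rewrite /= /cube_mu /mrestr setTI.
elim: n => [|n IH] /=.
  rewrite /dirac indicE; by case: (_ \in _); rewrite ltry.
rewrite /lebesgue_cons /pushforward cons_cV_cube.
rewrite product_measure1E //; last exact: measurable_cube.
rewrite [X in (X * _)%E](_ : _ = 1%E) ?mul1e //.
have h : lambda (`[0, 1]%classic : set R) = 1%E.
  by rewrite lebesgue_measure_itv /= lte_fin ltr01 sube0.
exact: h.
Qed.

HB.instance Definition _ n := @Measure_isFinite.Build _ _ R (@cube_mu n) (@cube_mu_fin n).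

(** Restricting a product measure to a rectangle is taking the product of the restricted
   measures, since both agree on rectangles. *)
Lemma product_restr n (X : set (measurableTypeR R * 'cV[R]_n)) : measurable X ->
  (unit_mu \x @cube_mu n)%E X =
  (lambda \x lebesgue_cV R n)%E (X `&` (`[0, 1]%classic `*` @cube n)).
Proof.
move=> mX.
have mD : measurable (`[0, 1]%classic `*` @cube n : set (measurableTypeR R * 'cV[R]_n)).
  by apply: measurableX; [exact: measurable_unit_itv|exact: measurable_cube].
rewrite (@product_measure_unique _ _ _ _ _ unit_mu (@cube_mu n)
  (mrestr (lambda \x lebesgue_cV R n)%E mD)) // => A B mA mB.
rewrite /= /mrestr -setXI product_measure1E //.
- by apply: measurableI => //; exact: measurable_unit_itv.
- by apply: measurableI => //; exact: measurable_cube.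
Qed.

(** The recursion behind all inductions on the dimension. *)
Lemma cube_mu_cons n (B : set 'cV[R]_n.+1) : measurable B ->
  @cube_mu n.+1 B = pushforward (unit_mu \x @cube_mu n)%E (@cons_cV R n) B.
Proof.
move=> mB; rewrite /cube_mu /mrestr /= /lebesgue_cons /pushforward product_restr; last first.
  by rewrite -[X in measurable X]setTI; exact: measurable_cons_cV.
by rewrite preimage_setI cons_cV_cube.
Qed.

(** As a product of two finite measures, this measure is within reach of Fubini's
   theorem. *)
Lemma bundle_measureE n (X : set (measurableTypeR R * 'cV[R]_n)) : measurable X ->
  bundle_measure R n X = (unit_mu \x @cube_mu n)%E X.
Proof.
move=> mX; rewrite product_restr // /bundle_measure /mrestr /=; congr (_ (_ `&` _)).
Qed.

Lemma bundle_measure_fin n : (bundle_measure R n setT < +oo)%E.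
Proof.
rewrite bundle_measureE // -setXTT product_measure1E //.
by rewrite lte_mul_pinfty // ?fin_num_measure // -ge0_fin_numE // fin_num_measure.
Qed.

Lemma integral_bundle n (f : measurableTypeR R * 'cV[R]_n -> \bar R) :
  (\int[bundle_measure R n]_z f z = \int[(unit_mu \x @cube_mu n)%E]_z f z)%E.
Proof. by apply: eq_measure_integral => X mX _; exact: bundle_measureE. Qed.

Lemma integrable_bundle n (f : measurableTypeR R * 'cV[R]_n -> \bar R) :
  (bundle_measure R n).-integrable setT f -> (unit_mu \x @cube_mu n)%E.-integrable setT f.
Proof.
move=> /integrableP[mf fi]; apply/integrableP; split=> //.
by rewrite -integral_bundle.
Qed.

Lemma unit_mu_set1 a : unit_mu [set a] = 0%E.
Proof.
apply/eqP; rewrite eq_le measure_ge0 andbT /unit_mu /mrestr.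
by rewrite -(lebesgue_measure_set1 a); apply: le_measure; rewrite ?inE //;
  exact: measurableI.
Qed.

Definition hyperplane n (i : 'I_n) a : set 'cV[R]_n := [set x | x i 0 = a].

Lemma measurable_hyperplane n (i : 'I_n) a : measurable (hyperplane i a).
Proof.
rewrite -[X in measurable X]setTI.
exact: (measurable_coord i measurableT (measurable_set1 a)).
Qed.

Lemma cube_mu_hyperplane n (i : 'I_n) a : @cube_mu n (hyperplane i a) = 0%E.
Proof.
elim: n i => [[]//|n IH] i; rewrite cube_mu_cons; last exact: measurable_hyperplane.
rewrite /pushforward; case: (unliftP ord0 i) => [j ->|->].
  rewrite [X in (unit_mu \x _)%E X](_ : _ = setT `*` hyperplane j a); last first.
    by rewrite predeqE => -[t x]; rewrite /hyperplane /cons_cV /= mxE liftK; split => [|[]].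
  rewrite product_measure1E //; last exact: measurable_hyperplane.
  by rewrite [X in (_ * X)%E](_ : _ = 0%E) ?mule0 //; exact: IH.
rewrite [X in (unit_mu \x _)%E X](_ : _ = [set a] `*` setT); last first.
  by rewrite predeqE => -[t x]; rewrite /hyperplane /cons_cV /= mxE unlift_none; split => [|[]].
rewrite product_measure1E //.
by rewrite [X in (X * _)%E](_ : _ = 0%E) ?mul0e //; exact: unit_mu_set1.
Qed.

(** The interior of the fundamental domain, where every point is its own representative
   and where sin (pi t) and all the sin (pi x_i) are positive. *)
Definition open_box n : set (measurableTypeR R * 'cV[R]_n) :=
  [set z : measurableTypeR R * 'cV[R]_n | 0 < (z.1 : R) < 1 /\ forall i, 0 < z.2 i 0 < 1].

(** The boundary is contained in finitely many hyperplanes, which are null sets. *)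
Lemma ae_open_box n : {ae bundle_measure R n, forall z, @open_box n z}.
Proof.
have n1 a : (bundle_measure R n).-negligible ([set a] `*` setT).
  have mE : measurable ([set a] `*` setT : set (measurableTypeR R * 'cV[R]_n)).
    by apply: measurableX.
  apply/negligibleP; [exact: mE|apply: (eq_trans (bundle_measureE mE))].
  rewrite product_measure1E //.
    by rewrite [X in (X * _)%E](_ : _ = 0%E) ?mul0e //; exact: unit_mu_set1.
have n2 i a : (bundle_measure R n).-negligible (setT `*` hyperplane i a).
  have mE : measurable (setT `*` hyperplane i a : set (measurableTypeR R * 'cV[R]_n)).
    by apply: measurableX => //; exact: measurable_hyperplane.
  apply/negligibleP; [exact: mE|apply: (eq_trans (bundle_measureE mE))].
  rewrite product_measure1E //.
    by rewrite [X in (_ * X)%E](_ : _ = 0%E) ?mule0 //; exact: cube_mu_hyperplane.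
  exact: measurable_hyperplane.
have n3 : {ae bundle_measure R n, forall z, fundamental_domain z}.
  apply/negligibleP; first exact: measurableC (@measurable_fundamental_domain R n).
  by rewrite /bundle_measure /= /mrestr setICl measure0.
have n4 : {ae bundle_measure R n, forall (z : measurableTypeR R * 'cV[R]_n) i, z.2 i 0 <> 0 /\ z.2 i 0 <> 1}.
  apply: (@negligibleS _ _ _ _ (\big[setU/set0]_i (setT `*` hyperplane i 0 `|` setT `*` hyperplane i 1))).
    move=> z /= /existsNP[i /not_andP h]; rewrite -bigcup_seq /=.
    exists i => /=; first exact: mem_index_enum.
    by case: h => /contrapT; [left|right].
  elim/big_ind: _ => [|A B nA nB|i _];
    [exact: negligible_set0|exact: negligibleU|exact: negligibleU].
have m (a : R) : {ae bundle_measure R n, forall (z : measurableTypeR R * 'cV[R]_n), (z.1 : R) <> a}.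
  by apply: negligibleS (n1 a) => z /= /contrapT.
near=> z; have n3z : fundamental_domain z by near: z.
have h2 : forall i, z.2 i 0 <> 0 /\ z.2 i 0 <> 1 by near: z.
have h3 : (z.1 : R) <> 0 by near: z; exact: m.
have h4 : (z.1 : R) <> 1 by near: z; exact: m.
have [/andP[a b] h1] := n3z; split.
  by rewrite !lt_neqAle a b !andbT eq_sym; apply/andP; split; apply/eqP.
move=> i; have /andP[c e] := h1 i; have [h5 h6] := h2 i.
by rewrite !lt_neqAle c e !andbT eq_sym; apply/andP; split; apply/eqP.
Unshelve. all: by end_near. Qed.

End restricted_measures.

(** * Trigonometric integrals *)

Section trigonometry.
Variable R : realType.
Implicit Types (a b t theta : R).

Lemma expi2piD a b : expi2pi (a + b) = expi2pi a * expi2pi b.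
Proof.
rewrite /expi2pi mulrDr cosD sinD; apply/eqP; rewrite eq_complex /=.
by apply/andP; split; apply/eqP => //; ring.
Qed.

Lemma expi2pi0 : expi2pi (0 : R) = 1.
Proof. by rewrite /expi2pi mulr0 cos0 sin0. Qed.

Lemma expi2piNK a : expi2pi (- a) * expi2pi a = 1.
Proof. by rewrite -expi2piD addNr expi2pi0. Qed.

Lemma expi2pi_nat (n : nat) : expi2pi n%:R = 1 :> R[i].
Proof.
elim: n => [|n IH]; first exact: expi2pi0.
rewrite -natr1 expi2piD IH mul1r /expi2pi mulr1.
have -> : 2 * pi = pi *+ 2 :> R by rewrite mulr_natl.
by rewrite cos2pi sin2pi.
Qed.

Lemma expi2pi_int (k : int) : expi2pi k%:~R = 1 :> R[i].
Proof.
case: (intP k) => [|n|n]; [exact: expi2pi0|exact: expi2pi_nat|].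
by rewrite -(expi2piNK n.+1%:R) expi2pi_nat mulr1 mulrNz.
Qed.

Lemma expi2pi_shift (k xi : int) (t : R) :
  expi2pi (k%:~R * (t + xi%:~R)) = expi2pi (k%:~R * t).
Proof. by rewrite mulrDr expi2piD -intrM expi2pi_int mulr1. Qed.

Lemma cdot_expi2pi a : cdot (expi2pi a) (expi2pi a) = 1.
Proof. by rewrite /cdot /= -!expr2 cos2Dsin2. Qed.

Lemma cdot_expi2piM (z w : R[i]) a b :
  cdot (z * expi2pi a) (w * expi2pi b) = cdot (z * expi2pi (a - b)) w.
Proof.
rewrite expi2piD; case: z w => [x y] [u v].
rewrite /cdot /expi2pi /= mulrN cosN sinN; ring.
Qed.

Lemma cos_expi2pi a : (cos (2 * pi * a))%:C%C = 2^-1 * expi2pi a + 2^-1 * expi2pi (- a).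
Proof.
rewrite -mulrDr /expi2pi mulrN cosN sinN.
rewrite (_ : _ + _ = (cos (2 * pi * a))%:C%C *+ 2); last first.
  by apply/eqP; rewrite mulr2n eq_complex /= subrr addr0 !eqxx.
by rewrite -(mulr_natl (cos (2 * pi * a))%:C%C) mulrA mulVf ?mul1r // pnatr_eq0.
Qed.

Lemma measurable_cosT d (T : measurableType d) (f : T -> R) :
  measurable_fun setT f -> measurable_fun setT (fun z => cos (f z)).
Proof.
move=> mf; apply: measurableT_comp mf => //.
by apply: continuous_measurable_fun; exact: continuous_cos.
Qed.

Lemma measurable_sinT d (T : measurableType d) (f : T -> R) :
  measurable_fun setT f -> measurable_fun setT (fun z => sin (f z)).
Proof.
move=> mf; apply: measurableT_comp mf => //.
by apply: continuous_measurable_fun; exact: continuous_sin.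
Qed.

Lemma measC_expi2pi d (T : measurableType d) (f : T -> R) :
  measurable_fun setT f -> measC (fun z => expi2pi (f z)).
Proof.
move=> mf; have m2 : measurable_fun setT (fun z => 2 * pi * f z).
  by apply: measurable_funM => //; exact: measurable_cst.
by split; [exact: measurable_cosT|exact: measurable_sinT].
Qed.

Lemma norm_cos_le1 a : `|cos a| <= 1.
Proof. by rewrite ler_norml cos_geN1 cos_le1. Qed.

Lemma unit_mu_fin : (@unit_mu R setT < +oo)%E.
Proof. by rewrite -ge0_fin_numE // fin_num_measure. Qed.

Lemma cube_mu_fin n : (@cube_mu R n setT < +oo)%E.
Proof. by rewrite -ge0_fin_numE // fin_num_measure. Qed.

Lemma integral_unit_mu (f : measurableTypeR R -> \bar R) : measurable_fun setT f ->
  (\int[@unit_mu R]_t f t = \int[@lebesgue_measure R]_(t in `[0%R, 1%R]) f t)%E.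
Proof.
move=> mf; pose D : set (measurableTypeR R) := `[0%R, 1%R]%classic.
have mI : measurable D := @measurable_unit_itv R.
rewrite -(setUv D) integral_setU //; last 3 first.
- exact: measurableC.
- by rewrite setUv.
- by apply/disj_setPS => x [].
rewrite [X in (_ + X)%E](_ : _ = 0%E) ?adde0.
  apply: eq_measure_integral => A mA AI.
  by rewrite /= /unit_mu /mrestr (setIidl AI).
transitivity (\int[mzero]_(t in ~` D) f t)%E; last exact: integral_measure_zero.
apply: eq_measure_integral => A mA AI.
rewrite /= /unit_mu /mrestr (_ : A `&` _ = set0) ?measure0 //.
by apply/seteqP; split => // x [/AI].
Qed.

Lemma measurable_affine k theta :
  measurable_fun [set: measurableTypeR R] (fun t => 2 * pi * (k * (t : R)) + theta).
Proof.
apply: measurable_funD; last exact: measurable_cst.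
by apply: measurable_funM; [exact: measurable_cst|apply: measurable_funM;
  [exact: measurable_cst|exact: measurable_id]].
Qed.

(** The right-hand side is kept as a difference of values of the primitive: it vanishes
   for integral k, and it telescopes for k in Z / N. *)
Lemma integral_unit_cos k theta : k != 0 ->
  (\int[@unit_mu R]_t (cos (2 * pi * (k * t) + theta))%:E =
   ((sin (2 * pi * k + theta) - sin theta) / (2 * pi * k))%:E)%E.
Proof.
move=> k0; rewrite integral_unit_mu; last first.
  by apply/measurable_EFinP; apply: measurable_cosT; exact: measurable_affine.
have c0 : 2 * pi * k != 0 :> R by rewrite !mulf_neq0 // gt_eqF // pi_gt0.
pose F t := sin (2 * pi * (k * t) + theta) / (2 * pi * k).
have dF t : is_derive t 1 F (cos (2 * pi * (k * t) + theta)).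
  rewrite /F; apply: is_derive_eq.
  rewrite scaler0 scaler0 add0r addr0 /GRing.scale /= mulr1.
  have : (pi : R) != 0 by rewrite gt_eqF ?pi_gt0.
  by move: (pi : R) => p p0; field; rewrite k0 p0.
have cF : continuous F.
  by move=> t; apply: differentiable_continuous; apply/derivable1_diffP; case: (dF t).
have cc : continuous (fun t : R => cos (2 * pi * (k * t) + theta)).
  move=> t; apply: differentiable_continuous; apply/derivable1_diffP.
  exact: ex_derive.
rewrite (@continuous_FTC2 _ _ F) //.
- by rewrite /F mulr0 mulr0 add0r mulr1 -EFinB -mulrBl.
- exact: continuous_subspaceT.
- split=> [t _| |]; first by case: (dF t).
  + by apply: cvg_at_right_filter; exact: cF.
  + by apply: cvg_at_left_filter; exact: cF.
- by move=> t _; rewrite derive1E; case: (dF t).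
Qed.

Definition mdot n (m : 'cV[int]_n) (x : 'cV[R]_n) : R := dot (to_R R m) x.

Lemma mdotE n (m : 'cV[int]_n) x : mdot m x = \sum_i (m i 0)%:~R * x i 0.
Proof. by apply: eq_bigr => i _; rewrite mxE. Qed.

Lemma measurable_mdot n (m : 'cV[int]_n) : measurable_fun setT (mdot m).
Proof.
rewrite (_ : mdot m = fun x => \sum_i (m i 0)%:~R * x i 0); last by apply/funext => x; exact: mdotE.
apply: measurable_sum => i; apply: measurable_funM; first exact: measurable_cst.
exact: measurable_coord.
Qed.

Lemma mdot_cons n (m : 'cV[int]_n.+1) (z : R * 'cV[R]_n) :
  mdot m (cons_cV z) = (m 0 0)%:~R * z.1 + mdot (\col_i m (lift ord0 i) 0) z.2.
Proof.
rewrite !mdotE big_ord_recl /cons_cV mxE unlift_none; congr (_ + _).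
by apply: eq_bigr => i _; rewrite !mxE liftK.
Qed.

Lemma measurable_mdot_cos n (m : 'cV[int]_n) theta :
  measurable_fun setT (fun x => cos (2 * pi * mdot m x + theta)).
Proof.
apply: measurable_cosT; apply: measurable_funD; last exact: measurable_cst.
by apply: measurable_funM; [exact: measurable_cst|exact: measurable_mdot].
Qed.

Lemma product_mu_fin n : ((@unit_mu R \x @cube_mu R n)%E setT < +oo)%E.
Proof. by rewrite -bundle_measureE //; exact: bundle_measure_fin. Qed.

(** R itself and measurableTypeR R have the same measurable sets but different
   displays; products of measures live over the latter. *)
Lemma measurable_cons_cVT n :
  measurable_fun [set: measurableTypeR R * 'cV[R]_n] (@cons_cV R n).
Proof. exact: measurable_cons_cV. Qed.

(** The phase theta makes the induction on the dimension work: the first coordinate is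
   absorbed in it unless all the other frequencies vanish, and then one is left with an
   integral over a whole number of periods. *)
Lemma integral_cube_cos n (m : 'cV[int]_n) theta : m != 0 ->
  (\int[@cube_mu R n]_x (cos (2 * pi * mdot m x + theta))%:E = 0)%E.
Proof.
elim: n m theta => [|n IH] m theta m0; first by rewrite flatmx0 eqxx in m0.
pose f (x : 'cV[R]_n.+1) := (cos (2 * pi * mdot m x + theta))%:E.
have mf : measurable_fun setT f by apply/measurable_EFinP; exact: measurable_mdot_cos.
pose g (z : measurableTypeR R * 'cV[R]_n) := cos (2 * pi * mdot m (cons_cV z) + theta).
have ifc : (@unit_mu R \x @cube_mu R n)%E.-integrable setT (EFin \o g).
  apply: (@integrable_bounded _ _ _ _ g 1).
  - exact: product_mu_fin.
  - have h := measurableT_comp (measurable_mdot_cos m theta) (@measurable_cons_cVT n).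
    exact: h.
  - by move=> z; exact: norm_cos_le1.
have H := integral_pushforward (@measurable_cons_cVT n) mf ifc measurableT.
rewrite preimage_setT in H.
transitivity (\int[(@unit_mu R \x @cube_mu R n)%E]_z (f \o @cons_cV R n) z)%E.
  etransitivity; last exact: H.
  apply: eq_measure_integral => [|? A mA _]; last exact: cube_mu_cons.
  exact: measurable_cons_cVT.
rewrite -integral12_prod_meas1 // /fubini_F.
pose m' : 'cV[int]_n := \col_i m (lift ord0 i) 0.
have fE t x : (f \o @cons_cV R n) (t, x) =
    (cos (2 * pi * mdot m' x + (2 * pi * ((m 0 0)%:~R * t) + theta)))%:E.
  by rewrite /f /= mdot_cons /= mulrDr addrAC addrC addrA.
under eq_integral => t _ do under eq_integral => x _ do rewrite fE.
have [m'0|m'0] := eqVneq m' 0; last first.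
  by rewrite integral0_eq // => t _; exact: IH.
have m00 : (m 0 0)%:~R != 0 :> R.
  rewrite intr_eq0; apply: contra m0 => /eqP m00; apply/eqP/colP => i; rewrite [RHS]mxE.
  case: (unliftP ord0 i) => [j ->|->]; last exact: m00.
  by have /colP/(_ j) := m'0; rewrite !mxE.
have E0 x : mdot m' x = 0.
  by rewrite mdotE m'0 big1 // => i _; rewrite mxE mul0r.
under eq_integral => t _ do under eq_integral => x _ do rewrite E0 mulr0 add0r.
have c_fin : @cube_mu R n setT \is a fin_num by rewrite ge0_fin_numE // cube_mu_fin.
have cst (r : R) : (\int[@cube_mu R n]_x r%:E = (fine (@cube_mu R n setT))%:E * r%:E)%E.
  by rewrite integral_cst // muleC fineK.
under eq_integral => t _ do rewrite cst.
pose h (t : measurableTypeR R) := cos (2 * pi * ((m 0 0)%:~R * (t : R)) + theta).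
have ih : (@unit_mu R).-integrable setT (EFin \o h).
  apply: (@integrable_bounded _ _ _ _ h 1).
  - exact: unit_mu_fin.
  - by apply: measurable_cosT; exact: measurable_affine.
  - by move=> t; exact: norm_cos_le1.
have -> := integralZl measurableT ih.
rewrite integral_unit_cos //.
have -> : sin (2 * pi * (m 0 0)%:~R + theta) = sin theta.
  rewrite sinD; have := expi2pi_int (m 0 0); rewrite /expi2pi => -[-> ->].
  by rewrite mul0r mul1r add0r.
by rewrite subrr mul0r mule0.
Qed.

End trigonometry.

(** * Modes *)

Section modes.
Variables (R : realType) (n : nat).
Local Notation space := (measurableTypeR R * 'cV[R]_n)%type.
Local Notation mu := (bundle_measure R n).
Implicit Types (f g : R -> R[i]) (m : 'cV[int]_n).

(** The imaginary part of a times the conjugate of b. *)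
Definition cross (a b : R[i]) : R :=
  complex.Im a * complex.Re b - complex.Re a * complex.Im b.

(** The sine is written as a shifted cosine, so that a single family of integrals
   suffices. *)
Lemma cdot_rot (a b : R[i]) p : cdot (a * expi2pi p) b =
  cdot a b * cos (2 * pi * p) + cross a b * cos (2 * pi * p + pi / 2).
Proof.
rewrite cosDpihalf; case: a b => [x y] [u v].
by rewrite /cdot /cross /expi2pi /=; ring.
Qed.

Definition mode f m (z : space) : R[i] := f z.1 * expi2pi (mdot m z.2).

(** The fibre phases cancel. *)
Lemma cdot_mode f g m z : cdot (mode f m z) (mode g m z) = cdot (f z.1) (g z.1).
Proof. by rewrite cdot_expi2piM subrr expi2pi0 mulr1. Qed.

Lemma mdotB m m' (x : 'cV[R]_n) : mdot m x - mdot m' x = mdot (m - m') x.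
Proof.
rewrite !mdotE -sumrB; apply: eq_bigr => i _.
by rewrite -mulrBl -mulrzBr !mxE rmorphB.
Qed.

Lemma integrable_lin_cos d (T : measurableType d) (nu : {measure set T -> \bar R})
    (h : T -> R) (c : R) : (nu setT < +oo)%E -> measurable_fun setT h ->
  nu.-integrable setT (fun x => (c * cos (h x))%:E).
Proof.
move=> nuoo mh; apply: (@integrable_bounded _ _ _ _ (fun x => c * cos (h x)) `|c|) => //.
  by apply: measurable_funM; [exact: measurable_cst|exact: measurable_cosT].
by move=> x; rewrite normrM ler_piMr // norm_cos_le1.
Qed.

Lemma integral_lin_cos d (T : measurableType d) (nu : {measure set T -> \bar R})
    (h h' : T -> R) (c c' : R) : (nu setT < +oo)%E ->
  measurable_fun setT h -> measurable_fun setT h' ->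
  (\int[nu]_x (c * cos (h x) + c' * cos (h' x))%:E =
   c%:E * \int[nu]_x (cos (h x))%:E + c'%:E * \int[nu]_x (cos (h' x))%:E)%E.
Proof.
move=> nuoo mh mh'.
have i1 := integrable_lin_cos c nuoo mh.
have i2 := integrable_lin_cos c' nuoo mh'.
under eq_integral => x _ do rewrite EFinD.
rewrite integralD //; congr (_ + _)%E.
  rewrite -integralZl //; have := integrable_lin_cos 1 nuoo mh.
  by apply: eq_integrable => // x _; rewrite mul1r.
rewrite -integralZl //; have := integrable_lin_cos 1 nuoo mh'.
by apply: eq_integrable => // x _; rewrite mul1r.
Qed.

(** By Fubini's theorem: for fixed t the integrand is a combination of two shifted cosines
   of nonzero frequency m - m' in x. *)
Lemma mode_orthogonal f g m m' : m != m' -> L2 mu (mode f m) -> L2 mu (mode g m') ->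
  ip mu (mode f m) (mode g m') = 0.
Proof.
move=> mm' hf hg; rewrite /ip /Rintegral integral_bundle.
have := integrable_bundle (L2_integrable hf hg) => hi.
rewrite -(integral12_prod_meas1 hi) /fubini_F integral0_eq // => t _.
transitivity (\int[@cube_mu R n]_x (cdot (f t) (g t) * cos (2 * pi * mdot (m - m') x + 0) +
    cross (f t) (g t) * cos (2 * pi * mdot (m - m') x + pi / 2))%:E)%E.
  by apply: eq_integral => x _ /=; rewrite cdot_expi2piM mdotB cdot_rot addr0.
have ma th : measurable_fun setT (fun x : 'cV[R]_n => 2 * pi * mdot (m - m') x + th).
  apply: measurable_funD; last exact: measurable_cst.
  by apply: measurable_funM; [exact: measurable_cst|exact: measurable_mdot].
rewrite integral_lin_cos //; last exact: cube_mu_fin.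
by rewrite !integral_cube_cos ?subr_eq0 // !mule0 adde0.
Qed.

Lemma measC_mode f m : measurable_fun [set: measurableTypeR R] (fun t => complex.Re (f t)) ->
  measurable_fun [set: measurableTypeR R] (fun t => complex.Im (f t)) -> measC (mode f m).
Proof.
move=> mR mI; apply: measCM.
  by split; [exact: (measurableT_comp mR measurable_fst)|exact: (measurableT_comp mI measurable_fst)].
by apply: measC_expi2pi; exact: (measurableT_comp (measurable_mdot m) measurable_snd).
Qed.

Lemma integral_bundle_fst (q : measurableTypeR R -> R) :
  measurable_fun setT q -> (forall t, 0 <= q t) ->
  (\int[mu]_z (q z.1)%:E = \int[@unit_mu R]_t (q t)%:E * @cube_mu R n setT)%E.
Proof.
move=> mq q0; rewrite integral_bundle fubini_tonelli1 //; last 2 first.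
- by apply/measurable_EFinP; exact: (measurableT_comp mq measurable_fst).
- by move=> z; rewrite lee_fin.
rewrite /fubini_F /=; under eq_integral => t _ do rewrite integral_cst //.
rewrite ge0_integralZr //; first exact/measurable_EFinP.
by move=> t _; rewrite lee_fin.
Qed.

Lemma integral_bundle_fst_cos k theta :
  (\int[mu]_z (cos (2 * pi * (k * (z.1 : R)) + theta))%:E =
   \int[@unit_mu R]_t (cos (2 * pi * (k * (t : R)) + theta))%:E * @cube_mu R n setT)%E.
Proof.
pose h (z : space) := cos (2 * pi * (k * (z.1 : R)) + theta).
have ih : (@unit_mu R \x @cube_mu R n)%E.-integrable setT (EFin \o h).
  apply: (@integrable_bounded _ _ _ _ h 1).
  - exact: product_mu_fin.
  - by apply: measurable_cosT; exact: (measurableT_comp (measurable_affine k theta) measurable_fst).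
  - by move=> t; exact: norm_cos_le1.
rewrite integral_bundle -(integral12_prod_meas1 ih) /fubini_F.
have cst t : (\int[@cube_mu R n]_x (EFin \o h) (t, x) =
    (cos (2 * pi * (k * t) + theta))%:E * @cube_mu R n setT)%E.
  by under eq_integral do rewrite /= /h /=; rewrite integral_cst.
under eq_integral => t _ do rewrite cst.
have ik : (@unit_mu R).-integrable setT (fun t : R => (1 * cos (2 * pi * (k * t) + theta))%:E).
  apply: integrable_lin_cos; [exact: unit_mu_fin|exact: measurable_affine].
have c_fin : @cube_mu R n setT \is a fin_num by rewrite ge0_fin_numE // cube_mu_fin.
rewrite -(fineK c_fin) -integralZr //; last first.
  by apply: eq_integrable ik => // t _; rewrite mul1r.
Qed.

End modes.

(** * Orthogonal series, and cutting the line into unit intervals *)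

Section orthogonal_series.
Context d (T : measurableType d) (R : realType) (mu : {measure set T -> \bar R}).
Hypothesis mu_fin : (mu [set: T] < +oo)%E.

Lemma ip_sumr (I : eqType) (s : seq I) (G : I -> T -> R[i]) H :
  (forall i, i \in s -> L2 mu (G i)) -> L2 mu H ->
  ip mu H (fun z => \sum_(i <- s) G i z) = \sum_(i <- s) ip mu H (G i).
Proof.
by move=> hG hH; rewrite ipC ip_suml //; apply: eq_bigr => i _; exact: ipC.
Qed.

Lemma ip_sum_orthogonal (I : eqType) (s : seq I) (u : I -> T -> R[i]) : uniq s ->
  (forall i, i \in s -> L2 mu (u i)) ->
  (forall i j, i \in s -> j \in s -> i != j -> ip mu (u i) (u j) = 0) ->
  ip mu (fun z => \sum_(i <- s) u i z) (fun z => \sum_(i <- s) u i z) =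
  \sum_(i <- s) ip mu (u i) (u i).
Proof.
move=> us hu ou; rewrite ip_suml //; last exact: L2_sum_in.
rewrite big_seq [RHS]big_seq; apply: eq_bigr => i si.
rewrite ip_sumr //; last exact: hu.
rewrite (bigD1_seq i) //= big_seq_cond big1 ?addr0 // => j /andP[sj ji].
by apply: ou; rewrite // eq_sym.
Qed.

Lemma perm_fsetD (I : choiceType) (J0 J : {fset I}) : (J0 `<=` J)%fset ->
  perm_eq J (J0 ++ (J `\` J0)%fset).
Proof.
move=> /fsubsetP JJ; apply: uniq_perm; first exact: fset_uniq.
  rewrite cat_uniq !fset_uniq andbT /=; apply/hasPn => i.
  by rewrite in_fsetD => /andP[].
move=> i; rewrite mem_cat in_fsetD; case: (boolP (i \in J0)) => [/JJ ->|] //=.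
Qed.

Variables (I : choiceType) (u : I -> T -> R[i]) (B : R).
Hypothesis hu : forall i, L2 mu (u i).
Hypothesis ou : forall i j, i != j -> ip mu (u i) (u j) = 0.
Hypothesis uB : forall J : {fset I}, \sum_(i <- J) ip mu (u i) (u i) <= B.

Local Notation psum J := (fun z => \sum_(i <- (J : {fset I})) u i z).

(** The partial sums of the squared norms have a supremum, so finite sets almost reaching
   it leave small tails by Pythagoras; a sequence of such sets is rapidly Cauchy. *)
Lemma orthogonal_series_cvg : exists2 F, L2 mu F &
  forall e : R, 0 < e -> exists J0 : {fset I}, forall J : {fset I},
    (J0 `<=` J)%fset -> L2dist mu F (psum J) < e.
Proof.
have hS (J : {fset I}) : L2 mu (psum J) by exact: L2_sum.
pose E := [set r | exists J : {fset I}, r = \sum_(i <- J) ip mu (u i) (u i)].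
have supE : has_sup E.
  split; first by exists 0, fset0; rewrite big_seq_fset0.
  by exists B => _ [J ->].
have tailP (eta : R) : 0 < eta -> exists J0 : {fset I}, forall J : {fset I},
    (J0 `<=` J)%fset -> L2dist mu (psum J0) (psum J) <= eta.
  move=> eta0; have [_ [J0 ->] supJ0] := sup_adherent (exprn_gt0 2 eta0) supE.
  exists J0 => J JJ; have pJ := perm_fsetD JJ.
  have -> : L2dist mu (psum J0) (psum J) = nrm mu (psum (J `\` J0)%fset).
    rewrite L2distC; congr nrm; apply/funext => z.
    by rewrite (perm_big _ pJ) /= big_cat /= addrAC subrr add0r.
  rewrite -ler_sqr ?nnegrE ?nrm_ge0 ?(ltW eta0) // sqr_nrm.
  rewrite ip_sum_orthogonal ?fset_uniq //; last by move=> i j _ _; exact: ou.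
  have : \sum_(i <- J) ip mu (u i) (u i) <= sup E.
    by apply: sup_upper_bound => //; exists J.
  rewrite (perm_big _ pJ) /= big_cat /=; move: supJ0.
  move: (\sum_(i <- J0) _) (\sum_(i <- (J `\` J0)%fset) _) (eta ^+ 2) (sup E) => a b c e; lra.
(* Two tails of size 2^-k / 4 make two consecutive partial sums 2^-k close. *)
pose eps k : R := 2 ^- k / 4.
have eps0 k : 0 < eps k by rewrite divr_gt0 // invr_gt0 exprn_gt0.
have [J_ hJ] := choice (fun k => tailP _ (eps0 k)).
have [k|F hF FJ] := L2_complete mu_fin (fun k => hS (J_ k)).
  apply: le_trans (L2dist_triangle (hS _) (hS (J_ k `|` J_ k.+1)%fset) (hS _)) _.
  rewrite [X in _ + X]L2distC.
  have h1 := hJ k _ (fsubsetUl (J_ k) (J_ k.+1)).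
  have h2 := hJ k.+1 _ (fsubsetUr (J_ k) (J_ k.+1)).
  apply: le_trans (lerD h1 h2) _; rewrite /eps.
  have -> : 2 ^- k.+1 = 2 ^- k / 2 :> R by rewrite exprS invfM mulrC.
  have : 0 < 2 ^- k :> R by rewrite invr_gt0 exprn_gt0.
  lra.
exists F => // e e0.
have : 2 ^- k @[k --> \oo] --> (0 : R).
  under eq_fun do rewrite -exprVn.
  by apply: (@cvg_expr R 2^-1); rewrite ger0_norm ?invr_ge0 //; lra.
have e3 : 0 < e / 3 by rewrite divr_gt0.
move=> /cvgrPdist_lt /(_ _ e3) [k _ /(_ k (leqnn k))] /=.
rewrite sub0r normrN ger0_norm ?invr_ge0 ?exprn_ge0 // => ke.
exists (J_ k) => J JJ; apply: le_lt_trans (L2dist_triangle hF (hS (J_ k)) (hS J)) _.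
rewrite L2distC; have h1 := FJ k; have h2 := hJ k _ JJ; move: h2; rewrite /eps.
have : 0 < 2 ^- k :> R by rewrite invr_gt0 exprn_gt0.
by move: (L2dist _ _ _) h1 (L2dist _ _ _) ke => a h1 b; lra.
Qed.

End orthogonal_series.

Section translation.
Variable R : realType.
Local Notation lambda := (@lebesgue_measure R).

Lemma measurable_shiftR c : measurable_fun [set: measurableTypeR R]
  (fun t => (t : R) + c : measurableTypeR R).
Proof. by apply: measurable_funD; [exact: measurable_id|exact: measurable_cst]. Qed.

Lemma preimage_shift_itv (a b c : R) b0 b1 :
  (fun t : R => t + c) @^-1` [set` Interval (BSide b0 a) (BSide b1 b)] =
  [set` Interval (BSide b0 (a - c)) (BSide b1 (b - c))].
Proof.
apply/seteqP; split => t; case: b0; case: b1;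
  by rewrite /= !in_itv /= ?lerBlDr ?ltrBlDr ?lerBrDr ?ltrBrDr.
Qed.

Lemma lebesgue_measure_shift c (A : set R) : measurable A ->
  pushforward lambda (fun t => (t : R) + c : measurableTypeR R) A = lambda A.
Proof.
move=> mA; apply/esym/lebesgue_measure_unique => //=; first exact: measurable_shiftR.
move=> _ X [[a b]] _ <-.
rewrite /pushforward preimage_shift_itv /= !lebesgue_measure_itv /=.
by rewrite !lte_fin ltrD2r; case: ifP => // _; rewrite -!EFinB; congr EFin; ring.
Qed.

(** The half-open interval makes the translates by integers disjoint. *)
Lemma integral_unit_shift (q : measurableTypeR R -> R) c :
  measurable_fun setT q -> (forall t, 0 <= q t) ->
  (\int[@unit_mu R]_t (q ((t : R) + c))%:E =
   \int[lambda]_(t in `[c, (c + 1)%R[) (q t)%:E)%E.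
Proof.
move=> mq q0.
have mqc : measurable_fun setT (fun t : measurableTypeR R => (q ((t : R) + c))%:E).
  by apply/measurable_EFinP; exact: (measurableT_comp mq (measurable_shiftR c)).
rewrite integral_unit_mu // -integral_itv_bndo_bndc; last exact: measurable_funTS.
have -> : `[0, 1[%classic = (fun t : R => t + c) @^-1` `[c, (c + 1)%R[%classic.
  by rewrite preimage_shift_itv subrr addrAC subrr add0r.
rewrite -[LHS](@ge0_integral_pushforward _ _ _ _ _ _ (measurable_shiftR c) lambda _ (EFin \o q)) //.
- apply: eq_measure_integral => [|? A mA _]; first exact: measurable_shiftR.
  exact: lebesgue_measure_shift.
- by apply/measurable_EFinP; exact: measurable_funTS.
- by move=> t _; rewrite lee_fin.
Qed.

(** This is the comparison of a series over Z with an integral over the line. *)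
Lemma sum_integral_unit_shift (q : measurableTypeR R -> R) (J : {fset int}) :
  measurable_fun setT q -> (forall t, 0 <= q t) ->
  (\sum_(xi <- J) \int[@unit_mu R]_t (q ((t : R) + xi%:~R))%:E <=
   \int[lambda]_t (q t)%:E)%E.
Proof.
move=> mq q0.
under eq_bigr => xi _ do rewrite integral_unit_shift //.
pose F (xi : int) : set (measurableTypeR R) := `[xi%:~R, (xi%:~R + 1)%R[%classic.
have mF xi : measurable (F xi) by exact: measurable_itv.
have tF : trivIset [set` J] F.
  move=> xi zeta _ _ [t []]; rewrite /F /= !in_itv /= => xit zetat.
  have fl (k : int) : k%:~R <= t < k%:~R + 1 -> Num.floor t = k.
    by move=> h; apply: Num.Theory.floor_def; rewrite intrD.
  by rewrite -(fl _ xit) -(fl _ zetat).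
rewrite -ge0_integral_bigsetU ?fset_uniq //.
- apply: ge0_subset_integral => //.
  + by apply: bigsetU_measurable => xi _.
  + exact/measurable_EFinP.
  + by move=> t _; rewrite lee_fin.
- by apply: measurable_funTS; exact/measurable_EFinP.
- by move=> t _; rewrite lee_fin.
Qed.

End translation.

(** * Integer matrices and orbits of frequencies *)

(** Measurability has to be assumed, the Borel structure not being complete. *)
Lemma L2_ae_eq d (T : measurableType d) (R : realType) (mu : {measure set T -> \bar R})
    (F G : T -> R[i]) : measC F -> L2 mu G -> {ae mu, forall z, F z = G z} -> L2 mu F.
Proof.
move=> mF hG FG; have [mG iG] := (iffLR (L2P mu G) hG); apply/L2P; split=> //.
have mc := measurable_cdot mF mF.
apply/integrableP; split; first exact/measurable_EFinP.
have /integrableP[mg] := iG; congr (_ < _)%E; apply: ge0_ae_eq_integral => //.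
- exact: measurableT_comp.
- by apply: measurableT_comp => //; exact/measurable_EFinP.
- by apply: filterS FG => z /= -> _.
Qed.

Section integer_matrices.
Variables (R : realType) (n : nat) (A : 'M[int]_n.+1).
Hypothesis A_unit : A \in unitmx.
Implicit Types (xi zeta : int) (y : 'cV[int]_n.+1) (x : 'cV[R]_n.+1).

Lemma to_RM p q r (B : 'M[int]_(p, q)) (C : 'M[int]_(q, r)) :
  to_R R (B *m C) = to_R R B *m to_R R C.
Proof. exact: (map_mxM intr). Qed.

Lemma to_R1 p : to_R R (1%:M : 'M[int]_p) = 1%:M.
Proof. exact: (map_mx1 intr). Qed.

Lemma expAD xi zeta : A ^ (xi + zeta) = A ^ xi *m A ^ zeta.
Proof. exact: exprzDr. Qed.

Lemma to_R_expAD xi zeta x : to_R R (A ^ (xi + zeta)) *m x =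
  to_R R (A ^ xi) *m (to_R R (A ^ zeta) *m x).
Proof. by rewrite expAD to_RM mulmxA. Qed.

Lemma trmx_expz xi : A^T ^ xi = (A ^ xi)^T.
Proof.
have trX (B : 'M[int]_n.+1) k : B^T ^+ k = (B ^+ k)^T.
  elim: k => [|k IH]; first by rewrite !expr0 trmx1.
  by rewrite exprS exprSr IH -!mulmxE trmx_mul.
case: (intP xi) => [|k|k]; [exact: trX|exact: trX|].
rewrite -!exprnN trX; exact: (esym (trmx_inv (A ^+ k.+1))).
Qed.

Lemma dotE (u v : 'cV[R]_n.+1) : dot u v = (u^T *m v) 0 0.
Proof. by rewrite mxE; apply: eq_bigr => i _; rewrite mxE. Qed.

(** Transposition moves A^xi from the point to the frequency. *)
Lemma phaseE y xi x : phase A y xi x = mdot (A^T ^ xi *m y) x.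
Proof.
rewrite /phase /mdot !dotE trmx_expz to_RM trmx_mul mulmxA; congr ((_ *m _ *m _) 0 0).
by rewrite /to_R map_trmx trmxK.
Qed.

Lemma phase_shift y xi zeta x : phase A y xi (to_R R (A ^ zeta) *m x) = phase A y (xi + zeta) x.
Proof. by rewrite /phase to_R_expAD. Qed.

Lemma mdot_int y (eta : 'cV[int]_n.+1) : exists k : int, mdot y (to_R R eta) = k%:~R.
Proof.
exists (\sum_i y i 0 * eta i 0); rewrite mdotE rmorph_sum; apply: eq_bigr => i _.
by rewrite mxE rmorphM.
Qed.

Lemma mdotDr y x x' : mdot y (x + x') = mdot y x + mdot y x'.
Proof. by rewrite !mdotE -big_split; apply: eq_bigr => i _; rewrite mxE mulrDr. Qed.

Lemma expi2pi_mdot_periodic y (eta : 'cV[int]_n.+1) x :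
  expi2pi (mdot y (x + to_R R eta)) = expi2pi (mdot y x).
Proof.
by rewrite mdotDr expi2piD; have [k ->] := mdot_int y eta; rewrite expi2pi_int mulr1.
Qed.

End integer_matrices.

Section orbits.
Variables (n : nat) (A : 'M[int]_n.+1).
Hypothesis A_unit : A \in unitmx.
Implicit Types (xi zeta : int) (y : 'cV[int]_n.+1).
Local Notation act xi y := (A^T ^ xi *m y).

Lemma AT_unit : A^T \in unitmx. Proof. by rewrite unitmx_tr. Qed.

Lemma actD xi zeta y : act (xi + zeta) y = act xi (act zeta y).
Proof. by rewrite (expAD AT_unit) mulmxA. Qed.

Lemma act0 y : act 0 y = y. Proof. by rewrite expr0z mul1mx. Qed.

Lemma lattice_orbit_refl y : lattice_orbit A y y.
Proof. by exists 0 => //; rewrite act0. Qed.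

Lemma lattice_orbit_eq y y' : lattice_orbit A y y' -> lattice_orbit A y' = lattice_orbit A y.
Proof.
move=> [xi _ <-]; apply/seteqP; split => _ [zeta _ <-].
  by exists (zeta + xi) => //; rewrite actD.
by exists (zeta - xi) => //; rewrite -actD subrK.
Qed.

Lemma orbit_mem o y : orbits A o -> o y -> lattice_orbit A y = o.
Proof. by move=> [y' _ <-]; exact: lattice_orbit_eq. Qed.

Lemma act_period y (d : nat) q : act d%:Z y = y -> act (q * d%:Z) y = y.
Proof.
move=> yd; have nat_per (k : nat) : act (k%:Z * d%:Z) y = y.
  elim: k => [|k IH]; first by rewrite mul0r act0.
  have -> : k.+1%:Z * d%:Z = k%:Z * d%:Z + d%:Z by rewrite -addn1 PoszD mulrDl mul1r.
  by rewrite actD yd IH.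
case: (intP q) => [|k|k]; [by rewrite mul0r act0|exact: nat_per|].
by rewrite -{1}(nat_per k.+1) -actD mulNr addNr act0.
Qed.

(** Euclidean division of the exponent by a period. *)
Lemma act_modz y (d : nat) xi : (0 < d)%N -> act d%:Z y = y ->
  exists2 i : nat, (i < d)%N & act xi y = act i%:Z y.
Proof.
move=> d0 yd; have dz : d%:Z != 0 by rewrite eqz_nat -lt0n.
exists (`|(xi %% d%:Z)%Z|)%N.
  by rewrite -ltz_nat gez0_abs ?modz_ge0 // ltz_pmod // ltz_nat.
rewrite gez0_abs ?modz_ge0 // {1}(divz_eq xi d%:Z) addrC actD act_period //.
Qed.

(** The difference of two exponents giving the same element is a period. *)
Lemma act_eq_period y xi zeta : xi != zeta -> act xi y = act zeta y ->
  exists2 d : nat, (0 < d)%N & act d%:Z y = y.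
Proof.
move=> + e; wlog lt : xi zeta e / xi < zeta.
  by move=> h; rewrite neq_lt => /orP[lt|lt]; [apply: (h xi zeta)|apply: (h zeta xi)];
    rewrite // lt_eqF.
move=> _; exists (`|zeta - xi|)%N; first by rewrite absz_gt0 subr_eq0 gt_eqF.
rewrite gez0_abs ?subr_ge0 ?ltW // addrC actD -e -actD addNr act0 //.
Qed.

Lemma infinite_orbit_inj y : infinite_set (lattice_orbit A y) ->
  injective (fun xi => act xi y).
Proof.
move=> inf xi zeta e; apply: contrapT => /eqP ne; apply: inf.
have [d d0 yd] := act_eq_period ne e.
apply: (sub_finite_set _ (finite_image (fun i : nat => act i%:Z y) (finite_II d))).
move=> _ [eta _ <-]; have [i id ->] := act_modz eta d0 yd.
by exists i.
Qed.

(** The least positive period is the size of the orbit. *)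
Lemma finite_orbitP y : finite_set (lattice_orbit A y) ->
  [/\ (0 < orbit_size A y)%N, act (orbit_size A y)%:Z y = y &
      forall i j : nat, (i < orbit_size A y)%N -> (j < orbit_size A y)%N ->
        act i%:Z y = act j%:Z y -> i = j].
Proof.
move=> fin.
have [d0 [d0_gt0 yd0]] : exists d : nat, (0 < d)%N /\ act d%:Z y = y.
  have : ~ injective (fun i : nat => act i%:Z y).
    move=> inj; apply: infinite_nat.
    rewrite (_ : [set: nat] = (fun i : nat => act i%:Z y) @^-1` lattice_orbit A y).
      by apply: finite_preimage => // i j _ _; exact: inj.
    by apply/seteqP; split => // i _; exists i%:Z.
  move=> /existsNP[xi /existsNP[zeta /not_implyP[e /eqP ne]]].
  by have [||d ? ?] := @act_eq_period y xi%:Z zeta%:Z; [by rewrite eqz_nat|exact: e|exists d].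
pose P d := (0 < d)%N && (act d%:Z y == y).
have exP : exists d, P d by exists d0; rewrite /P d0_gt0 yd0 eqxx.
have [d /andP[d_gt0 /eqP yd] dmin] := ex_minnP exP.
have dinj (i j : nat) : (i < d)%N -> (j < d)%N -> act i%:Z y = act j%:Z y -> i = j.
  wlog ij : i j / (i <= j)%N.
    move=> h; case: (leqP i j) => [|/ltnW] ij id jd e; first exact: h.
    by apply/esym; apply: h.
  move=> id jd e; apply/eqP; rewrite eqn_leq ij /= leqNgt; apply/negP => lt.
  have : P (j - i)%N.
    rewrite /P subn_gt0 lt /=; apply/eqP.
    by rewrite -subzn // addrC actD -e -actD addNr act0.
  by move=> /dmin; rewrite leqNgt (leq_ltn_trans (leq_subr _ _) jd).
have us : uniq [seq act i%:Z y | i : nat <- iota 0 d].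
  rewrite map_inj_in_uniq ?iota_uniq // => i j; rewrite !mem_iota /= !add0n; exact: dinj.
have -> : orbit_size A y = d.
  rewrite /orbit_size.
  have -> : lattice_orbit A y =
      [set` [fset m in [seq act i%:Z y | i : nat <- iota 0 d]]%fset].
    apply/seteqP; split => [_ [xi _ <-]|m] /=.
      have [i id ->] := act_modz xi d_gt0 yd.
      by rewrite !inE /=; apply/mapP; exists i; rewrite // mem_iota.
    by rewrite !inE => /mapP[i _ ->]; exists i%:Z.
  by rewrite set_fsetK card_fseq undup_id // size_map size_iota.
by split.
Qed.

End orbits.

(** * Extending functions from the fundamental domain to M *)

Section periodization.
Variables (R : realType) (n : nat) (A : 'M[int]_n.+1).
Hypothesis A_unit : A \in unitmx.
Local Notation space := (measurableTypeR R * 'cV[R]_n.+1)%type.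
Local Notation mu := (bundle_measure R n.+1).
Implicit Types (G : space -> R[i]) (v x : 'cV[R]_n.+1).

Definition fracv v : 'cV[R]_n.+1 := \col_i (v i 0 - (Num.floor (v i 0))%:~R).

(** The representative of z in [0, 1[ x [0, 1[^n: first t is brought to [0, 1[ by a power
   of the gluing, then x by an integral translation. *)
Definition reduce (z : space) : space :=
  ((z.1 : R) - (Num.floor (z.1 : R))%:~R,
   fracv (to_R R (A ^ (- Num.floor (z.1 : R))) *m z.2)).

Lemma fracvD v (eta : 'cV[int]_n.+1) : fracv (v + to_R R eta) = fracv v.
Proof.
apply/colP => i; rewrite !mxE floorDrz ?intr_int // intrKfloor rmorphD /=.
by rewrite opprD addrACA subrr addr0.
Qed.

(** Reduction is constant on the classes of points identified in M. *)
Lemma reduce_bundle G : bundle_function A (fun z => G (reduce z)).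
Proof.
move=> t x; split=> [eta|xi]; congr G; rewrite /reduce /=; congr pair.
  by rewrite mulmxDr -to_RM fracvD.
  by rewrite floorDrz ?intr_int // intrKfloor rmorphD /= opprD addrACA subrr addr0.
rewrite floorDrz ?intr_int // intrKfloor -to_R_expAD //.
by rewrite opprD addrNK.
Qed.

Lemma reduce_open_box z : open_box z -> reduce z = z.
Proof.
case: z => t x [/andP[t0 t1] x01]; rewrite /reduce /=.
have fl (r : R) : 0 < r < 1 -> Num.floor r = 0.
  by move=> /andP[r0 r1]; apply: floor_def; rewrite add0r ltW.
rewrite fl ?t0 // subr0 oppr0 expr0z to_R1 mul1mx; congr pair.
by apply/colP => i; rewrite mxE fl ?subr0 // x01.
Qed.

Lemma measurable_floorR : measurable_fun [set: measurableTypeR R]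
  (fun t => (Num.floor (t : R))%:~R : measurableTypeR R).
Proof.
have : measurable_fun [set: R] (fun t : R => (Num.floor t)%:~R : R).
  by apply: nondecreasing_measurable => // x y *; rewrite ler_int le_floor.
exact.
Qed.

(** On each of the countably many slabs where the floor of t is constant, reduction is
   an affine map followed by fractional parts. *)
Lemma measurable_reduce : measurable_fun [set: space] reduce.
Proof.
pose E (i : nat) : set space := if @choice.unpickle int i is Some k then
  fst @^-1` `[(k : int)%:~R, (k%:~R + 1)%R[%classic else set0.
have mE i : measurable (E i).
  rewrite /E; case: (choice.unpickle i) => // k.
  by rewrite -[X in measurable X]setTI; apply: measurable_fst => //; exact: measurable_itv.
have -> : [set: space] = (\bigcup_i E i)%classic.
  apply/seteqP; split => // z _; exists (choice.pickle (Num.floor (z.1 : R))) => //.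
  rewrite /E choice.pickleK /= in_itv /=; have := floor_itv (z.1 : R).
  by rewrite intrD.
apply/measurable_fun_bigcup => // i; rewrite /E; case: (choice.unpickle i) => [k|];
  last exact: measurable_fun_set0.
pose r (z : space) : space := ((z.1 : R) - k%:~R, fracv (to_R R (A ^ (- k)) *m z.2)).
apply: (@eq_measurable_fun _ _ _ _ _ r).
  move=> z; rewrite inE /= in_itv /= => h.
  have fl : Num.floor (z.1 : R) = k by apply: floor_def; rewrite intrD.
  by rewrite /r /reduce fl.
apply: measurable_funTS; apply: measurable_fun_pair.
  apply: measurable_funB; [exact: measurable_fst|exact: measurable_cst].
apply: measurable_fun_coordP => j.
pose c (z : space) : R := \sum_l to_R R (A ^ (- k)) j l * z.2 l 0.
have mc : measurable_fun [set: space] c.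
  apply: measurable_sum => l; apply: measurable_funM; first exact: measurable_cst.
  exact: (measurableT_comp (measurable_coord l) measurable_snd).
rewrite (_ : (fun z => _) = (fun z => c z - (Num.floor (c z))%:~R)); last first.
  by apply/funext => z; rewrite !mxE.
by apply: measurable_funB => //; exact: (measurableT_comp measurable_floorR mc).
Qed.

(** Almost every point of the fundamental domain is its own reduction. *)
Lemma periodize G : L2 mu G ->
  exists2 F, L2_bundle A F & {ae mu, forall z, F z = G z}.
Proof.
move=> hG; have [mR mI] := L2_meas hG.
have FG : {ae mu, forall z, G (reduce z) = G z}.
  by apply: filterS (ae_open_box R n.+1) => z /reduce_open_box ->.
exists (fun z => G (reduce z)) => //; split; first exact: reduce_bundle.
apply: L2_ae_eq hG FG; split.
- exact: (measurableT_comp mR measurable_reduce).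
- exact: (measurableT_comp mI measurable_reduce).
Qed.

Lemma bundle_function_lin (a : R[i]) F G : bundle_function A F -> bundle_function A G ->
  bundle_function A (fun z => a * F z + G z).
Proof.
move=> bF bG t x; have [F1 F2] := bF t x; have [G1 G2] := bG t x; split=> [eta|xi].
  by rewrite (F1 eta) (G1 eta).
by rewrite (F2 xi) (G2 xi).
Qed.

Lemma L2_bundle_lin (a : R[i]) F G : L2_bundle A F -> L2_bundle A G ->
  L2_bundle A (fun z => a * F z + G z).
Proof.
move=> [bF hF] [bG hG]; split; first exact: bundle_function_lin.
by apply: L2D => //; exact: L2Z.
Qed.

Lemma L2_bundle0 : L2_bundle A (fun=> 0 : R[i]).
Proof. by split; [split|exact: L2_0]. Qed.

End periodization.

(** * Closed sums of subspaces *)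

Section closed_sums.
Variables (R : realType) (n : nat) (A : 'M[int]_n.+1).
Local Notation space := (measurableTypeR R * 'cV[R]_n.+1)%type.
Local Notation mu := (bundle_measure R n.+1).

Lemma bundle_L2 (F : space -> R[i]) : L2_bundle A F -> L2 mu F.
Proof. by case. Qed.

(** Orthogonality passes to the closure by continuity. *)
Lemma ip_L2cl (W : set (space -> R[i])) F G : W `<=` L2 mu -> L2 mu F -> L2cl mu W G ->
  (forall H, W H -> ip mu F H = 0) -> ip mu F G = 0.
Proof.
move=> WL hF [hG cG] FW; apply/eqP; rewrite -normr_le0; apply/ler_addgt0Pr => e e0.
rewrite add0r; pose c := nrm mu F + 1.
have c0 : 0 < c by rewrite ltr_wpDl // nrm_ge0.
have [H WH GH] := cG _ (divr_gt0 e0 c0).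
have hH := WL _ WH.
have -> : ip mu F G = ip mu F (fun z => G z - H z).
  by rewrite [RHS]ipC ipBl // [ip mu H F]ipC (FW _ WH) subr0 ipC.
apply: le_trans (ip_le_nrm hF (L2B hG hH)) _.
apply: (@le_trans _ _ (c * (e / c))); last by rewrite mulrC divfK ?gt_eqF.
by rewrite ler_pM ?nrm_ge0 // ?lerDl // ltW.
Qed.

Section family.
Variables (I : choiceType) (D : set I) (V : I -> set (space -> R[i])).
Hypothesis subV : forall i, D i -> bundle_subspace A (V i).

Definition algebraic_sum : set (space -> R[i]) := [set S | exists (J : {fset I}) G,
  (forall i, i \in J -> D i /\ V i (G i)) /\ S = (fun z => \sum_(i <- J) G i z)].

Lemma subspace_L2 i F : D i -> V i F -> L2 mu F.
Proof. by move=> Di VF; have [VL _ _] := subV Di; exact/bundle_L2/VL. Qed.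

Lemma algsum_L2 : algebraic_sum `<=` L2 mu.
Proof.
move=> _ [J [G [VG ->]]]; apply: L2_sum_in => i /VG[Di VGi]; exact: subspace_L2 VGi.
Qed.

(** Two finite index sets are replaced by their union, extending both families by zero. *)
Lemma algebraic_sum_lin a F G : algebraic_sum F -> algebraic_sum G ->
  algebraic_sum (fun z => a * F z + G z).
Proof.
move=> [J [U [VU ->]]] [K [U' [VU' ->]]].
pose X i := if i \in J then U i else (fun=> 0).
pose Y i := if i \in K then U' i else (fun=> 0).
exists (J `|` K)%fset, (fun i z => a * X i z + Y i z); split.
  move=> i; rewrite in_fsetU => iJK.
  have Di : D i by case/orP: iJK => [/VU[]|/VU'[]].
  split=> //; have [_ V0 Vlin] := subV Di; apply: Vlin; rewrite /X /Y.
    by case: ifPn => // /VU[].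
  by case: ifPn => // /VU'[].
apply/funext => z; rewrite big_split -mulr_sumr; congr (a * _ + _).
  transitivity (\sum_(i <- J) X i z).
    by rewrite big_seq [RHS]big_seq; apply: eq_bigr => i iJ; rewrite /X iJ.
  by apply: big_fset_incl (fsubsetUl J K) _ => i _ /negbTE iJ; rewrite /X iJ.
transitivity (\sum_(i <- K) Y i z).
  by rewrite big_seq [RHS]big_seq; apply: eq_bigr => i iJ; rewrite /Y iJ.
by apply: big_fset_incl (fsubsetUr J K) _ => i _ /negbTE iJ; rewrite /Y iJ.
Qed.

Lemma closed_sumP F : closed_sum A D V F <-> L2_bundle A F /\ L2cl mu algebraic_sum F.
Proof.
split=> [[bF h]|[bF [hF h]]]; split=> //.
  split; first exact: bundle_L2.
  move=> e /h[J [G [VG FG]]].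
  have hS : L2 mu (fun z => \sum_(i <- J) G i z) by apply: algsum_L2; exists J, G.
  exists (fun z => \sum_(i <- J) G i z); first by exists J, G.
  by move: FG; rewrite L2norm_nrm ?lte_fin //; apply: L2B => //; exact: bundle_L2.
move=> e /h[_ [J [G [VG ->]]] FG]; exists J, G; split => //.
have hS : L2 mu (fun z => \sum_(i <- J) G i z) by apply: algsum_L2; exists J, G.
by rewrite L2norm_nrm ?lte_fin //; apply: L2B => //; exact: bundle_L2.
Qed.

Lemma closed_sum_sub i F : D i -> V i F -> closed_sum A D V F.
Proof.
move=> Di VF; have [VL _ _] := subV Di; apply/closed_sumP; split; first exact: VL.
apply: L2cl_sub; first exact: subspace_L2 VF.
exists [fset i]%fset, (fun=> F); split; first by move=> j /[1!inE] /eqP ->.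
by apply/funext => z; rewrite big_seq_fset1.
Qed.

Lemma closed_sum_subspace : bundle_subspace A (closed_sum A D V).
Proof.
split=> [F []||a F G] //.
- apply/closed_sumP; split; first exact: L2_bundle0.
  apply: L2cl_sub; first exact: L2_0.
  exists fset0, (fun=> fun=> 0); split => //.
  by apply/funext => z; rewrite big_seq_fset0.
- move=> /closed_sumP[bF cF] /closed_sumP[bG cG]; apply/closed_sumP.
  split; first exact: L2_bundle_lin.
  by apply: L2cl_lin => //; [exact: algsum_L2|exact: algebraic_sum_lin].
Qed.

(** A diagonal argument: an element approximated by limits of finite sums is itself
   approximated by finite sums. *)
Lemma closed_sum_closed F : L2_bundle A F ->
  (forall e : R, 0 < e -> exists2 G, closed_sum A D V G & L2dist mu F G < e) ->
  closed_sum A D V F.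
Proof.
move=> bF h; apply/closed_sumP; split=> //.
apply: L2cl_cl; [exact: algsum_L2|exact: bundle_L2|] => e /h[G /closed_sumP[_ cG] FG].
by exists G.
Qed.

(** If a finite sum of pairwise orthogonal functions vanishes, so does the sum of their
   squared norms, which are nonnegative. *)
Lemma direct_of_orthogonal :
  (forall i j F G, D i -> D j -> i != j -> V i F -> V j G -> ip mu F G = 0) ->
  direct_family A D V.
Proof.
move=> orth; split=> // J G VG sum0 i iJ.
have hG j : j \in J -> L2 mu (G j) by move=> /VG[Dj Vj]; exact: subspace_L2 Vj.
have hS : L2 mu (fun z => \sum_(i <- J) G i z) by exact: L2_sum_in.
have /(L2_ae_zero hS) S0 := sum0.
have := sqr_nrm mu (fun z => \sum_(i <- J) G i z).
rewrite S0 expr0n /= ip_sum_orthogonal ?fset_uniq //; last first.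
  move=> j k jJ kJ jk; have [Dj Vj] := VG _ jJ; have [Dk Vk] := VG _ kJ.
  exact: orth jk Vj Vk.
move=> /esym/eqP; rewrite psumr_eq0; last by move=> j _; exact: ip_ge0.
move=> /allP /(_ _ iJ) /= /eqP G0.
by apply/(L2_ae_zero (hG _ iJ)); rewrite /nrm G0 sqrtr0.
Qed.

End family.

Definition modes (P : set 'cV[int]_n.+1) : set (space -> R[i]) :=
  [set s | L2 mu s /\ exists f m, P m /\ s = mode f m].

(** Every space of the theorem is contained in such a closed span, which reduces their
   mutual orthogonality to the disjointness of sets of frequencies. *)
Definition mode_space P := L2cl mu (cspan (modes P)).

Lemma cspan_modes_L2 P : cspan (modes P) `<=` L2 mu.
Proof.
move=> f; elim=> [|a s g [hs _] _ IH]; first exact: L2_0.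
by apply: L2D => //; exact: L2Z.
Qed.

(** By induction over finite sums, from orthogonality of modes; the additivity of the real
   inner product suffices because a complex multiple of a mode is again a mode. *)
Lemma mode_space_orthogonal (P P' : set 'cV[int]_n.+1) F G : (forall m, P m -> ~ P' m) ->
  mode_space P F -> mode_space P' G -> ip mu F G = 0.
Proof.
move=> PP' hF hG.
have key s t : cspan (modes P) s -> cspan (modes P') t -> ip mu s t = 0.
  move=> Ss St; elim: St => [|b s' g' [hs' [f' [m' [Pm' s'E]]]] Sg' IH'].
    by rewrite ipC ip0l.
  have hg' := cspan_modes_L2 Sg'.
  rewrite ipDr //; [|exact: L2Z|exact: cspan_modes_L2 Ss].
  rewrite IH' addr0; elim: Ss => [|a s0 g [hs0 [f [m [Pm s0E]]]] Sg IH].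
    by rewrite ip0l.
  have hg := cspan_modes_L2 Sg.
  rewrite ipDl //; [|exact: L2Z..].
  rewrite IH addr0 s0E s'E.
  have E (c : R[i]) (k : R -> R[i]) l : (fun z : space => c * mode k l z) = mode (fun t => c * k t) l.
    by apply/funext => z; rewrite /mode mulrA.
  rewrite !E mode_orthogonal // -?E; first by apply: contraPneq Pm' => <-; exact: PP'.
    by rewrite -s0E; exact: L2Z.
  by rewrite -s'E; exact: L2Z.
apply: (ip_L2cl (@cspan_modes_L2 P') _ hG); first by case: hF.
move=> H SH; rewrite ipC; apply: (ip_L2cl (@cspan_modes_L2 P) _ hF).
  exact: cspan_modes_L2 SH.
by move=> K SK; rewrite ipC; exact: key.
Qed.

Lemma mode_space_lin P a F G : mode_space P F -> mode_space P G ->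
  mode_space P (fun z => a * F z + G z).
Proof.
apply: L2cl_lin; first exact: cspan_modes_L2.
by move=> *; exact: cspan_lin.
Qed.

Lemma mode_space_sum P (I : eqType) (s : seq I) (G : I -> space -> R[i]) :
  (forall i, i \in s -> mode_space P (G i)) -> mode_space P (fun z => \sum_(i <- s) G i z).
Proof.
elim: s => [|i s IH] h.
  under eq_fun do rewrite big_nil.
  by apply: L2cl_sub; [exact: L2_0|exact: cspan0].
have hs : mode_space P (fun z => \sum_(j <- s) G j z).
  by apply: IH => j js; apply: h; rewrite inE js orbT.
have := mode_space_lin 1 (h i (mem_head _ _)) hs.
by congr (mode_space P _); apply/funext => z; rewrite big_cons mul1r.
Qed.

Lemma mode_space_closed P F : L2 mu F ->
  (forall e : R, 0 < e -> exists2 G, mode_space P G & L2dist mu F G < e) -> mode_space P F.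
Proof. by move=> hF h; apply: L2cl_cl => //; exact: cspan_modes_L2. Qed.

Lemma mode_spaceS (P P' : set 'cV[int]_n.+1) : P `<=` P' -> mode_space P `<=` mode_space P'.
Proof.
move=> PP' F [hF cF]; split=> // e /cF[G SG FG]; exists G => //.
elim: SG => [|a s g [hs [f [m [Pm sE]]]] _ IH]; first exact: cspan0.
by apply: cspan_cons => //; split=> //; exists f, m; split=> //; exact: PP'.
Qed.

Lemma closed_sum_mode_space P (I : choiceType) (D : set I) (V : I -> set (space -> R[i])) :
  (forall i, D i -> bundle_subspace A (V i)) ->
  (forall i, D i -> V i `<=` mode_space P) -> closed_sum A D V `<=` mode_space P.
Proof.
move=> subV VP F /(closed_sumP subV)[bF [hF cF]]; apply: mode_space_closed => //.
move=> e /cF[_ [J [G [VG ->]]] FG]; eexists; last exact: FG.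
by apply: mode_space_sum => i /VG[Di]; exact: VP.
Qed.

End closed_sums.

(** * Infinite orbits *)

Section H_infinite.
Variables (R : realType) (n : nat) (A : 'M[int]_n.+1).
Hypothesis A_unit : A \in unitmx.
Local Notation space := (measurableTypeR R * 'cV[R]_n.+1)%type.
Local Notation mu := (bundle_measure R n.+1).
Local Notation lambda := (@lebesgue_measure R).
Local Notation act xi y := (A^T ^ xi *m y).
Implicit Types (f g : R -> R[i]) (y : 'cV[int]_n.+1).

Definition series_term y f (xi : int) (z : space) : R[i] :=
  f ((z.1 : R) + xi%:~R) * expi2pi (phase A y xi z.2).

(** This is where the frequency moves along the orbit. *)
Lemma series_termE y f xi : series_term y f xi = mode (fun t => f (t + xi%:~R)) (act xi y).
Proof. by apply/funext => z; rewrite /series_term /mode phaseE. Qed.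

Lemma cdot_term y f xi z : cdot (series_term y f xi z) (series_term y f xi z) =
  cdot (f ((z.1 : R) + xi%:~R)) (f ((z.1 : R) + xi%:~R)).
Proof. by rewrite series_termE cdot_mode. Qed.

Lemma measC_term y f xi : L2 lambda f -> measC (series_term y f xi).
Proof.
move=> /L2_meas[mR mI]; rewrite series_termE; apply: measC_mode.
- exact: (measurableT_comp mR (measurable_shiftR xi%:~R)).
- exact: (measurableT_comp mI (measurable_shiftR xi%:~R)).
Qed.

Lemma measurable_sqnorm f : L2 lambda f ->
  measurable_fun [set: measurableTypeR R] (fun t => cdot (f t) (f t)).
Proof. by move=> /L2_meas mf; exact: measurable_cdot. Qed.

Lemma integral_term y f xi : L2 lambda f ->
  (\int[mu]_z (cdot (series_term y f xi z) (series_term y f xi z))%:E =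
   \int[@unit_mu R]_t (cdot (f ((t : R) + xi%:~R)) (f ((t : R) + xi%:~R)))%:E *
   @cube_mu R n.+1 setT)%E.
Proof.
move=> hf; under eq_integral => z _ do rewrite cdot_term.
rewrite (@integral_bundle_fst _ _ (fun t => cdot (f ((t : R) + xi%:~R)) (f ((t : R) + xi%:~R)))) //.
  exact: (measurableT_comp (measurable_sqnorm hf) (measurable_shiftR xi%:~R)).
by move=> t; exact: cdot_ge0.
Qed.

Lemma integral_sqnorm_lty f : L2 lambda f -> (\int[lambda]_t (cdot (f t) (f t))%:E < +oo)%E.
Proof.
by move=> hf; have := integrable_lty measurableT (L2_integrable hf hf).
Qed.

Lemma cube_mass_fin : @cube_mu R n.+1 setT \is a fin_num.
Proof. by rewrite ge0_fin_numE // cube_mu_fin. Qed.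

(** The squared norm of the term of index xi is the integral of |f|^2 over a unit interval
   starting at xi, times the mass of the cube. *)
Lemma sum_integral_term y f (J : {fset int}) : L2 lambda f ->
  (\sum_(xi <- J) \int[mu]_z (cdot (series_term y f xi z) (series_term y f xi z))%:E <=
   \int[lambda]_t (cdot (f t) (f t))%:E * @cube_mu R n.+1 setT)%E.
Proof.
move=> hf; under eq_bigr => xi _ do rewrite integral_term //.
rewrite -ge0_sume_distrl; last first.
  by move=> xi _; apply: integral_ge0 => t _; rewrite lee_fin cdot_ge0.
apply: lee_wpmul2r => //.
apply: (@sum_integral_unit_shift _ (fun t => cdot (f t) (f t))).
- exact: measurable_sqnorm.
- by move=> t; exact: cdot_ge0.
Qed.

Lemma total_mass_lty f : L2 lambda f ->
  (\int[lambda]_t (cdot (f t) (f t))%:E * @cube_mu R n.+1 setT < +oo)%E.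
Proof.
move=> hf; have h0 : (0 <= \int[lambda]_t (cdot (f t) (f t))%:E)%E.
  by apply: integral_ge0 => t _; rewrite lee_fin cdot_ge0.
rewrite lte_mul_pinfty ?cube_mu_fin //.
by rewrite ge0_fin_numE // integral_sqnorm_lty.
Qed.

Lemma term_L2 y f xi : L2 lambda f -> L2 mu (series_term y f xi).
Proof.
move=> hf; apply/L2P; split; first exact: measC_term.
apply/integrableP; split.
  by apply/measurable_EFinP; apply: measurable_cdot; exact: measC_term.
under eq_integral => z _ do rewrite /= ger0_norm ?cdot_ge0 //.
apply: le_lt_trans (total_mass_lty hf).
by have := sum_integral_term y [fset xi]%fset hf; rewrite big_seq_fset1.
Qed.

Lemma partial_sum_term y f (J : {fset int}) z :
  partial_sum (fun xi => f ((z.1 : R) + xi%:~R) * expi2pi (phase A y xi z.2)) J =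
  \sum_(xi <- J) series_term y f xi z.
Proof. by rewrite /partial_sum big_seq_fsetE. Qed.

(** Convergence of the norms in the extended reals along the directed set of finite
   sets, restated with real distances. *)
Lemma series_sumP y f F : L2 lambda f -> is_series_sum A y f F <-> L2_bundle A F /\
  forall e : R, 0 < e -> exists J0 : {fset int}, forall J : {fset int}, (J0 `<=` J)%fset ->
    L2dist mu F (fun z => \sum_(xi <- J) series_term y f xi z) < e.
Proof.
move=> hf; have E : L2_bundle A F -> (fun J : {fset int} =>
    L2norm mu (fun z => F z - partial_sum
      (fun xi => f ((z.1 : R) + xi%:~R) * expi2pi (phase A y xi z.2)) J)) =
    (fun J => (L2dist mu F (fun z => \sum_(xi <- J) series_term y f xi z))%:E).
  move=> bF; apply/funext => J; under eq_fun do rewrite partial_sum_term.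
  by rewrite L2norm_nrm //; apply: L2B; [exact: bundle_L2 bF|apply: L2_sum => xi; exact: term_L2].
have totallyF : Filter (@totally int) by have [_ h] := @totally_filter int; exact: h.
split=> [[bF cF]|[bF cF]]; split=> //.
  move=> e e0; move: cF; rewrite (E bF).
  move=> /fine_cvg /cvgrPdist_lt /(_ _ e0) [J0 _ hJ0]; exists J0 => J JJ.
  by have := hJ0 J JJ; rewrite /= sub0r normrN ger0_norm ?L2dist_ge0.
rewrite (E bF); apply: cvg_EFin; first exact: nearW.
apply/cvgrPdist_lt => e /cF[J0 hJ0]; exists J0 => // J JJ /=.
by rewrite sub0r normrN ger0_norm ?L2dist_ge0 //; exact: hJ0.
Qed.

(** H_y is a space of limits of finite sums of terms, and each term is a mode. *)
Lemma H_infinite_mode_space y : @H_infinite R n A y `<=` mode_space (lattice_orbit A y).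
Proof.
move=> F [f hf /(series_sumP y F hf)[bF cF]].
apply: mode_space_closed; first exact: bundle_L2 bF.
move=> e /cF[J0 /(_ J0 (fsubset_refl _)) FJ]; eexists; last exact: FJ.
apply: mode_space_sum => xi _; apply: L2cl_sub; first exact: term_L2.
apply: cspan_sub; split; first exact: term_L2.
by exists (fun t => f (t + xi%:~R)), (act xi y); split; [exists xi|exact: series_termE].
Qed.

Lemma H_infinite_subspace y : bundle_subspace A (@H_infinite R n A y).
Proof.
split=> [F [f _ []] //||a F G [f hf /(series_sumP y F hf)[bF cF]] [g hg /(series_sumP y G hg)[bG cG]]].
- exists (fun=> 0); first exact: L2_0.
  apply/series_sumP; first exact: L2_0.
  split; first exact: L2_bundle0.
  move=> e e0; exists fset0 => J _.
  rewrite (_ : (fun z => \sum_(xi <- J) _) = fun=> 0) ?L2distxx //.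
  by apply/funext => z; rewrite big1 // => xi _; rewrite /series_term mul0r.
- have hfg : L2 lambda (fun t => a * f t + g t) by apply: L2D => //; exact: L2Z.
  exists (fun t => a * f t + g t) => //; apply/series_sumP => //.
  split; first exact: L2_bundle_lin.
  move=> e e0; pose c := Num.sqrt (cdot a a) + 1.
  have c0 : 0 < c by rewrite ltr_wpDl // sqrtr_ge0.
  have [J1 h1] := cF _ (divr_gt0 (divr_gt0 e0 (ltr0n R 2)) c0).
  have [J2 h2] := cG _ (divr_gt0 e0 (ltr0n R 2)).
  exists (J1 `|` J2)%fset => J; rewrite fsubUset => /andP[/h1 {}h1 /h2 {}h2].
  have hS k (hk : L2 lambda k) : L2 mu (fun z => \sum_(xi <- J) series_term y k xi z).
    by apply: L2_sum => xi; exact: term_L2.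
  rewrite (_ : (fun z => \sum_(xi <- J) _) = (fun z => a * (\sum_(xi <- J) series_term y f xi z) +
      \sum_(xi <- J) series_term y g xi z)); last first.
    apply/funext => z; rewrite mulr_sumr -big_split; apply: eq_bigr => xi _.
    by rewrite /series_term mulrDl mulrA.
  apply: le_lt_trans (L2dist_lin a (bundle_L2 bF) (bundle_L2 bG) (hS f hf) (hS g hg)) _.
  rewrite (splitr e); apply: ler_ltD => //.
  apply: (@le_trans _ _ (c * (e / 2 / c))); last by rewrite mulrC divfK ?gt_eqF.
  by rewrite ler_pM ?sqrtr_ge0 ?L2dist_ge0 // ?lerDl // ltW.
Qed.

(** In an infinite orbit the frequencies are pairwise distinct, so the terms are
   orthogonal; [periodize] turns the limit into a function on M. *)
Lemma series_sum_exists y f : infinite_set (lattice_orbit A y) -> L2 lambda f ->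
  exists F, is_series_sum A y f F.
Proof.
move=> inf hf; have inj := infinite_orbit_inj A_unit inf.
have ipE xi : ip mu (series_term y f xi) (series_term y f xi) =
    fine (\int[mu]_z (cdot (series_term y f xi z) (series_term y f xi z))%:E)%E by [].
have [|J|F0 hF0 cF0] := @orthogonal_series_cvg _ _ _ mu (bundle_measure_fin R n.+1) int
  (series_term y f) (fine (\int[lambda]_t (cdot (f t) (f t))%:E * @cube_mu R n.+1 setT))
  (fun xi => term_L2 y xi hf).
- move=> xi zeta ne; have h1 := term_L2 y xi hf; have h2 := term_L2 y zeta hf.
  rewrite !series_termE in h1 h2 *; apply: mode_orthogonal => //.
  by apply: contra_neq ne; exact: inj.
- rewrite -lee_fin fineK; last first.
    rewrite ge0_fin_numE ?total_mass_lty // mule_ge0 //.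
    by apply: integral_ge0 => t _; rewrite lee_fin cdot_ge0.
  apply: le_trans (sum_integral_term y J hf).
  rewrite -sumEFin; apply: lee_sum => xi _; rewrite ipE fineK //.
  exact: (integrable_fin_num measurableT (L2_integrable (term_L2 y xi hf) (term_L2 y xi hf))).
have [F bF FF0] := periodize A_unit hF0.
exists F; apply/series_sumP => //; split=> // e /cF0[J0 hJ0]; exists J0 => J JJ.
have hS : L2 mu (fun z => \sum_(xi <- J) series_term y f xi z).
  by apply: L2_sum => xi; exact: term_L2.
apply: le_lt_trans (L2dist_triangle (bundle_L2 bF) hF0 hS) _.
by rewrite (ae_eq_L2dist (bundle_L2 bF) hF0 FF0) add0r; exact: hJ0.
Qed.

End H_infinite.

(** * Finite orbits *)

Section H_finite.
Variables (R : realType) (n : nat) (A : 'M[int]_n.+1) (y : 'cV[int]_n.+1).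
Hypothesis A_unit : A \in unitmx.
Hypothesis fin_orbit : finite_set (lattice_orbit A y).
Local Notation space := (measurableTypeR R * 'cV[R]_n.+1)%type.
Local Notation mu := (bundle_measure R n.+1).
Local Notation act xi y := (A^T ^ xi *m y).
Local Notation N := (orbit_size A y).
Implicit Types (phi psi : R -> R[i]).

(** The series of H_y wrapped around a finite orbit; phi plays the role of an N-periodic
   function on the line. *)
Definition cyclic_sum phi (z : space) : R[i] := \sum_(xi < N) series_term A y phi (xi : nat)%:Z z.

(** The Fourier basis of N-periodic functions. *)
Definition char_N (t0 : int) (s : R) : R[i] := expi2pi (t0%:~R * s / N%:R).

Let N_gt0 : (0 < N)%N. Proof. by have [] := finite_orbitP A_unit fin_orbit. Qed.

Let N_neq0 : N%:R != 0 :> R. Proof. by rewrite pnatr_eq0 -lt0n. Qed.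

(** The exponential in t is distributed over the sum, which makes H_{t0, y} the space of
   cyclic sums of multiples of one element of the Fourier basis. *)
Lemma H_finiteE t0 : @H_finite R n A y t0 = range (fun C => cyclic_sum (fun s => C * char_N t0 s)).
Proof.
have key C (z : space) : cyclic_sum (fun s => C * char_N t0 s) z =
    C * expi2pi (t0%:~R * (z.1 : R) / N%:R) *
    \sum_(xi < N) expi2pi (t0%:~R * xi%:R / N%:R + phase A y (xi : nat)%:Z z.2).
  rewrite /cyclic_sum mulr_sumr; apply: eq_bigr => xi _.
  rewrite /series_term /char_N mulrDr mulrDl !expi2piD !mulrA.
  by [].
by apply/seteqP; split => _ [C _ <-]; exists C => //; apply/funext => z; rewrite key.
Qed.

Lemma char_N_periodic t0 s : char_N t0 (s + N%:R) = char_N t0 s.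
Proof.
by rewrite /char_N mulrDr mulrDl expi2piD mulfK // expi2pi_int mulr1.
Qed.

Lemma measC_char_N t0 : measC (char_N t0 : measurableTypeR R -> _).
Proof.
apply: measC_expi2pi; apply: measurable_funM; last exact: measurable_cst.
by apply: measurable_funM; [exact: measurable_cst|exact: measurable_id].
Qed.

Lemma cyclic_term_L2 phi (M : R) xi : measC (phi : measurableTypeR R -> _) ->
  (forall s, cdot (phi s) (phi s) <= M) -> L2 mu (series_term A y phi xi).
Proof.
move=> [mR mI] hM; apply: (@L2_bounded _ _ _ _ (bundle_measure_fin R n.+1) _ M).
  rewrite series_termE; apply: measC_mode.
  - exact: (measurableT_comp mR (measurable_shiftR xi%:~R)).
  - exact: (measurableT_comp mI (measurable_shiftR xi%:~R)).
by move=> z; rewrite cdot_term.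
Qed.

(** The gluing shifts the summation index by an integer, and the summand is N-periodic
   in this index. *)
Lemma cyclic_sum_bundle phi : (forall s, phi (s + N%:R) = phi s) ->
  bundle_function A (cyclic_sum phi).
Proof.
move=> per t x; split=> [eta|zeta].
  apply: eq_bigr => xi _; rewrite /series_term /= !phaseE; congr (_ * _).
  by rewrite expi2pi_mdot_periodic.
have [_ yN _] := finite_orbitP A_unit fin_orbit.
pose g (k : int) := series_term A y phi k (t, x).
have gN k : g (k + N%:Z) = g k.
  rewrite /g /series_term /= intrD addrA per; congr (_ * expi2pi _).
  by rewrite !phaseE (actD A_unit) yN.
have step k : \sum_(xi < N) g ((xi : nat)%:Z + (k + 1)) = \sum_(xi < N) g ((xi : nat)%:Z + k).
  rewrite -!(big_mkord xpredT (fun i => g (i%:Z + _))).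
  rewrite -[in RHS](prednK N_gt0) big_nat_recl // -[in LHS](prednK N_gt0) big_nat_recr //= addrC.
  congr (_ + _); first by rewrite add0r -[RHS]gN; congr g;
    rewrite -[in RHS](prednK N_gt0) -addn1 PoszD; ring.
  by apply: eq_bigr => i _; congr g; rewrite -addn1 PoszD; ring.
have all k : \sum_(xi < N) g ((xi : nat)%:Z + k) = \sum_(xi < N) g (xi : nat)%:Z.
  have base : \sum_(xi < N) g ((xi : nat)%:Z + 0) = \sum_(xi < N) g (xi : nat)%:Z.
    by apply: eq_bigr => i _; rewrite addr0.
  elim/int_ind: k => [|k IH|k IH]; first exact: base.
    by rewrite -addn1 PoszD step.
  by rewrite -IH -step; apply: eq_bigr => i _; congr g; rewrite -addn1 PoszD; ring.
rewrite /cyclic_sum -(all zeta); apply: eq_bigr => xi _.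
rewrite /g /series_term /= phase_shift //; congr (phi _ * _).
by rewrite intrD addrA addrAC.
Qed.

Lemma char_N_bound C t0 s : cdot (C * char_N t0 s) (C * char_N t0 s) <= cdot C C.
Proof. by rewrite cdotMM cdot_expi2pi mulr1. Qed.

Lemma measC_Cchar C t0 : measC (fun s : measurableTypeR R => C * char_N t0 s).
Proof. by apply: measCM; [exact: measC_cst|exact: measC_char_N]. Qed.

Lemma H_finite_subspace t0 : bundle_subspace A (@H_finite R n A y t0).
Proof.
rewrite H_finiteE; split.
- move=> _ [C _ <-]; split.
    by apply: cyclic_sum_bundle => s; rewrite char_N_periodic.
  apply: L2_sum => xi; apply: (cyclic_term_L2 _ (measC_Cchar C t0)).
  exact: char_N_bound.
- exists 0 => //; apply/funext => z; rewrite /cyclic_sum big1 // => xi _.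
  by rewrite /series_term !mul0r.
- move=> a _ _ [C _ <-] [C' _ <-]; exists (a * C + C') => //; apply/funext => z.
  rewrite /cyclic_sum mulr_sumr -big_split; apply: eq_bigr => xi _.
  by rewrite /series_term !mulrDl !mulrA.
Qed.

Lemma H_finite_mode_space t0 : @H_finite R n A y t0 `<=` mode_space (lattice_orbit A y).
Proof.
rewrite H_finiteE => _ [C _ <-]; apply: mode_space_sum => xi _.
have h := cyclic_term_L2 (xi : nat)%:Z (measC_Cchar C t0) (char_N_bound C t0).
apply: L2cl_sub => //; apply: cspan_sub; split=> //.
by exists (fun t => C * char_N t0 (t + (xi : nat)%:Z%:~R)), (act (xi : nat)%:Z y);
  split; [exists (xi : nat)%:Z|exact: series_termE].
Qed.

(** G is the primitive of the integrand, read at the integers. *)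
Lemma ip_term_char C C' (t0 t1 : int) (i : nat) (k := (t0 - t1)%:~R / N%:R : R)
    (G := fun j : nat => fine (@cube_mu R n.+1 setT) / (2 * pi * k) *
      (cdot C C' * sin (2 * pi * k * j%:R) + cross C C' * sin (2 * pi * k * j%:R + pi / 2))) :
  t0 != t1 ->
  ip mu (series_term A y (fun s => C * char_N t0 s) i%:Z)
      (series_term A y (fun s => C' * char_N t1 s) i%:Z) =
  G i.+1 - G i.
Proof.
move=> t01; have k0 : k != 0 by rewrite mulf_neq0 ?invr_eq0 // intr_eq0 subr_eq0.
rewrite /ip /Rintegral.
transitivity (fine (\int[mu]_z (cdot C C' * cos (2 * pi * (k * (z.1 : R)) + 2 * pi * k * i%:R) +
    cross C C' * cos (2 * pi * (k * (z.1 : R)) + (2 * pi * k * i%:R + pi / 2)))%:E)%E).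
  congr fine; apply: eq_integral => z _; congr EFin.
  rewrite cdot_expi2piM subrr expi2pi0 mulr1 cdot_expi2piM cdot_rot.
  have -> : t0%:~R * (z.1 + i%:~R) / N%:R - t1%:~R * (z.1 + i%:~R) / N%:R =
      k * (z.1 : R) + k * i%:R :> R.
    by rewrite /k -mulrBl -mulrBl rmorphB /=; ring.
  by congr (_ * cos _ + _ * cos _); ring.
have ma th : measurable_fun setT (fun z : space => 2 * pi * (k * (z.1 : R)) + th).
  exact: (measurableT_comp (measurable_affine k th) measurable_fst).
rewrite integral_lin_cos //; last exact: bundle_measure_fin.
rewrite !integral_bundle_fst_cos !integral_unit_cos //.
rewrite -(fineK (cube_mass_fin R n)) -!EFinM -EFinD /= /G.
have e : 2 * pi * k + 2 * pi * k * i%:R = 2 * pi * k * i.+1%:R by rewrite -natr1; ring.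
rewrite !addrA e; set c := fine _; set w := 2 * pi * k.
by ring.
Qed.

(** Only equal frequencies contribute; their contributions telescope to the difference of
   a primitive at the two ends of a period. *)
Lemma H_finite_orthogonal t0 t1 F G : t0 != t1 ->
  @H_finite R n A y t0 F -> @H_finite R n A y t1 G -> ip mu F G = 0.
Proof.
move=> t01; rewrite !H_finiteE => -[C _ <-] [C' _ <-].
have hL C0 t2 xi := cyclic_term_L2 xi (measC_Cchar C0 t2) (char_N_bound C0 t2).
have [_ _ inj] := finite_orbitP A_unit fin_orbit.
have hS C0 t2 : L2 mu (fun z => \sum_(xi < N) series_term A y (fun s => C0 * char_N t2 s) (xi : nat)%:Z z).
  by apply: L2_sum => xi; exact: hL.
rewrite /cyclic_sum ip_suml; [|by move=> xi _; exact: hL|exact: hS].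
have diag (xi : 'I_N) : ip mu (series_term A y (fun s => C * char_N t0 s) (xi : nat)%:Z)
    (fun z => \sum_(zeta < N) series_term A y (fun s => C' * char_N t1 s) (zeta : nat)%:Z z) =
    ip mu (series_term A y (fun s => C * char_N t0 s) (xi : nat)%:Z)
          (series_term A y (fun s => C' * char_N t1 s) (xi : nat)%:Z).
  rewrite ip_sumr; [|by move=> zeta _; exact: hL|exact: hL].
  rewrite (bigD1 xi) //= big1 ?addr0 // => zeta ne.
  have h1 := hL C t0 (xi : nat)%:Z; have h2 := hL C' t1 (zeta : nat)%:Z.
  rewrite !series_termE in h1 h2 *; apply: mode_orthogonal => //.
  by apply: contra_neq ne => e; apply/val_inj; exact: inj (ltn_ord _) (ltn_ord _) (esym e).
pose k : R := (t0 - t1)%:~R / N%:R.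
pose D (j : nat) := fine (@cube_mu R n.+1 setT) / (2 * pi * k) *
  (cdot C C' * sin (2 * pi * k * j%:R) + cross C C' * sin (2 * pi * k * j%:R + pi / 2)).
transitivity (\sum_(0 <= j < N) (D j.+1 - D j)).
  by rewrite big_mkord; apply: eq_bigr => xi _; rewrite diag ip_term_char.
rewrite telescope_sumr //.
have kN th : sin (2 * pi * k * N%:R + th) = sin (2 * pi * k * 0%:R + th).
  rewrite -mulrA /k divfK // mulr0 add0r sinD.
  have := expi2pi_int R (t0 - t1); rewrite /expi2pi => -[-> ->].
  by rewrite mul0r mul1r add0r.
have kN0 : sin (2 * pi * k * N%:R) = sin (2 * pi * k * 0%:R).
  by have := kN 0; rewrite !addr0.
by rewrite /D kN kN0 subrr.
Qed.

End H_finite.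

(** * Density of the characters *)

Section arcs.
Variable R : realType.

(** Since cos (2 pi c - pi a) - cos (pi a) = 2 sin (pi c) sin (pi (a - c)), the arc
   ]0, a[ of the circle is a superlevel set of a trigonometric polynomial. *)
Lemma arc_superlevel (c a : R) : 0 < c < 1 -> 0 < a <= 1 ->
  (0 < cos (2 * pi * (c - a / 2)) - cos (pi * a)) = (c < a).
Proof.
move=> /andP[c0 c1] /andP[a0 a1]; have p0 := pi_gt0 R.
pose u := pi * c; pose v := pi * (a - c).
have -> : 2 * pi * (c - a / 2) = u - v by rewrite /u /v; field.
have -> : pi * a = u + v by rewrite /u /v; ring.
rewrite cosB cosD opprD opprK addrACA subrr add0r -mulr2n.
have su : 0 < sin u by apply: sin_gt0_pi; rewrite /u mulr_gt0 //= gtr_pMr.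
rewrite pmulrn_lgt0 // pmulr_rgt0 //.
have [ca|ac] := ltP c a.
  apply: sin_gt0_pi; rewrite /v mulr_gt0 ?subr_gt0 //= gtr_pMr //.
  by move: p0 => _; lra.
apply/negbTE; rewrite -leNgt.
have [ca|ne] := eqVneq c a; first by rewrite /v ca subrr mulr0 sin0.
have ac' : a < c by rewrite lt_def ne.
rewrite -oppr_ge0 -sinN ltW //; apply: sin_gt0_pi.
rewrite /v -mulrN opprB mulr_gt0 ?subr_gt0 //= gtr_pMr //.
by move: p0 => _; lra.
Qed.

End arcs.

Section character_density.
Variables (R : realType) (n : nat).
Local Notation space := (measurableTypeR R * 'cV[R]_n)%type.
Local Notation mu := (bundle_measure R n).

Definition character (k : int) (m : 'cV[int]_n) (z : space) : R[i] :=
  expi2pi (k%:~R * (z.1 : R) + mdot m z.2).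

Definition characters : set (space -> R[i]) :=
  [set s | exists k m, s = character k m].

Lemma characters1 : characters (fun=> 1).
Proof.
exists 0, 0; apply/funext => z; rewrite /character mul0r add0r mdotE big1 ?expi2pi0 //.
by move=> i _; rewrite mxE mul0r.
Qed.

Lemma charactersM f g : characters f -> characters g -> characters (fun z => f z * g z).
Proof.
move=> [k [m ->]] [k' [m' ->]]; exists (k + k'), (m + m'); apply/funext => z.
rewrite /character -expi2piD intrD mulrDl addrACA; congr (expi2pi (_ + _)).
by rewrite !mdotE -big_split; apply: eq_bigr => i _; rewrite mxE intrD mulrDl.
Qed.

Lemma characterE k m (z : space) :
  character k m z = expi2pi (k%:~R * (z.1 : R)) * expi2pi (mdot m z.2).
Proof. exact: expi2piD. Qed.

Lemma measurable_z1 : measurable_fun [set: space] (fun z => (z.1 : measurableTypeR R)).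
Proof. exact: measurable_fst. Qed.

Lemma measurable_z2 i : measurable_fun [set: space] (fun z => (z.2 i 0 : measurableTypeR R)).
Proof. exact: (measurableT_comp (measurable_coord i) measurable_snd). Qed.

Lemma measC_character k m : measC (character k m).
Proof.
apply: measC_expi2pi; apply: measurable_funD.
  by apply: measurable_funM; [exact: measurable_cst|exact: measurable_fst].
exact: (measurableT_comp (measurable_mdot m) measurable_snd).
Qed.

Lemma character_L2 k m : L2 mu (character k m).
Proof.
apply: (@L2_bounded _ _ _ _ (bundle_measure_fin R n) _ 1); first exact: measC_character.
by move=> z; rewrite cdot_expi2pi.
Qed.

Definition halfspaces : set (set space) :=
  [set E | (exists a : R, E = [set z : space | (z.1 : R) < a]) \/
           (exists i, exists a : R, E = [set z : space | z.2 i 0 < a])].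

Lemma measurable_lt (c : space -> R) (a : R) :
  measurable_fun [set: space] (fun z => c z : measurableTypeR R) ->
  measurable [set z | c z < a].
Proof.
move=> mc; rewrite (_ : [set z | _] = setT `&` c @^-1` `]-oo, a[%classic).
  by apply: mc => //; exact: measurable_itv.
by rewrite setTI; apply/seteqP; split => z; rewrite /= in_itv.
Qed.

(** The identity is measurable from the sigma-algebra generated by the half-spaces to the
   product one, as all its coordinates are. *)
Lemma measurable_halfspaces : @measurable _ space = <<s halfspaces >>.
Proof.
apply/seteqP; split; last first.
  apply: smallest_sub; first exact: sigma_algebra_measurable.
  move=> _ [[a ->]|[i [a ->]]]; apply: measurable_lt; [exact: measurable_z1|exact: measurable_z2].
pose T' := g_sigma_algebraType halfspaces.
have mlt (c : space -> R) : (forall a : R, halfspaces [set z | c z < a]) ->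
    measurable_fun [set: T'] (fun z : T' => c z : measurableTypeR R).
  move=> hc; apply: (measurability _ (RGenInftyO.measurableE R)) => //.
  move=> /= _ [_ [a ->] <-].
  rewrite (_ : _ `&` _ = [set z | c z < a]); first exact: sub_sigma_algebra.
  by rewrite setTI; apply/seteqP; split => z; rewrite /= in_itv.
have mid : measurable_fun [set: T'] (fun z : T' => (z.1, z.2) : space).
  apply: measurable_fun_pair.
    by apply: (mlt (fun z => z.1)) => a; left; exists a.
  apply: measurable_fun_coordP => i.
  by apply: (mlt (fun z => z.2 i 0)) => a; right; exists i, a.
move=> E mE; have := mid measurableT E mE; rewrite setTI.
by rewrite (_ : _ @^-1` E = E) //; apply/seteqP; split => -[].
Qed.

(** Inside the open box a half-space is an arc, up to the degenerate cases where it
   is empty or everything. *)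
Lemma coordinate_approx (c : space -> R) (a : R) :
  measurable_fun [set: space] (fun z => c z : measurableTypeR R) ->
  characters (fun z => expi2pi (c z)) -> characters (fun z => expi2pi (- c z)) ->
  (forall z, open_box z -> 0 < c z < 1) ->
  approx_set characters (@open_box R n) [set z | c z < a].
Proof.
move=> mc Sc ScN c01; split; first exact: measurable_lt.
have cst (b : R) : 0 <= b <= 1 -> (forall z, open_box z -> ((c z < a)%R%:R : R) = b) ->
    exists p : nat -> space -> R, [/\ forall k, cspan characters (fun z => (p k z)%:C%C),
      forall k z, 0 <= p k z <= 1 &
      forall z, open_box z -> p k z @[k --> \oo] --> (\1_[set z | c z < a] z : R)].
  move=> b01 hb; exists (fun _ _ => b); split=> [k|//|z /hb]; first exact: cspan_cst characters1 _.
  by rewrite indicE mem_setE => ->; exact: cvg_cst.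
have [a0|a0] := leP a 0.
  apply: (cst 0) => [|z /c01 /andP[c0 _]]; first by rewrite lexx ler01.
  by rewrite ltNge (le_trans a0 (ltW c0)).
have [a1|a1] := leP 1 a.
  apply: (cst 1) => [|z /c01 /andP[_ c1]]; first by rewrite lexx ler01.
  by rewrite (lt_le_trans c1 a1).
pose f z := cos (2 * pi * (c z - a / 2)) - cos (pi * a).
have Sf : cspan characters (fun z => (f z)%:C%C).
  have h1 := cspanZ (2^-1 * expi2pi (- (a / 2))) (cspan_sub Sc).
  have h2 := cspanZ (2^-1 * expi2pi (a / 2)) (cspan_sub ScN).
  have := cspan_lin (-1) (cspan_cst characters1 (cos (pi * a))%:C%C) (cspanD h1 h2).
  congr cspan; apply/funext => z; rewrite /f rmorphB /= cos_expi2pi mulN1r addrC.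
  by rewrite opprB ![expi2pi (_ - _)]expi2piD; congr (_ - _); ring.
have fM z : `|f z| <= 2.
  by rewrite (le_trans (ler_normB _ _)) // (_ : 2 = 1 + 1) // lerD // norm_cos_le1.
have [p [Sp p01 pf]] := cspan_superlevel characters1 charactersM Sf fM.
exists p; split=> // z /c01 cz; have := pf z.
by rewrite indicE mem_setE /f arc_superlevel // a0 ltW.
Qed.

Lemma mdot_delta (i : 'I_n) (k : int) (x : 'cV[R]_n) :
  mdot (k *: delta_mx i 0 : 'cV[int]_n) x = k%:~R * x i 0.
Proof.
rewrite mdotE (bigD1 i) //= !mxE !eqxx mulr1 big1 ?addr0 // => j ji.
by rewrite !mxE (negbTE ji) mulr0 mul0r.
Qed.

(** Half-spaces generate the sigma-algebra and are approximable inside the open box,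
   whose complement is null. *)
Lemma characters_dense F : L2 mu F -> L2cl mu (cspan characters) F.
Proof.
apply: (cspan_dense (bundle_measure_fin R n) characters1 charactersM _ _ (ae_open_box R n) measurable_halfspaces).
- by move=> _ [k [m ->]]; exact: measC_character.
- by move=> _ [k [m ->]] z; rewrite cdot_expi2pi.
- move=> _ [[a ->]|[i [a ->]]].
    apply: coordinate_approx; [exact: measurable_z1| | |by move=> z []].
      by exists 1, 0; apply/funext => z; rewrite /character mul1r mdotE big1 ?addr0 // => i _;
        rewrite mxE mul0r.
    by exists (-1), 0; apply/funext => z; rewrite /character mulN1r mdotE big1 ?addr0 // => i _;
      rewrite mxE mul0r.
  apply: coordinate_approx; [exact: measurable_z2| | |by move=> z []].
    by exists 0, (1 *: delta_mx i 0); apply/funext => z;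
      rewrite /character mul0r add0r mdot_delta mul1r.
  by exists 0, (-1 *: delta_mx i 0); apply/funext => z;
    rewrite /character mul0r add0r mdot_delta mulN1r.
Qed.

End character_density.

(** * The two orthogonal summands *)

Section sum_of_orthogonal_subspaces.
Variables (R : realType) (n : nat) (A : 'M[int]_n.+1).
Hypothesis A_unit : A \in unitmx.
Local Notation space := (measurableTypeR R * 'cV[R]_n.+1)%type.
Local Notation mu := (bundle_measure R n.+1).
Variables E E' : set (space -> R[i]).
Hypotheses (subE : bundle_subspace A E) (subE' : bundle_subspace A E').
Hypothesis closedE : forall F, L2_bundle A F ->
  (forall e : R, 0 < e -> exists2 G, E G & L2dist mu F G < e) -> E F.
Hypothesis closedE' : forall F, L2_bundle A F ->
  (forall e : R, 0 < e -> exists2 G, E' G & L2dist mu F G < e) -> E' F.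
Hypothesis orthEE' : forall F G, E F -> E' G -> ip mu F G = 0.

Definition orthogonal_sum : set (space -> R[i]) :=
  [set F | exists P Q, [/\ E P, E' Q & F = (fun z => P z + Q z)]].

Lemma orthogonal_sum_bundle F : orthogonal_sum F -> L2_bundle A F.
Proof.
have [EL _ _] := subE; have [EL' _ _] := subE'.
move=> [P [Q [/EL bP /EL' bQ ->]]]; have := L2_bundle_lin 1 bP bQ.
by under eq_fun do rewrite mul1r.
Qed.

Lemma orthogonal_sum_lin a F G : orthogonal_sum F -> orthogonal_sum G ->
  orthogonal_sum (fun z => a * F z + G z).
Proof.
have [_ _ El] := subE; have [_ _ El'] := subE'.
move=> [P [Q [EP EQ ->]]] [P' [Q' [EP' EQ' ->]]].
exists (fun z => a * P z + P' z), (fun z => a * Q z + Q' z).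
by split; [exact: El|exact: El'|apply/funext => z; rewrite mulrDr addrACA].
Qed.

Lemma orthogonal_sum_subl F : E F -> orthogonal_sum F.
Proof.
have [_ E0 _] := subE'; move=> EF; exists F, (fun=> 0); split=> //.
by apply/funext => z; rewrite addr0.
Qed.

Lemma orthogonal_sum_subr F : E' F -> orthogonal_sum F.
Proof.
have [_ E0 _] := subE; move=> EF; exists (fun=> 0), F; split=> //.
by apply/funext => z; rewrite add0r.
Qed.

(** By Pythagoras, a Cauchy sequence in the sum has Cauchy components. The first component
   is constructed as a limit; the second one is then what remains. *)
Lemma orthogonal_sum_closed F : L2_bundle A F ->
  (forall e : R, 0 < e -> exists2 G, orthogonal_sum G & L2dist mu F G < e) -> orthogonal_sum F.
Proof.
move=> bF h; have hF := bundle_L2 bF.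
have [EL _ El] := subE; have [EL' _ El'] := subE'.
pose eps k : R := 2 ^- k / 4.
have eps0 k : 0 < eps k by rewrite divr_gt0 // invr_gt0 exprn_gt0.
have hk k : exists PQ : (space -> R[i]) * (space -> R[i]),
    [/\ E PQ.1, E' PQ.2 & L2dist mu F (fun z => PQ.1 z + PQ.2 z) < eps k].
  by have [_ [P [Q [EP EQ ->]]] FG] := h _ (eps0 k); exists (P, Q).
have [PQ hPQ] := choice hk.
pose P k := (PQ k).1; pose Q k := (PQ k).2.
have EP k : E (P k) by have [] := hPQ k.
have EQ k : E' (Q k) by have [] := hPQ k.
have hP k : L2 mu (P k) by exact/bundle_L2/EL.
have hQ k : L2 mu (Q k) by exact/bundle_L2/EL'.
have hS k : L2 mu (fun z => P k z + Q k z) by exact: L2D.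
have FS k : L2dist mu F (fun z => P k z + Q k z) < eps k by have [] := hPQ k.
have sub_le (X X' Y Y' : space -> R[i]) : E X -> E X' -> E' Y -> E' Y' ->
    L2dist mu X X' <= L2dist mu (fun z => X z + Y z) (fun z => X' z + Y' z).
  move=> EX EX' EY EY'.
  have EB : E (fun z => X z - X' z).
    have := El (-1) _ _ EX' EX; congr E; apply/funext => z; by rewrite mulN1r addrC.
  have EB' : E' (fun z => Y z - Y' z).
    have := El' (-1) _ _ EY' EY; congr E'; apply/funext => z; by rewrite mulN1r addrC.
  have hB := bundle_L2 (EL _ EB); have hB' := bundle_L2 (EL' _ EB').
  rewrite -ler_sqr ?nnegrE ?L2dist_ge0 // /L2dist !sqr_nrm.
  rewrite (_ : (fun z => X z + Y z - _) = (fun z => (X z - X' z) + (Y z - Y' z))); last first.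
    by apply/funext => z; rewrite opprD addrACA.
  have pyth U V : L2 mu U -> L2 mu V -> ip mu U V = 0 ->
      ip mu (fun z => U z + V z) (fun z => U z + V z) = ip mu U U + ip mu V V.
    move=> hU hV UV; have hUV := L2D hU hV.
    by rewrite ipDl // !ipDr // [ip mu V U]ipC UV addr0 add0r.
  by rewrite (pyth _ _ hB hB' (orthEE' EB EB')) lerDl ip_ge0.
have [k|P0 hP0 cP0] := L2_complete (bundle_measure_fin R n.+1) hP.
  apply: le_trans (sub_le _ _ _ _ (EP k) (EP k.+1) (EQ k) (EQ k.+1)) _.
  apply: le_trans (L2dist_triangle (hS k) hF (hS k.+1)) _; rewrite [X in X + _]L2distC.
  have h1 := FS k; have h2 := FS k.+1; move: h1 h2; rewrite /eps.
  have -> : 2 ^- k.+1 = 2 ^- k / 2 :> R by rewrite exprS invfM mulrC.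
  have : 0 < 2 ^- k :> R by rewrite invr_gt0 exprn_gt0.
  move: (L2dist _ _ _) (L2dist _ _ _) => a b; lra.
have [P' bP' P'P0] := periodize A_unit hP0.
have hP' := bundle_L2 bP'.
have P'P k : L2dist mu P' (P k) <= 2 * 2 ^- k.
  apply: le_trans (L2dist_triangle hP' hP0 (hP k)) _.
  by rewrite (ae_eq_L2dist hP' hP0 P'P0) add0r L2distC.
have small (e : R) : 0 < e -> exists k, 3 * 2 ^- k < e.
  move=> e0; have : 2 ^- k @[k --> \oo] --> (0 : R).
    under eq_fun do rewrite -exprVn.
    by apply: (@cvg_expr R 2^-1); rewrite ger0_norm ?invr_ge0 //; lra.
  have e3 : 0 < e / 3 by rewrite divr_gt0.
  move=> /cvgrPdist_lt /(_ _ e3) [k _ /(_ k (leqnn k))] /=.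
  rewrite sub0r normrN ger0_norm ?invr_ge0 ?exprn_ge0 // => ke.
  by exists k; move: ke; lra.
have pk k : 0 < 2 ^- k :> R by rewrite invr_gt0 exprn_gt0.
exists P', (fun z => F z - P' z); split.
- apply: closedE => // e /small[k ke]; exists (P k); first exact: EP.
  by apply: le_lt_trans (P'P k) _; move: (pk k) ke; lra.
- have bQ' : L2_bundle A (fun z => F z - P' z).
    have := L2_bundle_lin (-1) bP' bF; congr (L2_bundle A _).
    by apply/funext => z; rewrite mulN1r addrC.
  apply: closedE' => // e /small[k ke]; exists (Q k); first exact: EQ.
  have := L2dist_lin (-1) hP' hF (hP k) (hS k).
  rewrite (_ : (fun z => -1 * P' z + F z) = (fun z => F z - P' z)); last first.
    by apply/funext => z; rewrite mulN1r addrC.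
  rewrite (_ : (fun z => -1 * P k z + (P k z + Q k z)) = Q k); last first.
    by apply/funext => z; rewrite mulN1r addKr.
  move=> /le_lt_trans; apply.
  have -> : cdot (-1) (-1) = 1 :> R by rewrite /cdot /= oppr0 mulr0 addr0 mulrNN mulr1.
  rewrite sqrtr1 mul1r; have := P'P k; have := FS k; rewrite /eps.
  by move: (pk k) ke; move: (L2dist _ _ _) (L2dist _ _ _) (2 ^- k) => a b c; lra.
- by apply/funext => z; rewrite addrCA subrr addr0.
Qed.

End sum_of_orthogonal_subspaces.

Section decomposition.
Variables (R : realType) (n : nat) (A : 'M[int]_n.+1).
Hypothesis A_unit : A \in unitmx.
Variable rep : set 'cV[int]_n.+1 -> 'cV[int]_n.+1.
Hypothesis rep_orbit : forall o, orbits A o -> o (rep o).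
Local Notation space := (measurableTypeR R * 'cV[R]_n.+1)%type.
Local Notation mu := (bundle_measure R n.+1).
Local Notation act xi y := (A^T ^ xi *m y).
Local Notation H_y := (fun o => @H_infinite R n A (rep o)).
Local Notation H_t0_y := (fun o t0 => @H_finite R n A (rep o) t0).
Local Notation E_inf := (closed_sum A (infinite_orbits A) H_y).
Local Notation E_orb := (fun o => closed_sum A [set: int] (H_t0_y o)).
Local Notation E_fin := (closed_sum A (finite_orbits A) E_orb).

Lemma orbit_repE o : orbits A o -> lattice_orbit A (rep o) = o.
Proof. by move=> oo; exact: (orbit_mem A_unit oo (rep_orbit oo)). Qed.

(** Both orbits are the orbit of m. *)
Lemma orbits_disjoint o o' m : orbits A o -> orbits A o' -> o m -> o' m -> o = o'.
Proof.
by move=> oo oo' om om'; rewrite -(orbit_mem A_unit oo om) (orbit_mem A_unit oo' om').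
Qed.

Lemma H_y_subspace o : bundle_subspace A (H_y o).
Proof. exact: H_infinite_subspace. Qed.

Lemma H_y_mode_space o : infinite_orbits A o -> H_y o `<=` mode_space o.
Proof.
by move=> [oo _] F HF; have := H_infinite_mode_space HF; rewrite orbit_repE.
Qed.

Lemma fin_orbit_rep o : finite_orbits A o -> finite_set (lattice_orbit A (rep o)).
Proof. by move=> [oo fo]; rewrite orbit_repE. Qed.

Lemma H_t0_y_subspace o t0 : finite_orbits A o -> bundle_subspace A (H_t0_y o t0).
Proof. by move=> fo; have h := H_finite_subspace R A_unit (fin_orbit_rep fo) t0; exact: h. Qed.

Lemma E_orb_subspace o : finite_orbits A o -> bundle_subspace A (E_orb o).
Proof. by move=> fo; apply: closed_sum_subspace => t0 _; exact: H_t0_y_subspace. Qed.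

Lemma E_orb_mode_space o : finite_orbits A o -> E_orb o `<=` mode_space o.
Proof.
move=> fo; apply: closed_sum_mode_space => t0 _; first exact: H_t0_y_subspace.
move=> F HF; have := H_finite_mode_space HF.
by rewrite orbit_repE //; case: fo.
Qed.

Lemma E_inf_subspace : bundle_subspace A E_inf.
Proof. by apply: closed_sum_subspace => o _; exact: H_y_subspace. Qed.

Lemma E_fin_subspace : bundle_subspace A E_fin.
Proof. by apply: closed_sum_subspace => o; exact: E_orb_subspace. Qed.

(** The two sums involve frequencies in infinite orbits and in finite orbits respectively. *)
Lemma E_inf_E_fin_orthogonal F G : E_inf F -> E_fin G -> ip mu F G = 0.
Proof.
move=> EF EG.
apply: (@mode_space_orthogonal _ _ [set m | exists2 o, infinite_orbits A o & o m]
  [set m | exists2 o, finite_orbits A o & o m]).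
- move=> m [p [oo io] om] [p' [oo' fo'] om'].
  by apply: io; rewrite (orbits_disjoint oo oo' om om').
- apply: closed_sum_mode_space EF => [p _|p io]; first exact: H_y_subspace.
  apply: subset_trans (H_y_mode_space io) _.
  by apply: mode_spaceS => m om; exists p.
- apply: closed_sum_mode_space EG => [p|p fo]; first exact: E_orb_subspace.
  apply: subset_trans (E_orb_mode_space fo) _.
  by apply: mode_spaceS => m om; exists p.
Qed.

(** For f take the wave e^(2 pi i k s) cut off to the unit interval [xi0, xi0 + 1[: at a
   point of the open box only the term of index xi0 survives. *)
Lemma character_infinite o k m : infinite_orbits A o -> o m ->
  exists2 F, E_inf F & L2dist mu F (character k m) = 0.
Proof.
move=> io om; have [oo info] := io; move: om; rewrite -{1}(orbit_repE oo) => -[xi0 _ mE].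
pose I : set R := `[xi0%:~R, (xi0%:~R + 1)%R[%classic.
pose f (s : R) : R[i] := ((\1_I s : R))%:C%C * expi2pi (k%:~R * s).
have mI : measurable (I : set (measurableTypeR R)) by exact: measurable_itv.
have hf : L2 (@lebesgue_measure R) f.
  apply/L2P; split.
    apply: measCM; first exact: measC_indC.
    apply: measC_expi2pi; apply: measurable_funM; [exact: measurable_cst|exact: measurable_id].
  have := @integrable_indic_itv R xi0%:~R (xi0%:~R + 1) true true.
  apply: eq_integrable => // s _; congr EFin.
  rewrite /f cdotMM cdot_expi2pi mulr1 cdot_real indicE.
  by case: (s \in _); rewrite /= ?expr1n // expr0n.
have [F FS] : exists F, is_series_sum A (rep o) f F.
  by apply: (series_sum_exists A_unit) => //; rewrite orbit_repE.
have [bF cF] := iffLR (series_sumP A (rep o) F hf) FS.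
exists F.
  by apply: closed_sum_sub io _ => [p _|]; [exact: H_y_subspace|exists f].
apply/eqP; rewrite eq_le L2dist_ge0 andbT; apply/ler_addgt0Pr => e /cF[J0 hJ0].
rewrite add0r; have := hJ0 (xi0 |` J0)%fset (fsubsetU1 _ _).
set S := (fun z => \sum_(xi <- _) _) => FS'.
have hS : L2 mu S by apply: L2_sum => xi; exact: term_L2.
apply: le_trans (L2dist_triangle (bundle_L2 bF) hS (character_L2 _ k m)) _.
rewrite [X in _ + X]ae_eq_L2dist ?addr0 //; [exact: ltW|exact: character_L2|].
apply: filterS (ae_open_box R n.+1) => -[t x] [t01 _].
rewrite /S (bigD1_seq xi0) /= ?fset1U1 ?fset_uniq // big1_seq ?addr0 => [|xi /andP[ne _]].
  rewrite /series_term /f /= indicE mem_set; last first.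
    rewrite /I /= in_itv /=; move: t01 => /andP[/= t0 t1]; lra.
  by rewrite mul1r expi2pi_shift phaseE // mE characterE.
rewrite /series_term /f /= indicE memNset ?mul0r ?mul0r //.
rewrite /I /= in_itv /= => h; move/eqP: ne; apply.
have <- : Num.floor (t + xi%:~R) = xi.
  by apply: floor_def; rewrite intrD; move: t01 => /andP[/= t0 t1]; apply/andP; split; lra.
by apply: floor_def; rewrite intrD.
Qed.

End decomposition.

(** * Characters with frequency in a finite orbit *)

Section cyclic_approximation.
Variables (R : realType) (n : nat) (A : 'M[int]_n.+1) (y : 'cV[int]_n.+1).
Hypothesis A_unit : A \in unitmx.
Hypothesis fin_orbit : finite_set (lattice_orbit A y).
Local Notation space := (measurableTypeR R * 'cV[R]_n.+1)%type.
Local Notation mu := (bundle_measure R n.+1).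
Local Notation act xi y := (A^T ^ xi *m y).
Local Notation N := (orbit_size A y).
Local Notation E_y := (closed_sum A [set: int] (@H_finite R n A y)).

Let subH t0 : [set: int] t0 -> bundle_subspace A (@H_finite R n A y t0).
Proof. by move=> _; exact: H_finite_subspace. Qed.

Let N_gt0 : (0 < N)%N. Proof. by have [] := finite_orbitP A_unit fin_orbit. Qed.

Let N_neq0 : N%:R != 0 :> R. Proof. by rewrite pnatr_eq0 -lt0n. Qed.

Definition chars_N : set (R -> R[i]) := [set s | exists t0, s = char_N A y t0].

Lemma chars_N1 : chars_N (fun=> 1).
Proof. by exists 0; apply/funext => s; rewrite /char_N !mul0r expi2pi0. Qed.

Lemma chars_NM f g : chars_N f -> chars_N g -> chars_N (fun s => f s * g s).
Proof.
move=> [t0 ->] [t1 ->]; exists (t0 + t1); apply/funext => s.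
by rewrite /char_N -expi2piD intrD !mulrDl.
Qed.

(** The cyclic sum is linear in phi. *)
Lemma cyclic_sum_E (phi : R -> R[i]) : cspan chars_N phi -> E_y (cyclic_sum A y phi).
Proof.
have [_ E0 Elin] := closed_sum_subspace subH.
elim=> [|a s g [t0 ->] _ IH].
  rewrite (_ : cyclic_sum A y _ = fun=> 0) //; apply/funext => z.
  by rewrite /cyclic_sum big1 // => xi _; rewrite /series_term mul0r.
have h : E_y (cyclic_sum A y (fun s => 1 * char_N A y t0 s)).
  by apply: (closed_sum_sub subH (I : setT t0)); rewrite H_finiteE //; exists 1.
have := Elin a _ _ h IH; congr E_y; apply/funext => z.
rewrite /cyclic_sum mulr_sumr -big_split; apply: eq_bigr => xi _.
by rewrite /series_term mul1r mulrDl mulrA.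
Qed.

(** The trigonometric polynomial of [arc_superlevel] for the arc of length 1 / N, moved to
   start at xi0: in a period it is positive exactly on ]xi0, xi0 + 1[. *)
Definition window (xi0 : nat) (s : R) : R :=
  cos (2 * pi * ((s - xi0%:R) / N%:R - N%:R^-1 / 2)) - cos (pi / N%:R).

Lemma window_cspan xi0 : cspan chars_N (fun s => (window xi0 s)%:C%C).
Proof.
have c (k : int) : cspan chars_N (char_N A y k) by apply: cspan_sub; exists k.
pose b : R := xi0%:R / N%:R + N%:R^-1 / 2.
have h1 := cspanZ (2^-1 * expi2pi (- b)) (c 1).
have h2 := cspanZ (2^-1 * expi2pi b) (c (-1)).
have := cspan_lin (-1) (cspan_cst chars_N1 (cos (pi / N%:R))%:C%C) (cspanD h1 h2).
congr cspan; apply/funext => s; rewrite /window rmorphB /= cos_expi2pi mulN1r addrC.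
have -> : (s - xi0%:R) / N%:R - N%:R^-1 / 2 = s / N%:R - b by rewrite /b; field.
by rewrite /char_N mul1r mulN1r mulNr opprB ![expi2pi (_ - _)]expi2piD; congr (_ - _); ring.
Qed.

(** For xi < xi0 the argument is first moved by a full period into ]0, 1[. *)
Lemma window_sign (xi0 xi : nat) (t : R) : (xi0 < N)%N -> (xi < N)%N -> 0 < t < 1 ->
  (0 < window xi0 (t + xi%:R)) = (xi == xi0).
Proof.
move=> xi0N xiN /andP[t0 t1].
have N0 : 0 < N%:R :> R by rewrite ltr0n.
have Ni0 : 0 < (N%:R^-1 : R) <= 1 by rewrite invr_gt0 N0 invf_le1 // ler1n.
have xN : xi%:R + 1 <= N%:R :> R by rewrite natr1 ler_nat.
have x0N : xi0%:R + 1 <= N%:R :> R by rewrite natr1 ler_nat.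
have x0 : 0 <= xi%:R :> R by [].
have x00 : 0 <= xi0%:R :> R by [].
rewrite /window; set c := (_ - _) / _.
have [le|lt] := leqP xi0 xi.
  have le' : xi0%:R <= xi%:R :> R by rewrite ler_nat.
  rewrite arc_superlevel //; last first.
    by rewrite /c divr_gt0 ?ltr_pdivrMr // ?mul1r //=; lra.
  rewrite /c ltr_pdivrMr // mulVf //.
  have [->|ne] := eqVneq xi xi0; first by rewrite -addrA subrr addr0 t1.
  have : xi0%:R + 1 <= xi%:R :> R by rewrite natr1 ler_nat ltn_neqAle eq_sym ne.
  by move=> h; apply/negbTE; rewrite -leNgt; lra.
have lt' : xi%:R + 1 <= xi0%:R :> R by rewrite natr1 ler_nat.
have -> : cos (2 * pi * (c - N%:R^-1 / 2)) = cos (2 * pi * ((c + 1) - N%:R^-1 / 2)).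
  rewrite -[LHS]cosD2pi; congr cos; rewrite -mulr_natl; ring.
have cE : c + 1 = (t + xi%:R - xi0%:R + N%:R) / N%:R by rewrite /c; field.
rewrite arc_superlevel //; last first.
  by rewrite cE divr_gt0 ?ltr_pdivrMr // ?mul1r //=; lra.
rewrite cE ltr_pdivrMr // mulVf // (ltn_eqF lt).
by apply/negbTE; rewrite -leNgt; lra.
Qed.

Lemma cvg_sumR (s : seq 'I_N) (u : 'I_N -> nat -> R) :
  (forall i, u i k @[k --> \oo] --> (0 : R)) ->
  \sum_(i <- s) u i k @[k --> \oo] --> (0 : R).
Proof.
have z0 : \sum_(i <- s) 0 = 0 :> R by rewrite big1_eq.
move=> h; rewrite -[X in _ --> X]z0.
by apply: cvg_big => //; exact: add_continuous.
Qed.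

(** The wave e^(2 pi i k s) times functions approximating the indicator of the window is
   a sequence of trigonometric polynomials of period N. Its cyclic sums converge, at
   every point of the open box, to the term of index xi0 alone. *)
Lemma character_finite k m : lattice_orbit A y m ->
  exists2 F, E_y F & L2dist mu F (character k m) = 0.
Proof.
move=> [zeta _ mE]; have [_ yN yinj] := finite_orbitP A_unit fin_orbit.
have [xi0 xi0N zE] := act_modz A_unit zeta N_gt0 yN; rewrite zE in mE => {zeta zE}.
have hm : L2 mu (character k m) by exact: character_L2.
have [F bF Fm] := periodize A_unit hm.
have Fm0 : L2dist mu F (character k m) = 0 by exact: ae_eq_L2dist (bundle_L2 bF) hm Fm.
exists F => //; apply: (closed_sum_closed subH) => // e e0.
have wM s : `|window xi0 s| <= 2.
  by rewrite (le_trans (ler_normB _ _)) // (_ : 2 = 1 + 1) // lerD // norm_cos_le1.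
have [p [Sp p01 pw]] := cspan_superlevel chars_N1 chars_NM (window_cspan xi0) wM.
pose w s : R[i] := expi2pi (k%:~R * s).
have Sw : cspan chars_N w.
  apply: cspan_sub; exists (k * N%:Z); apply/funext => s.
  by rewrite /w /char_N intrM mulrAC mulfK.
pose phi j s := (p j s)%:C%C * w s.
have Sphi j : cspan chars_N (phi j) by have h := cspanM chars_NM (Sp j) Sw; exact: h.
pose F_ j := cyclic_sum A y (phi j).
have EF j : E_y (F_ j) by exact: cyclic_sum_E.
have hF j : L2 mu (F_ j).
  by have [EL _ _] := closed_sum_subspace subH; exact/bundle_L2/EL.
pose v (xi : 'I_N) (z : space) : R[i] :=
  w ((z.1 : R) + (xi : nat)%:R) * expi2pi (phase A y (xi : nat)%:Z z.2).
have v1 xi z : cdot (v xi z) (v xi z) = 1 by rewrite cdotMM !cdot_expi2pi mulr1.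
have vRe xi z : `|complex.Re (v xi z)| <= 1.
  rewrite -(@expr_le1 _ 2) // real_normK ?num_real // -(v1 xi z) /cdot -!expr2.
  by rewrite lerDl sqr_ge0.
have vIm xi z : `|complex.Im (v xi z)| <= 1.
  rewrite -(@expr_le1 _ 2) // real_normK ?num_real // -(v1 xi z) /cdot -!expr2.
  by rewrite lerDr sqr_ge0.
have F_E j z : F_ j z = \sum_(xi < N) (p j ((z.1 : R) + (xi : nat)%:R))%:C%C * v xi z.
  by apply: eq_bigr => xi _; rewrite /series_term /phi /v mulrA.
have ReM (r : R) (c : R[i]) : complex.Re (r%:C%C * c) = r * complex.Re c.
  by case: c => a b /=; rewrite mul0r subr0.
have ImM (r : R) (c : R[i]) : complex.Im (r%:C%C * c) = r * complex.Im c.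
  by case: c => a b /=; rewrite mul0r addr0.
have ReS (r : 'I_N -> R) (c : 'I_N -> R[i]) :
    complex.Re (\sum_(i < N) (r i)%:C%C * c i) = \sum_(i < N) r i * complex.Re (c i).
  by rewrite raddf_sum; apply: eq_bigr => i _; exact: ReM.
have ImS (r : 'I_N -> R) (c : 'I_N -> R[i]) :
    complex.Im (\sum_(i < N) (r i)%:C%C * c i) = \sum_(i < N) r i * complex.Im (c i).
  by rewrite raddf_sum; apply: eq_bigr => i _; exact: ImM.
(* A constant bound: both coordinates of a sum of N numbers of modulus at most 1 are
   at most N. *)
pose H : space -> R[i] := fun=> (2 * N%:R : R)%:C%C.
have hH : L2 mu H.
  apply: (@L2_bounded _ _ _ _ (bundle_measure_fin R n.+1) _ ((2 * N%:R) ^+ 2)).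
    exact: measC_cst.
  by move=> z; rewrite cdot_real.
have FH j z : cdot (F_ j z) (F_ j z) <= cdot (H z) (H z).
  have bnd (q : 'I_N -> R) : (forall xi, `|q xi| <= 1) ->
      (\sum_(xi < N) p j ((z.1 : R) + (xi : nat)%:R) * q xi) ^+ 2 <= N%:R ^+ 2.
    move=> q1; rewrite -real_normK ?num_real // ler_sqr ?nnegrE // (le_trans (ler_norm_sum _ _ _)) //.
    apply: (@le_trans _ _ (\sum_(xi < N) (1 : R))); last by rewrite sumr_const card_ord.
    apply: ler_sum => xi _; have /andP[p0 p1] := p01 j ((z.1 : R) + (xi : nat)%:R).
    by rewrite normrM ger0_norm // mulr_ile1.
  rewrite cdot_real /cdot -!expr2 F_E ReS ImS.
  have h1 := bnd _ (vRe^~ z); have h2 := bnd _ (vIm^~ z).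
  by rewrite exprMn; apply: le_trans (lerD h1 h2) _; have := sqr_ge0 (N%:R : R); lra.
have cF : {ae mu, forall z, cdot (F_ j z - character k m z) (F_ j z - character k m z)
    @[j --> \oo] --> (0 : R)}.
  apply: filterS (ae_open_box R n.+1) => z [t01 _].
  have dE j : F_ j z - character k m z = \sum_(xi < N)
      (p j ((z.1 : R) + (xi : nat)%:R) - (0 < window xi0 ((z.1 : R) + (xi : nat)%:R))%R%:R)%:C%C * v xi z.
    rewrite F_E; under [RHS]eq_bigr do rewrite rmorphB mulrBl.
    rewrite sumrB; congr (_ - _).
    rewrite (bigD1 (Ordinal xi0N)) //= window_sign // eqxx mul1r big1 ?addr0.
      rewrite characterE /v /w /= phaseE mE; congr (_ * _).
      by rewrite -(expi2pi_shift k xi0%:Z).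
    move=> xi ne; rewrite window_sign // (_ : (xi : nat) == xi0 = false) ?mul0r //.
    by apply/negbTE; apply: contra ne => /eqP h; apply/eqP/val_inj.
  have cvg0 (q : 'I_N -> R) : \sum_(xi < N)
      (p j ((z.1 : R) + (xi : nat)%:R) - (0 < window xi0 ((z.1 : R) + (xi : nat)%:R))%R%:R) * q xi
      @[j --> \oo] --> (0 : R).
    apply: cvg_sumR => xi; rewrite -[X in _ --> X](mul0r (q xi)); apply: cvgM; last exact: cvg_cst.
    rewrite -[X in _ --> X](subrr ((0 < window xi0 ((z.1 : R) + (xi : nat)%:R))%R%:R : R)).
    by apply: cvgB; [exact: pw|exact: cvg_cst].
  have cR := cvg0 (fun xi => complex.Re (v xi z)).
  have cI := cvg0 (fun xi => complex.Im (v xi z)).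
  have := cvgD (cvgM cR cR) (cvgM cI cI); rewrite mulr0 addr0 => cRI.
  by under eq_fun do rewrite dE /cdot ReS ImS; exact: cRI.
have [j Fj] := L2_dominated_cvg (fun j => L2_meas (hF j)) hm hH FH cF e0.
exists (F_ j) => //.
apply: le_lt_trans (L2dist_triangle (bundle_L2 bF) hm (hF j)) _.
by rewrite Fm0 add0r L2distC.
Qed.

End cyclic_approximation.

(** * The decomposition of L^2(M) *)

Theorem theorem5p8 (R : realType) (n : nat) (A : 'M[int]_n.+1)
    (A_unit : A \in unitmx)
    (rep : set 'cV[int]_n.+1 -> 'cV[int]_n.+1)
    (rep_orbit : forall o, orbits A o -> o (rep o)) :
  let H_y o := @H_infinite R n A (rep o) in
  let H_t0_y o t0 := @H_finite R n A (rep o) t0 in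
  let E_inf := closed_sum A (infinite_orbits A) H_y in
  let E_orb o := closed_sum A [set: int] (H_t0_y o) in
  let E_fin := closed_sum A (finite_orbits A) E_orb in
  [/\ forall o f, infinite_orbits A o -> L2 (@lebesgue_measure R) f ->
        exists F, is_series_sum A (rep o) f F,
      direct_family A (infinite_orbits A) H_y,
      forall o, finite_orbits A o -> direct_family A [set: int] (H_t0_y o),
      direct_family A (finite_orbits A) E_orb &
      (forall F, E_inf F -> E_fin F -> ae_zero (@bundle_measure R n.+1) F) /\
      @L2_bundle R n A =
        [set fun z => F z + G z | F in E_inf & G in E_fin]].
Proof.
move=> H_y H_t0_y E_inf E_orb E_fin.
have subinf : bundle_subspace A E_inf by exact: E_inf_subspace.
have subfin : bundle_subspace A E_fin by exact: E_fin_subspace.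
have [ELinf _ _] := subinf; have [ELfin _ _] := subfin.
have orth F G : E_inf F -> E_fin G -> ip (bundle_measure R n.+1) F G = 0.
  exact: E_inf_E_fin_orthogonal.
have subH o : infinite_orbits A o -> bundle_subspace A (H_y o).
  by move=> _; exact: H_y_subspace.
have subO o : finite_orbits A o -> bundle_subspace A (E_orb o).
  exact: E_orb_subspace.
split.
- move=> o f io hf; have [oo info] := io; apply: (series_sum_exists A_unit) hf.
  by rewrite (orbit_repE A_unit rep_orbit oo).
- apply: direct_of_orthogonal => // o o' F G io io' ne HF HG.
  apply: (@mode_space_orthogonal _ _ o o') => [m om om'| |].
  + by case: io io' => oo _ [oo' _]; move/eqP: ne; apply; exact: orbits_disjoint oo oo' om om'.
  + exact: (H_y_mode_space A_unit rep_orbit io).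
  + exact: (H_y_mode_space A_unit rep_orbit io').
- move=> o fo; apply: direct_of_orthogonal => [t0 _|t0 t1 F G _ _ ne HF HG].
    exact: (H_t0_y_subspace R A_unit rep_orbit t0 fo).
  exact: (H_finite_orthogonal A_unit (fin_orbit_rep A_unit rep_orbit fo) ne HF HG).
- apply: direct_of_orthogonal => // o o' F G fo fo' ne HF HG.
  apply: (@mode_space_orthogonal _ _ o o') => [m om om'| |].
  + by case: fo fo' => oo _ [oo' _]; move/eqP: ne; apply; exact: orbits_disjoint oo oo' om om'.
  + exact: (E_orb_mode_space A_unit rep_orbit fo).
  + exact: (E_orb_mode_space A_unit rep_orbit fo').
split.
  move=> F EF EF'; apply/(L2_ae_zero (bundle_L2 (ELinf _ EF))).
  by rewrite /nrm orth // sqrtr0.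
have closedinf := closed_sum_closed subH.
have closedfin := closed_sum_closed subO.
have osumE : orthogonal_sum E_inf E_fin = [set fun z => F z + G z | F in E_inf & G in E_fin].
  apply/seteqP; split=> [_ [P [Q [EP EQ ->]]]|_ [P EP [Q EQ <-]]].
    by exists P => //; exists Q.
  by exists P, Q.
rewrite -osumE; apply/seteqP; split=> [F bF|F]; last exact: orthogonal_sum_bundle.
have osum_cl := orthogonal_sum_closed A_unit subinf subfin closedinf closedfin orth.
apply: osum_cl => // e e0; have hF := bundle_L2 bF.
(* As the sum is closed, it is enough to change a combination S of characters near F into
   an element of the sum at distance zero from S, one character at a time. *)
have [_ /(_ _ e0)[S chS FS]] := characters_dense hF.
suff [S' oS' SS'] : exists2 S', orthogonal_sum E_inf E_fin S' &
  L2dist (bundle_measure R n.+1) S' S = 0.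
  exists S' => //; have hS' := bundle_L2 (orthogonal_sum_bundle subinf subfin oS').
  have hS : L2 (bundle_measure R n.+1) S.
    elim: chS => [|a s g [k [m ->]] _ IH]; first exact: L2_0.
    by apply: L2D => //; apply: L2Z; exact: character_L2.
  apply: le_lt_trans (L2dist_triangle hF hS hS') _.
  by rewrite [X in _ + X]L2distC SS' addr0.
elim: chS => [|a s g [k [m ->]] cg [g' og' gg']].
  exists (fun=> 0); last exact: L2distxx.
  by have [_ E0 _] := subinf; exact: (orthogonal_sum_subl subfin E0).
have [c oc cc] : exists2 c, orthogonal_sum E_inf E_fin c &
  L2dist (bundle_measure R n.+1) c (character k m) = 0.
  pose o := lattice_orbit A m.
  have oo : orbits A o by exists m.
  have om : o m by exact: lattice_orbit_refl.
  have [fo|io] := pselect (finite_set o).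
    have om' : lattice_orbit A (rep o) m by rewrite (orbit_repE A_unit rep_orbit oo).
    have fo' : finite_set (lattice_orbit A (rep o)) by rewrite (orbit_repE A_unit rep_orbit oo).
    have [c Ec cm] := character_finite R A_unit fo' k om'; exists c => //.
    exact: (orthogonal_sum_subr subinf (closed_sum_sub subO (conj oo fo) Ec)).
  have [c Ec cm] := character_infinite R A_unit rep_orbit k (conj oo io) om.
  by exists c => //; exact: (orthogonal_sum_subl subfin Ec).
have hg : L2 (bundle_measure R n.+1) g.
  elim: cg {gg' F S FS bF hF} => [|b s' g0 [k' [m' ->]] _ IH]; first exact: L2_0.
  by apply: L2D => //; apply: L2Z; exact: character_L2.
exists (fun z => a * c z + g' z); first exact: (orthogonal_sum_lin subinf subfin a oc og').
apply/eqP; rewrite eq_le L2dist_ge0 andbT.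
have hc := bundle_L2 (orthogonal_sum_bundle subinf subfin oc).
have hg' := bundle_L2 (orthogonal_sum_bundle subinf subfin og').
apply: le_trans (L2dist_lin a hc hg' (character_L2 _ k m) hg) _.
by rewrite cc gg' mulr0 addr0.
Qed.
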